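(* Let $\Bbbk$ be an algebraically closed field of characteristic $0$, let $\mathfrak g$ be a finite-dimensional simple Lie algebra over $\Bbbk$ and let $\sigma\in\operatorname{Aut}(\mathfrak g)$ be an automorphism coming from an automorphism of the Dynkin diagram of $\mathfrak g$. (1) The enveloping algebra $U(\mathfrak g[t]^\sigma)$ has just-infinite growth. That is, if $J$ is a nonzero ideal of $U(\mathfrak g[t]^\sigma)$, then $U(\mathfrak g[t]^\sigma)/J$ has polynomial growth. (2) Let $I$ be a nonzero Poisson ideal of $S(\mathfrak g[t]^\sigma)$. Then $S(\mathfrak g[t]^\sigma)/I$ has polynomial growth.
   Context: Let $r$ be the order of $\sigma$, let $\eta$ be a primitive $r$-th root of unity, and for $s\in\mathbb Z$ let $\overline s$ be its class mod $r$ and $\mathfrak g_{\overline s}=\{g\in\mathfrak g:\sigma(g)=\eta^s g\}$. The twisted current algebra is $\mathfrak g[t]^\sigma=\bigoplus_{s\ge0}\mathfrak g_{\overline s}t^s\subseteq\mathfrak g[t]$ ($=\mathfrak g[t]$ when $\sigma=\mathrm{id}$), with bracket $[xt^a,yt^b]=[x,y]t^{a+b}$. For a Lie algebra $\mathfrak k$, $S(\mathfrak k)$ carries the Kostant-Kirillov Poisson bracket determined by $\{x,y\}=[x,y]$ for $x,y\in\mathfrak k$. A Poisson ideal is an ideal which is also a Lie ideal for the Poisson bracket. A $\Bbbk$-algebra $R$ has polynomial growth if there is a polynomial $p(t)\in\mathbb R[t]$ such that for every finite-dimensional subspace $V\subseteq R$, $\dim V^n\le p(n)$ for all sufficiently large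 $n$; equivalently $\operatorname{GKdim}R=\sup_V\limsup_n\log_n\dim V^n<\infty$. $R$ has just-infinite growth if $\operatorname{GKdim}R=\infty$ but $\operatorname{GKdim}R/J<\infty$ for every nonzero two-sided ideal $J$. *)

(* Defs.v *)
From HB Require Import structures.
From mathcomp Require Import all_boot all_order all_algebra.
From mathcomp Require Import generic_quotient ring_quotient perm.
From mathcomp Require Import all_classical all_reals all_analysis.
From mathcomp Require monalg.
(* The notations of [monalg] clash with those of mathcomp-analysis. *)
Import -(notations) monalg.

Set Implicit Arguments.
Unset Strict Implicit.
Unset Printing Implicit Defensive.

Import Order.TTheory GRing.Theory Num.Theory.
Local Open Scope classical_set_scope.
Local Open Scope ring_scope.

(** * Associative unital algebras, possibly zero *)

(* MathComp's [algType] excludes the zero algebra, but a quotient by an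
   arbitrary two-sided ideal may be zero.  Hence a k-algebra is a possibly zero
   ring with a central ring morphism from k, whose scaling is x |-> c%:K * x. *)
HB.mixin Record isPzAlgebra (k : fieldType) A of GRing.PzRing A := {
  kcst : k -> A;
  kcst1 : kcst 1 = 1;
  kcstB : forall c d, kcst (c - d) = kcst c - kcst d;
  kcstM : forall c d, kcst (c * d) = kcst c * kcst d;
  kcstC : forall c x, kcst c * x = x * kcst c
}.

#[short(type="pzAlgType")]
HB.structure Definition PzAlgebra (k : fieldType) :=
  {A of GRing.PzRing A & isPzAlgebra k A}.

Notation "c %:K" := (kcst c) (at level 1, format "c %:K") : ring_scope.

Section Ideals.
Context {k : fieldType} {A : pzAlgType k}.

Definition two_sided_ideal (I : set A) : Prop :=
  [/\ I 0,
      forall x y, I x -> I y -> I (x - y),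
      forall a x, I x -> I (a * x) &
      forall a x, I x -> I (x * a)].

Record ideal := Ideal { ideal_set :> A -> Prop; idealP : two_sided_ideal ideal_set }.

Definition nonzero_ideal (I : ideal) : Prop := exists2 x, I x & x != 0.

Lemma ideal_gen_subproof (G : set A) :
  two_sided_ideal (smallest two_sided_ideal G).
Proof.
split=> [|x y Ix Iy|a x Ix|a x Ix] J /[dup] JP [[J0 JB Jl Jr] _] //.
- by apply: JB; [exact: Ix|exact: Iy].
- by apply: Jl; exact: Ix.
- by apply: Jr; exact: Ix.
Qed.

Definition ideal_gen (G : set A) : ideal := Ideal (ideal_gen_subproof G).

Definition ideal_pred (I : ideal) : {pred A} := fun x => `[< I x >].

Lemma ideal_pred_zmod_closed (I : ideal) : zmod_closed (ideal_pred I).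
Proof.
case: (idealP I) => I0 IB _ _; split; first exact/asboolP.
by move=> x y /asboolP Ix /asboolP Iy; apply/asboolP; exact: IB.
Qed.

HB.instance Definition _ (I : ideal) :=
  GRing.isZmodClosed.Build A (ideal_pred I) (ideal_pred_zmod_closed I).

End Ideals.
Arguments ideal {k} A.

Section Quotient.
Context {k : fieldType} {A : pzAlgType k} (I : ideal A).
Local Open Scope quotient_scope.

(* The additive group of the quotient is MathComp's [Quotient.quot]. *)
Definition quot_alg : Type := Quotient.quot (ideal_pred I).
HB.instance Definition _ := GRing.Zmodule.on quot_alg.

Definition quot_pi (x : A) : quot_alg := \pi_(Quotient.quot (ideal_pred I)) x.
Definition quot_repr (x : quot_alg) : A :=
  repr (x : Quotient.quot (ideal_pred I)).

Lemma quot_reprK : cancel quot_repr quot_pi. Proof. exact: reprK. Qed.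

Lemma quot_piP x y : quot_pi x = quot_pi y <-> I (x - y).
Proof.
have := Quotient.idealrBE (ideal_pred I) x y => E.
split=> [/eqP|Ixy]; first by rewrite /quot_pi -E => /asboolP.
by apply/eqP; rewrite /quot_pi -E; apply/asboolP.
Qed.

Lemma quot_piD x y : quot_pi (x + y) = quot_pi x + quot_pi y.
Proof. by rewrite /quot_pi !piE. Qed.

Lemma quot_ind (P : quot_alg -> Prop) : (forall x, P (quot_pi x)) -> forall x, P x.
Proof. by move=> Px x; rewrite -[x]quot_reprK. Qed.

Definition quot_mul (x y : quot_alg) : quot_alg :=
  quot_pi (quot_repr x * quot_repr y).

Lemma quot_repr_pi x : I (quot_repr (quot_pi x) - x).
Proof. by apply/quot_piP; rewrite quot_reprK. Qed.

Lemma quot_piM x y : quot_mul (quot_pi x) (quot_pi y) = quot_pi (x * y).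
Proof.
case: (idealP I) => I0 IB Il Ir.
apply/quot_piP; set x' := quot_repr (quot_pi x); set y' := quot_repr (quot_pi y).
have -> : x' * y' - x * y = x' * (y' - y) - (- (x' - x)) * y.
  by rewrite mulrBr mulNr mulrBl opprK addrA subrK.
apply: (IB); first exact: Il (quot_repr_pi _).
by apply: Ir; rewrite -[- _]sub0r; apply: IB => //; exact: quot_repr_pi.
Qed.

Let mulA : associative quot_mul.
Proof. by do 3![elim/quot_ind=> ?]; rewrite !quot_piM mulrA. Qed.
Let mul1 : left_id (quot_pi 1) quot_mul.
Proof. by elim/quot_ind=> ?; rewrite quot_piM mul1r. Qed.
Let mulr1' : right_id (quot_pi 1) quot_mul.
Proof. by elim/quot_ind=> ?; rewrite quot_piM mulr1. Qed.
Let mulDl : left_distributive quot_mul +%R.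
Proof.
by do 3![elim/quot_ind=> ?]; rewrite -quot_piD !quot_piM -quot_piD mulrDl.
Qed.
Let mulDr : right_distributive quot_mul +%R.
Proof.
by do 3![elim/quot_ind=> ?]; rewrite -quot_piD !quot_piM -quot_piD mulrDr.
Qed.

HB.instance Definition _ :=
  GRing.Zmodule_isPzRing.Build quot_alg mulA mul1 mulr1' mulDl mulDr.

Let cst1 : quot_pi 1%:K = 1. Proof. by rewrite kcst1. Qed.
Let cstB (c d : k) : quot_pi (c - d)%:K = quot_pi c%:K - quot_pi d%:K.
Proof. by apply/eqP; rewrite eq_sym subr_eq -quot_piD kcstB subrK. Qed.
Let cstM (c d : k) : quot_pi (c * d)%:K = quot_pi c%:K * quot_pi d%:K.
Proof. by rewrite kcstM -quot_piM. Qed.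
Let cstC (c : k) (x : quot_alg) : quot_pi c%:K * x = x * quot_pi c%:K.
Proof.
elim/quot_ind: x => x.
change (quot_mul (quot_pi c%:K) (quot_pi x) =
        quot_mul (quot_pi x) (quot_pi c%:K)).
by rewrite !quot_piM kcstC.
Qed.

HB.instance Definition _ := isPzAlgebra.Build k quot_alg cst1 cstB cstM cstC.

End Quotient.

(** * Growth *)

Section Subspaces.
Context {k : fieldType} {A : pzAlgType k}.

Definition subspace (V : set A) : Prop :=
  V 0 /\ forall (c : k) x y, V x -> V y -> V (c%:K * x + y).

Definition lspan (X : set A) : set A := smallest subspace X.

Definition fin_dim (V : set A) : Prop := exists s : seq A, V = lspan [set` s].

Definition lin_indep d (b : d.-tuple A) : Prop :=
  forall c : 'I_d -> k, \sum_i (c i)%:K * tnth b i = 0 -> forall i, c i = 0.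

(* The common length of the bases of a finite-dimensional V (0 otherwise). *)
Definition sdim (V : set A) : nat :=
  get [set d | exists2 b : d.-tuple A, lin_indep b & V = lspan [set` b]].

End Subspaces.

Section Growth.
Context {k : fieldType}.

Definition mulS {A : pzAlgType k} (V W : set A) : set A :=
  lspan [set x * y | x in V & y in W].

Definition expS {A : pzAlgType k} (V : set A) (n : nat) : set A :=
  iter n (mulS V) (lspan [set 1]).

Definition polynomial_growth (R : realType) (A : pzAlgType k) : Prop :=
  exists p : {poly R}, forall V : set A, fin_dim V ->
    \forall n \near \oo, (sdim (expS V n))%:R <= p.[n%:R].

(* The extended logarithm [lne] gives log_n 0 = -oo. *)
Definition GKdim (R : realType) (A : pzAlgType k) : \bar R :=
  ereal_sup
    [set limn_esup (fun n : nat =>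
           (lne ((sdim (expS V n))%:R)%:E * ((ln n%:R)^-1)%:E)%E)
    | V in [set V : set A | fin_dim V]].

Definition just_infinite_growth (R : realType) (A : pzAlgType k) : Prop :=
  GKdim R A = +oo%E /\
  forall J : ideal A, nonzero_ideal J -> (GKdim R (quot_alg J) < +oo)%E.

End Growth.

(** * Lie algebras *)

HB.mixin Record isLie (k : fieldType) L of GRing.Lmodule k L := {
  lie : L -> L -> L;
  lieDZl : forall (c : k) (x y z : L), lie (c *: x + y) z = c *: lie x z + lie y z;
  lieDZr : forall (c : k) (x y z : L), lie z (c *: x + y) = c *: lie z x + lie z y;
  liexx : forall x : L, lie x x = 0;
  lie_jacobi : forall x y z : L,
    lie x (lie y z) + lie y (lie z x) + lie z (lie x y) = 0
}.

#[short(type="lieType")]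
HB.structure Definition Lie (k : fieldType) :=
  {L of GRing.Lmodule k L & isLie k L}.

#[short(type="finDimLieType")]
HB.structure Definition FinDimLie (k : fieldType) :=
  {L of Lie k L & Vector k L}.

Section LieTheory.
Context {k : fieldType} {L : lieType k}.
Implicit Types x y z : L.

Lemma lie_is_linear x : linear (lie x).
Proof. by move=> c y z; rewrite lieDZr. Qed.
HB.instance Definition _ x := GRing.isLinear.Build k L L _ (lie x) (lie_is_linear x).

Lemma lier_is_linear y : linear (fun x => lie x y).
Proof. by move=> c x z; rewrite lieDZl. Qed.

Lemma lieDl x y z : lie (x + y) z = lie x z + lie y z.
Proof. by have := lieDZl 1 x y z; rewrite !scale1r. Qed.
Lemma lie0l z : lie (0 : L) z = 0.
Proof. by apply: (addrI (lie 0 z)); rewrite -lieDl !addr0. Qed.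
Lemma lieZl c x z : lie (c *: x) z = c *: lie x z.
Proof. by have := lieDZl c x 0 z; rewrite lie0l !addr0. Qed.
Lemma lieC x y : lie x y = - lie y x.
Proof.
apply/eqP; rewrite -addr_eq0; apply/eqP.
by have := liexx (x + y); rewrite raddfD /= !lieDl !liexx add0r addr0 addrC.
Qed.
Lemma lie_suml n (F : 'I_n -> L) z : lie (\sum_i F i) z = \sum_i lie (F i) z.
Proof. by elim/big_ind2: _ => [|? ? ? ? <- <-|//]; rewrite ?lie0l ?lieDl. Qed.

End LieTheory.

Record lie_aut {k : fieldType} (L : lieType k) := LieAut {
  aut_fun :> {linear L -> L};
  aut_bij : bijective aut_fun;
  aut_lie : forall x y, aut_fun (lie x y) = lie (aut_fun x) (aut_fun y)
}.

Definition aut_order {k : fieldType} {L : lieType k} (s : lie_aut L) (r : nat) : Prop :=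
  [/\ (0 < r)%N, iter r s =1 id &
      forall m, (0 < m < r)%N -> ~ (iter m s =1 id)].

Section FinDimLieTheory.
Context {k : fieldType} {g : finDimLieType k}.
Implicit Types (U V H I : {vspace g}).

Definition simple_lie : Prop :=
  (exists x y : g, lie x y != 0) /\
  forall I, (forall x y, y \in I -> lie x y \in I) -> I = 0%VS \/ I = fullv.

Definition lie_vspace U V : {vspace g} :=
  <<[seq lie x y | x <- vbasis U, y <- vbasis V]>>%VS.

(* Subalgebra, nilpotent (via the lower central series), self-normalizing. *)
Definition cartan_subalgebra H : Prop :=
  [/\ (lie_vspace H H <= H)%VS,
      exists n, iter n (lie_vspace H) H = 0%VS &
      forall x, (forall h, h \in H -> lie x h \in H) -> x \in H].

(* Linear forms on H. *)
Local Notation dual H := ('Hom(subvs_of H, (k^o : vectType k))).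

Definition weight_vector H (a : dual H) (x : g) : Prop :=
  forall h : subvs_of H, lie (vsval h) x = (a h : k) *: x.

Definition is_root H (a : dual H) : Prop :=
  a != 0 /\ exists2 x, x != 0 & weight_vector a x.

Definition root_basis H l (a : l.-tuple (dual H)) : Prop :=
  [/\ free a,
      forall i, is_root (tnth a i) &
      forall b : dual H, is_root b -> exists n : 'I_l -> nat,
        b = \sum_i tnth a i *+ n i \/ b = - \sum_i tnth a i *+ n i].

(* A Cartan subalgebra, a basis of simple roots, and Chevalley generators. *)
Record pinning := Pinning {
  pin_H : {vspace g};
  pin_l : nat;
  pin_root : pin_l.-tuple (dual pin_H);
  pin_e : 'I_pin_l -> g;
  pin_f : 'I_pin_l -> g;
  pin_h : 'I_pin_l -> subvs_of pin_H;
  pin_cartan : cartan_subalgebra pin_H;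
  pin_root_basis : root_basis pin_root;
  pin_weight_e : forall i, weight_vector (tnth pin_root i) (pin_e i);
  pin_weight_f : forall i, weight_vector (- tnth pin_root i) (pin_f i);
  pin_ef : forall i, lie (pin_e i) (pin_f i) = vsval (pin_h i);
  pin_coroot : forall i, tnth pin_root i (pin_h i) = 2%:R
}.

(* The entries of the Cartan matrix, i.e. the data encoded by the Dynkin
   diagram, seen in k (which will have characteristic 0). *)
Definition cartan_int (P : pinning) (i j : 'I_(pin_l P)) : k :=
  tnth (pin_root P) j (pin_h i).

Definition diagram_aut (P : pinning) (p : 'S_(pin_l P)) : Prop :=
  forall i j, cartan_int (p i) (p j) = cartan_int i j.

Definition from_diagram_aut (s : lie_aut g) : Prop :=
  exists (P : pinning) (p : 'S_(pin_l P)), diagram_aut p /\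
    forall i, s (pin_e i) = pin_e (p i) /\ s (pin_f i) = pin_f (p i).

End FinDimLieTheory.
Arguments simple_lie {k} g.

(** * Twisted current algebras *)

Section TwistedCurrent.
Context {k : fieldType} {g : lieType k} (s : lie_aut g) (eta : k).

(* The sequence u stands for \sum_n (u n) t^n.  The n-th coefficient is
   required to be in the eta^n-eigenspace of s, and the n-th coefficient of a
   bracket is given by [x t^a, y t^b] = [x, y] t^(a+b). *)
Definition twisted_pred : {pred nat -> g} := fun u =>
  `[< (exists N, forall n, (N <= n)%N -> u n = 0) /\
      forall n, s (u n) = eta ^+ n *: u n >].

Lemma twisted_submod_closed : submod_closed twisted_pred.
Proof.
split; first by apply/asboolP; split=> [|n]; [by exists 0%N|rewrite linear0 scaler0].
move=> c u v /asboolP[[M Mu] su] /asboolP[[N Nv] sv]; apply/asboolP; split.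
  exists (maxn M N) => n; rewrite geq_max => /andP[Mn Nn].
  change (c *: u n + v n = 0).
  by rewrite Mu // Nv // scaler0 addr0.
move=> n; change (s (c *: u n + v n) = eta ^+ n *: (c *: u n + v n)).
by rewrite linearP /= su sv scalerDr !scalerA mulrC.
Qed.

HB.instance Definition _ :=
  GRing.isSubmodClosed.Build k (nat -> g) twisted_pred twisted_submod_closed.

Record twisted_current := TwistedCurrent {
  tc_coef :> nat -> g;
  tc_coefP : tc_coef \in twisted_pred
}.

HB.instance Definition _ := [isSub for tc_coef].
HB.instance Definition _ := [Choice of twisted_current by <:].
HB.instance Definition _ := [SubChoice_isSubLmodule of twisted_current by <:].

Definition tc_bracket_coef (u v : nat -> g) (n : nat) : g :=
  \sum_(i < n.+1) lie (u i) (v (n - i)%N).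

Lemma tc_bracketP (u v : twisted_current) :
  tc_bracket_coef u v \in twisted_pred.
Proof.
case: u v => u /= /asboolP[[M Mu] su] [v /= /asboolP[[N Nv] sv]].
apply/asboolP; split=> [|n].
  exists (M + N)%N => n MNn; apply: big1 => i _.
  have [Mi|iM] := leqP M i; first by rewrite Mu // lie0l.
  rewrite Nv ?raddf0 // leq_subRL; last by rewrite -ltnS.
  by rewrite (leq_trans _ MNn) // leq_add2r ltnW.
rewrite linear_sum scaler_sumr; apply: eq_bigr => i _.
rewrite aut_lie su sv lieZl linearZ /= scalerA -exprD subnKC //.
by rewrite -ltnS.
Qed.

Definition tc_bracket (u v : twisted_current) : twisted_current :=
  TwistedCurrent (tc_bracketP u v).

Lemma tc_bracket_coefE (u v : nat -> g) n N : (n < N)%N ->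
  tc_bracket_coef u v n =
  \sum_(i < N) \sum_(j < N | (i + j == n)%N) lie (u i) (v j).
Proof.
move=> nN; rewrite /tc_bracket_coef (big_ord_widen _ (fun i => lie (u i) (v (n - i)%N)) nN).
rewrite big_mkcond; apply: eq_bigr => i _; rewrite ltnS; case: ifPn => [le_in|].
  have ltN : (n - i < N)%N by rewrite (leq_ltn_trans (leq_subr _ _)).
  rewrite (big_pred1 (Ordinal ltN)) // => j /=.
  by rewrite -val_eqE /= -(eqn_add2l i (j : nat)) subnKC.
rewrite -ltnNge => lt_ni; rewrite big_pred0 // => j.
by apply/negbTE; rewrite neq_ltn (leq_trans lt_ni (leq_addr _ _)) orbT.
Qed.

Lemma tc_bracket_coefxx (u : nat -> g) n : tc_bracket_coef u u n = 0.
Proof.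
rewrite (tc_bracket_coefE _ _ (ltnSn n)) pair_big_dep /=.
rewrite (bigID (fun p : 'I_n.+1 * 'I_n.+1 => p.1 < p.2)%N) /= [X in _ + X](bigID (fun p : 'I_n.+1 * 'I_n.+1 => p.2 < p.1)%N) /=.
rewrite [X in _ + (_ + X)]big1 ?addr0 => [|[i j] /= /andP[/andP[_]]]; last first.
  by rewrite -!leqNgt => ji ij; rewrite (@anti_leq i j) ?liexx // ij.
rewrite [X in _ + X](reindex_inj (h := fun p : 'I_n.+1 * 'I_n.+1 => (p.2, p.1))) /=; last first.
  by move=> [? ?] [? ?] [-> ->].
rewrite [X in _ + X](eq_bigl
  (fun p : 'I_n.+1 * 'I_n.+1 => (p.1 + p.2 == n)%N && (p.1 < p.2)%N)); last first.
  by case=> i j /=; rewrite addnC; case: ltngtP; rewrite ?andbF ?andbT.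
by rewrite -big_split big1 // => p _ /=; rewrite [X in X + _]lieC addNr.
Qed.

Lemma tc_bracket_coef3E (u v w : nat -> g) n :
  tc_bracket_coef u (tc_bracket_coef v w) n =
  \sum_(a < n.+1) \sum_(b < n.+1) \sum_(c < n.+1)
    if (a + b + c == n)%N then lie (u a) (lie (v b) (w c)) else 0.
Proof.
apply: eq_bigr => a _; rewrite (@tc_bracket_coefE _ _ _ n.+1) ?ltnS ?leq_subr //.
rewrite raddf_sum; apply: eq_bigr => b _; rewrite raddf_sum.
rewrite big_mkcond; apply: eq_bigr => c _ /=.
have le_an : (a <= n)%N by rewrite -ltnS.
by rewrite -(eqn_add2l a) subnKC // addnA.
Qed.

Lemma tc_jacobi_coef (u v w : nat -> g) n :
  tc_bracket_coef u (tc_bracket_coef v w) n +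
  tc_bracket_coef v (tc_bracket_coef w u) n +
  tc_bracket_coef w (tc_bracket_coef u v) n = 0.
Proof.
rewrite !tc_bracket_coef3E.
under [X in _ + X + _]eq_bigr do rewrite exchange_big /=.
rewrite [X in _ + X + _]exchange_big /= [X in _ + X]exchange_big /=.
under [X in _ + X]eq_bigr do rewrite exchange_big /=.
rewrite -!big_split big1 // => a _; rewrite -!big_split big1 // => b _.
rewrite -!big_split big1 // => c _ /=.
have -> : (b + c + a = a + b + c)%N by rewrite addnC addnA.
have -> : (c + a + b = a + b + c)%N by rewrite -addnA addnC.
case: ifP; rewrite ?lie_jacobi ?addr0 //.
Qed.

Let tc_ext (u v : twisted_current) : (forall n, u n = v n) -> u = v.
Proof. by move=> uv; apply/val_inj/funext. Qed.

Let lieDZl' (c : k) (x y z : twisted_current) :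
  tc_bracket (c *: x + y) z = c *: tc_bracket x z + tc_bracket y z.
Proof.
apply: tc_ext => n.
change (tc_bracket_coef (fun i => c *: x i + y i) z n =
        c *: tc_bracket_coef x z n + tc_bracket_coef y z n).
rewrite /tc_bracket_coef scaler_sumr -big_split.
by apply: eq_bigr => i _; rewrite lieDZl.
Qed.
Let lieDZr' (c : k) (x y z : twisted_current) :
  tc_bracket z (c *: x + y) = c *: tc_bracket z x + tc_bracket z y.
Proof.
apply: tc_ext => n.
change (tc_bracket_coef z (fun i => c *: x i + y i) n =
        c *: tc_bracket_coef z x n + tc_bracket_coef z y n).
rewrite /tc_bracket_coef scaler_sumr -big_split.
by apply: eq_bigr => i _; rewrite lieDZr.
Qed.
Let liexx' (x : twisted_current) : tc_bracket x x = 0.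
Proof. by apply: tc_ext => n; exact: tc_bracket_coefxx. Qed.
Let lie_jacobi' (x y z : twisted_current) :
  tc_bracket x (tc_bracket y z) + tc_bracket y (tc_bracket z x) +
  tc_bracket z (tc_bracket x y) = 0.
Proof. by apply: tc_ext => n; exact: tc_jacobi_coef. Qed.

HB.instance Definition _ :=
  isLie.Build k twisted_current lieDZl' lieDZr' liexx' lie_jacobi'.

End TwistedCurrent.

(** * Tensor, enveloping and symmetric algebras *)

Section FreeAlgebra.
Context (k : fieldType) (X : choiceType).

(* The algebra of the free monoid on X. *)
Definition free_alg : Type := malg (fmonom X) k.
HB.instance Definition _ := GRing.NzRing.on free_alg.

Definition free_gen (x : X) : free_alg := mkmalgU (fmu x) 1.

Definition free_cst (c : k) : free_alg := mkmalgU mone c.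

Let cst1 : free_cst 1 = 1. Proof. by []. Qed.
Let cstB c d : free_cst (c - d) = free_cst c - free_cst d.
Proof. exact: raddfB. Qed.
Let cstM c d : free_cst (c * d) = free_cst c * free_cst d.
Proof. exact: mpolyCM. Qed.
Let cstC c (x : free_alg) : free_cst c * x = x * free_cst c.
Proof.
rewrite /free_cst !malgM_def fgmulUg fgmulgU.
by apply: eq_bigr => m _; rewrite mul1m mulm1 mulrC.
Qed.

HB.instance Definition _ := isPzAlgebra.Build k free_alg cst1 cstB cstM cstC.

End FreeAlgebra.

Section TensorAlgebra.
Context {k : fieldType} (V : lmodType k).

(* Freely generated by the elements of V, modulo the linear relations. *)
Definition tensor_rel : set (free_alg k V) :=
  [set t | exists (c : k) (x y : V), t =
    free_gen k (c *: x + y) - (c%:K * free_gen k x + free_gen k y)].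

Definition tensor_alg : pzAlgType k := quot_alg (ideal_gen tensor_rel).

Definition tensor_in (x : V) : tensor_alg := quot_pi _ (free_gen k x).

Definition sym_rel : set tensor_alg :=
  [set t | exists x y : V,
    t = tensor_in x * tensor_in y - tensor_in y * tensor_in x].

Definition sym_alg : pzAlgType k := quot_alg (ideal_gen sym_rel).

Definition sym_in (x : V) : sym_alg := quot_pi _ (tensor_in x).

End TensorAlgebra.

Section EnvelopingAlgebra.
Context {k : fieldType} (L : lieType k).

Definition env_rel : set (tensor_alg L) :=
  [set t | exists x y : L, t =
    tensor_in x * tensor_in y - tensor_in y * tensor_in x
    - tensor_in (lie x y)].

Definition env_alg : pzAlgType k := quot_alg (ideal_gen env_rel).

End EnvelopingAlgebra.

(** * Poisson structures *)

Section Poisson.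
Context {k : fieldType}.

Definition poisson_bracket (S : pzAlgType k) (pb : S -> S -> S) : Prop :=
  [/\ (forall c x y z, pb (c%:K * x + y) z = c%:K * pb x z + pb y z),
      (forall x, pb x x = 0),
      (forall x y z, pb x (pb y z) + pb y (pb z x) + pb z (pb x y) = 0) &
      (forall x y z, pb x (y * z) = pb x y * z + y * pb x z)].

(* This determines pb, since sym_alg L is generated by the image of L. *)
Definition kostant_kirillov (L : lieType k)
    (pb : sym_alg L -> sym_alg L -> sym_alg L) : Prop :=
  poisson_bracket pb /\
  forall x y : L, pb (sym_in x) (sym_in y) = sym_in (lie x y).

Definition poisson_ideal (S : pzAlgType k) (pb : S -> S -> S) (I : ideal S) : Prop :=
  forall x y, I y -> I (pb x y).

End Poisson.

(* Main.v *)
From HB Require Import structures.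
Require Import Defs.
From mathcomp Require Import all_boot all_order all_algebra.
From mathcomp Require Import all_classical all_reals all_analysis.
From mathcomp Require Import zify ring.
From mathcomp Require monalg.
Import -(notations) monalg.

(** Write L for the twisted current algebra, and let B be U(L) or S(L).  Both are
    spanned by words in letters e_i t^n, where (e_i) is a basis of g made of
    eigenvectors of sigma, and L acts on both by derivations: u acts by the
    commutator with u, respectively by the Poisson bracket with u.

    Why quotients by nonzero stable ideals grow polynomially
    ([growth_of_relation], [growth_of_quotient]).  A nonzero element of the ideal
    is a relation between words in the quotient.  Giving each letter the weight
    n + K with K large, its words of largest weight all have the same length D, and
    the order of their letters matters only in lower weight.  Apply to it D blocks
    of M derivations e_l t^c each.  By the Leibniz rule the derivations get
    distributed over the D factors in all possible ways.  Shifting their t-degrees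
    according to the monomials of a product of differences ([separator]) and adding
    up with signs cancels each distribution in which two blocks hit a common
    factor; so each block acts as a whole on one factor of its own.  As g is simple,
    Burnside's theorem makes the products of M operators ad e_l span all
    endomorphisms of g ([words_mx_full], [matrix_unit_op_span]), so that the block
    may be taken to turn one chosen basis vector into another one and to kill the
    rest.  The outcome ([leading_word]) is that a product of D letters of large
    t-degrees n_1 >= ... >= n_D is a combination of words of smaller weight and of
    products of D letters of the same total degree but with lexicographically
    larger t-degrees.  Hence words with fewer than D letters of t-degree at least
    some N span ([filt_normal]); in weight at most p there are polynomially many of
    them.

    Why U(L) itself has infinite Gelfand-Kirillov dimension
    ([GKdim_env_infty]).  U(L) acts on multilinear forms on L^P.  There are letters
    h_0, h_1, ... of L, a vector y of L and linear forms that kill y and separate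
    the vectors [h_b, y]; applying a word in the h_b to the product of P such forms and
    evaluating at (y, ..., y) tells apart the words of length at most P up to
    permutation.  So the q^d monomials in h_0, ..., h_(d-1) with exponents below q
    are independent, and the growth exceeds n^e for each e.

    For S(L) one more point needs an argument.  A Poisson bracket is given as linear
    in its left argument only, whereas { u, - } has to act linearly.  On a
    commutative domain of characteristic 0 the Jacobi and Leibniz identities force
    skew-symmetry ([poisson_antisymmetric]); and S(L) is a domain, by a substitution
    of powers of one variable for the letters ([sym_domain]). *)

Set Implicit Arguments.
Unset Strict Implicit.
Unset Printing Implicit Defensive.

Import Order.TTheory GRing.Theory Num.Theory.
Local Open Scope ring_scope.

Local Notation subspace := Defs.subspace.

(** * Subspaces, spans and dimension *)

Section Scalars.
Context {k : fieldType} {A : pzAlgType k}.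
Implicit Types (c d : k) (x y : A).

HB.instance Definition _ := GRing.isZmodMorphism.Build k A (@kcst k A) (@kcstB k A).
HB.instance Definition _ :=
  GRing.isMonoidMorphism.Build k A (@kcst k A) (conj (@kcst1 k A) (@kcstM k A)).

Lemma kcst_mulCA c x y : x * (c%:K * y) = c%:K * (x * y).
Proof. by rewrite mulrA -kcstC mulrA. Qed.

End Scalars.

Section Subspace.
Context {k : fieldType} {A : pzAlgType k} (W : set A).
Hypothesis subW : subspace W.

Lemma subspace0 : W 0. Proof. by case: subW. Qed.

Lemma subspaceP c x y : W x -> W y -> W (c%:K * x + y).
Proof. by move: subW => [_]; apply. Qed.

Lemma subspaceZ c x : W x -> W (c%:K * x).
Proof. by move=> Wx; rewrite -[_ * _]addr0; apply: subspaceP => //; exact: subspace0. Qed.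

Lemma subspaceD x y : W x -> W y -> W (x + y).
Proof. by move=> Wx Wy; have := subspaceP 1 Wx Wy; rewrite kcst1 mul1r. Qed.

Lemma subspaceN x : W x -> W (- x).
Proof. by move=> /(subspaceZ (-1)); rewrite rmorphN1 mulN1r. Qed.

Lemma subspaceB x y : W x -> W y -> W (x - y).
Proof. by move=> Wx /subspaceN; exact: subspaceD. Qed.

Lemma subspace_sum I (s : seq I) (P : pred I) (F : I -> A) :
  (forall i, P i -> W (F i)) -> W (\sum_(i <- s | P i) F i).
Proof. by move=> WF; elim/big_ind: _ => //; [exact: subspace0|exact: subspaceD]. Qed.

Lemma subspace_sum_seq (I : eqType) (s : seq I) (F : I -> A) :
  (forall i, i \in s -> W (F i)) -> W (\sum_(i <- s) F i).
Proof. by move=> WF; rewrite big_seq; exact: subspace_sum. Qed.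

Lemma subspace_congr x y : W (x - y) -> W y -> W x.
Proof. by move=> Wxy Wy; rewrite -[x](subrK y); exact: subspaceD. Qed.

End Subspace.

Section LSpan.
Context {k : fieldType} {A : pzAlgType k}.
Implicit Types X Y W : set A.

Lemma lspan_subspace X : subspace (lspan X).
Proof.
split=> [|c x y Xx Xy] W /[dup] WP [[W0 WZ] _] //.
by apply: WZ; [exact: Xx|exact: Xy].
Qed.

Lemma sub_lspan X x : X x -> lspan X x.
Proof. by move=> Xx W [_]; exact. Qed.

Lemma lspan_min X W : subspace W -> (forall x, X x -> W x) -> forall x, lspan X x -> W x.
Proof. by move=> sW XW x Xx; apply: Xx; split. Qed.

Lemma lspan_sub X Y : (forall x, X x -> Y x) -> forall x, lspan X x -> lspan Y x.
Proof.
by move=> XY; apply: lspan_min => [|x /XY]; [exact: lspan_subspace|exact: sub_lspan].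
Qed.

Lemma subspace_mull W a : subspace W -> subspace (fun x => W (a * x)).
Proof.
move=> sW; split=> [|c x y Wx Wy]; first by rewrite mulr0; exact: subspace0.
by rewrite mulrDr kcst_mulCA; apply: subspaceD => //; exact: subspaceZ.
Qed.

Lemma subspace_mulr W a : subspace W -> subspace (fun x => W (x * a)).
Proof.
move=> sW; split=> [|c x y Wx Wy]; first by rewrite mul0r; exact: subspace0.
by rewrite mulrDl -mulrA; apply: subspaceD => //; exact: subspaceZ.
Qed.

Lemma lspanM X Y W : subspace W ->
  (forall x y, X x -> Y y -> W (x * y)) ->
  forall x y, lspan X x -> lspan Y y -> W (x * y).
Proof.
move=> sW XYW x y Xx Yy.
apply: (lspan_min (subspace_mulr y sW)) Xx => {}x Xx.
by apply: (lspan_min (subspace_mull x sW)) Yy => {}y Yy; exact: XYW.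
Qed.

Lemma lspan_seqP (s : seq A) x :
  lspan [set` s] x -> exists c : 'I_(size s) -> k, x = \sum_i (c i)%:K * s`_i.
Proof.
pose W y := exists c : 'I_(size s) -> k, y = \sum_i (c i)%:K * s`_i.
suff: forall y, lspan [set` s] y -> W y by apply.
apply: lspan_min => [|{}x xs].
  split; first by exists (fun=> 0); rewrite big1 // => i _; rewrite rmorph0 mul0r.
  move=> c _ _ [a ->] [b ->]; exists (fun i => c * a i + b i).
  rewrite mulr_sumr -big_split; apply: eq_bigr => i _.
  by rewrite rmorphD rmorphM mulrDl mulrA.
have xs' : (index x s < size s)%N by rewrite index_mem.
exists (fun i => (i == Ordinal xs')%:R); rewrite (bigD1 (Ordinal xs')) //=.
rewrite eqxx kcst1 mul1r nth_index // big1 ?addr0 // => i /negbTE->.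
by rewrite rmorph0 mul0r.
Qed.

End LSpan.

Section Dimension.
Context {k : fieldType} {A : pzAlgType k}.

(** Steinitz: d independent combinations of s force d <= size s, since a
    d x (size s) matrix with d larger has a nonzero left kernel. *)
Lemma lin_indep_size d (b : d.-tuple A) (s : seq A) :
  lin_indep b -> (forall i, lspan [set` s] (tnth b i)) -> (d <= size s)%N.
Proof.
move=> b_indep bs; rewrite leqNgt; apply/negP => lt_sd.
have /choice[M bM] : forall i, exists c : 'I_(size s) -> k,
    tnth b i = \sum_j (c j)%:K * s`_j by move=> i; exact: lspan_seqP.
pose M' := \matrix_(i, j) M i j : 'M[k]_(d, size s).
have : kermx M' != 0.
  by rewrite -mxrank_eq0 mxrank_ker subn_eq0 -ltnNge (leq_ltn_trans (rank_leq_col _)).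
case/rowV0Pn => u /sub_kermxP uM /rV0Pn[i].
have /b_indep->// : \sum_i (u 0 i)%:K * tnth b i = 0; last by rewrite eqxx.
under eq_bigr do rewrite bM mulr_sumr.
rewrite exchange_big big1 //= => j _.
transitivity ((\sum_i u 0 i * M i j)%:K * s`_j).
  by rewrite rmorph_sum mulr_suml; apply: eq_bigr => l _; rewrite rmorphM mulrA.
have := congr1 (fun N : 'rV_ _ => N 0 j) uM; rewrite !mxE => uMj.
rewrite [X in X%:K](_ : _ = 0) ?rmorph0 ?mul0r // -[RHS]uMj.
by apply: eq_bigr => l _; rewrite mxE.
Qed.

(** Every spanning list contains a basis, so [sdim] of a finite-dimensional space is
    the length of an actual basis. *)
Lemma lspan_basis (s : seq A) :
  exists d, exists2 b : d.-tuple A, lin_indep b & lspan [set` s] = lspan [set` b].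
Proof.
elim: s => [|x s [d [b b_indep sb]]].
  by exists 0%N; exists [tuple] => // c _ [].
have sE : lspan [set` x :: s] = lspan [set` x :: b].
  rewrite eqEsubset; split; apply: lspan_min; try exact: lspan_subspace.
    move=> y; rewrite /= inE => /orP[/eqP->|ys].
      by apply: sub_lspan; rewrite /= mem_head.
    have : lspan [set` b] y by rewrite -sb; exact: sub_lspan.
    by apply: lspan_sub => z /= zb; rewrite inE zb orbT.
  move=> y; rewrite /= inE => /orP[/eqP->|ys].
    by apply: sub_lspan; rewrite /= mem_head.
  have : lspan [set` s] y by rewrite sb; exact: sub_lspan.
  by apply: lspan_sub => z /= zb; rewrite inE zb orbT.
have [xb|xb] := pselect (lspan [set` b] x).
  exists d; exists b => //; rewrite sE eqEsubset; split; last first.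
    by apply: lspan_sub => z /= zb; rewrite inE zb orbT.
  apply: lspan_min; first exact: lspan_subspace.
  by move=> y; rewrite /= inE => /orP[/eqP->//|yb]; exact: sub_lspan.
exists d.+1; exists (cons_tuple x b) => // c.
rewrite big_ord_recl /= tnth0; under eq_bigr do rewrite tnthS.
move=> c0.
have c00 : c ord0 = 0.
  apply: contrapT => /eqP cn0; apply: xb.
  have -> : x = (- (c ord0)^-1)%:K * \sum_(i < d) (c (lift ord0 i))%:K * tnth b i.
    move/eqP: c0; rewrite addr_eq0 => /eqP c0.
    rewrite rmorphN mulNr -mulrN -c0 mulrA -rmorphM mulVf // rmorph1 mul1r //.
  apply: (subspaceZ (lspan_subspace _)).
  apply: (subspace_sum (lspan_subspace _)) => i _.
  apply: (subspaceZ (lspan_subspace _)).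
  by apply: sub_lspan; exact: mem_tnth.
move: c0; rewrite c00 rmorph0 mul0r add0r => /b_indep ci i.
by case: (unliftP ord0 i) => [j ->|->].
Qed.

Lemma sdim_le (V : set A) (s : seq A) :
  (forall x, V x -> lspan [set` s] x) -> (sdim V <= size s)%N.
Proof.
move=> Vs; rewrite /sdim; set P := (X in get X).
have [[d Pd]|nP] := pselect (exists d, P d).
  have [b b_indep Vb] := getI Pd.
  by apply: (lin_indep_size b_indep) => i; apply: Vs; rewrite Vb; apply: sub_lspan; exact: mem_tnth.
by rewrite getPN // => d Pd; apply: nP; exists d.
Qed.

Lemma sdim_ge (V : set A) (s : seq A) d (b : d.-tuple A) :
  V = lspan [set` s] -> lin_indep b -> (forall i, V (tnth b i)) -> (d <= sdim V)%N.
Proof.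
move=> Vs b_indep Vb; have [d' [b' b'_indep sb']] := lspan_basis s.
have [b'' _ Vb''] : [set d | exists2 b : d.-tuple A, lin_indep b & V = lspan [set` b]]%classic (sdim V).
  by apply: (@getI _ _ d'); exists b' => //; rewrite Vs.
rewrite -(size_tuple b''); apply: (lin_indep_size b_indep) => i.
by rewrite -Vb''; exact: Vb.
Qed.

End Dimension.

(** * The lexicographic order and a separating polynomial *)

Lemma sum_indicator (Q : finType) (P : pred Q) x : (\sum_(q | P q) (q == x))%N = P x.
Proof.
have [Px|nPx] := boolP (P x).
  by rewrite (bigD1 x) //= eqxx big1 ?addn0 // => q /andP[_ /negbTE->].
by rewrite big1 // => q Pq; case: eqP => // qx; rewrite -qx Pq in nPx.
Qed.

Section Lex.
Context (D : nat).
Implicit Types b c : 'I_D -> nat.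

Definition lex_lt b b' :=
  exists i : 'I_D, (forall j : 'I_D, (j < i)%N -> b j = b' j) /\ (b i < b' i)%N.

Definition lex_le b b' := b =1 b' \/ lex_lt b b'.

Lemma lex_total b b' : lex_le b b' \/ lex_lt b' b.
Proof.
have [i0 /= ne0|eqb] := pickP [pred i | b i != b' i]; last first.
  by left; left=> i; apply/eqP; have /= /negbFE := eqb i.
case: (arg_minnP (P := [pred i | b i != b' i]) val ne0) => i /= nei imin.
have eqj (j : 'I_D) : (j < i)%N -> b j = b' j.
  by move=> ji; apply/eqP/negPn/negP => /imin; rewrite leqNgt ji.
have [lt|gt|eqi] := ltngtP (b i) (b' i); last by rewrite eqi eqxx in nei.
  by left; right; exists i.
by right; exists i; split=> // j /eqj.
Qed.

Lemma lex_lt_trans b1 b2 b3 : lex_lt b1 b2 -> lex_lt b2 b3 -> lex_lt b1 b3.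
Proof.
move=> [i [eqi lti]] [j [eqj ltj]]; have [ij|ji|/val_inj ij] := ltngtP i j.
- exists i; split=> [l li|]; last by rewrite -eqj.
  by rewrite eqi // eqj // (ltn_trans li).
- exists j; split=> [l lj|]; last by rewrite eqi.
  by rewrite eqi ?eqj // (ltn_trans lj).
- subst j; exists i; split=> [l li|]; first by rewrite eqi // eqj.
  exact: ltn_trans ltj.
Qed.

Lemma lex_le_trans b1 b2 b3 : lex_le b1 b2 -> lex_le b2 b3 -> lex_le b1 b3.
Proof.
move=> [eq12|lt12] [eq23|lt23].
- by left=> i; rewrite eq12.
- right; case: lt23 => i [eqi lti]; exists i.
  by split=> [j /eqi <-|]; rewrite eq12.
- right; case: lt12 => i [eqi lti]; exists i.
  by split=> [j /eqi ->|]; rewrite -eq23.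
- by right; exact: lex_lt_trans lt23.
Qed.

Lemma lex_min (I : eqType) (s : seq I) (f : I -> 'I_D -> nat) : s != [::] ->
  exists2 x, x \in s & forall y, y \in s -> lex_le (f x) (f y).
Proof.
elim: s => // x [_ _|y s IHs _].
  by exists x; rewrite ?mem_head // => y; rewrite inE => /eqP->; left.
have [//|z zs zmin] := IHs; have [xz|zx] := lex_total (f x) (f z).
  exists x; rewrite ?mem_head // => t; rewrite inE => /orP[/eqP->|/zmin]; first by left.
  exact: lex_le_trans.
exists z; first by rewrite inE zs orbT.
by move=> t; rewrite inE => /orP[/eqP->|/zmin//]; right.
Qed.

Lemma lex_le_ltD b b' c c' : lex_le b b' -> lex_lt c c' ->
  lex_lt (fun i => b i + c i)%N (fun i => b' i + c' i)%N.
Proof.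
move=> [eb|[i [ei li]]] [j [ej lj]].
  by exists j; split=> [l /ej ->|]; rewrite eb ?ltn_add2l.
have [ij|ji|/val_inj ij] := ltngtP i j.
- exists i; split=> [l lt|]; first by rewrite ei // ej // (ltn_trans lt).
  by rewrite ej // ltn_add2r.
- exists j; split=> [l lt|]; first by rewrite ej // ei // (ltn_trans lt).
  by rewrite ei // ltn_add2l.
- subst j; exists i; split=> [l lt|]; first by rewrite ei // ej.
  by rewrite -addSn leq_add // ltnW.
Qed.

(** For a nonincreasing b the lexicographic order is detected by the sum of
    the powers of D + 1: D equal powers weigh less than the next power. *)
Lemma lex_lt_powers b b' : (forall i j : 'I_D, (i <= j)%N -> (b j <= b i)%N) ->
  lex_lt b b' -> (\sum_i D.+1 ^ b i < \sum_i D.+1 ^ b' i)%N.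
Proof.
move=> bdec [i [eqi lti]].
rewrite (bigID (fun j : 'I_D => j < i)%N) [X in (_ < X)%N](bigID (fun j : 'I_D => j < i)%N) /=.
under eq_bigr => j ji do rewrite eqi //.
rewrite ltn_add2l (leq_trans _ (_ : D.+1 ^ (b i).+1 <= _))%N //; last first.
  rewrite (bigD1 i) ?ltnn //= (leq_trans _ (leq_addr _ _)) // leq_pexp2l //.
rewrite (@leq_ltn_trans (\sum_(j < D) D.+1 ^ b i)%N) //.
  rewrite big_mkcond leq_sum // => j _; case: ifP => // nji.
  by apply: leq_pexp2l => //; apply: bdec; rewrite leqNgt.
by rewrite sum_nat_const card_ord expnS ltn_mul2r expn_gt0 ltnSn.
Qed.

End Lex.

Section Separator.
Context (k : fieldType) (D M : nat).
Local Notation Q := ('I_D * 'I_M)%type.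

Definition bump_at (q : Q) (s : {ffun Q -> nat}) : {ffun Q -> nat} :=
  [ffun q' => (s q' + (q' == q))%N].

(** The polynomial prod_(p in ps) (z_(p.2) - z_(p.1)) in variables z_q, as the
    list of its signed monomials before any cancellation. *)
Fixpoint separator (ps : seq (Q * Q)) : seq (k * {ffun Q -> nat}) :=
  if ps is p :: ps' then
    [seq (u.1, bump_at p.2 u.2) | u <- separator ps'] ++
    [seq (- u.1, bump_at p.1 u.2) | u <- separator ps']
  else [:: (1, [ffun=> 0%N])].

Definition block (s : {ffun Q -> nat}) (j : 'I_D) : nat := (\sum_(q | q.1 == j) s q)%N.

Lemma bump_atC p q s : bump_at p (bump_at q s) = bump_at q (bump_at p s).
Proof. by apply/ffunP => x; rewrite !ffunE addnAC. Qed.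

Lemma block_bump q s j : block (bump_at q s) j = (block s j + (q.1 == j))%N.
Proof.
rewrite /block; under eq_bigr do rewrite ffunE.
by rewrite big_split /= sum_indicator.
Qed.

(** A linear functional on monomials that does not distinguish z_(p.1) from z_(p.2)
    factors through the substitution z_(p.1) = z_(p.2), which kills the product. *)
Lemma separator_vanish (A : pzAlgType k) (ps : seq (Q * Q)) p (H : {ffun Q -> nat} -> A) : p \in ps ->
  (forall s, H (bump_at p.1 s) = H (bump_at p.2 s)) ->
  \sum_(u <- separator ps) u.1%:K * H u.2 = 0.
Proof.
elim: ps H => // q ps IHs H; rewrite inE => pq Hp.
rewrite big_cat !big_map /=.
have [pps|pps] := boolP (p \in ps).
  have shifted q' : \sum_(u <- separator ps) u.1%:K * H (bump_at q' u.2) = 0.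
    by apply: (IHs (fun s => H (bump_at q' s))) => // s; rewrite !(bump_atC q').
  rewrite shifted add0r; under eq_bigr do rewrite rmorphN mulNr.
  by rewrite sumrN shifted oppr0.
rewrite (negbTE pps) orbF in pq; rewrite -(eqP pq) -big_split big1 //= => u _.
by rewrite Hp rmorphN mulNr addrN.
Qed.

Lemma separator_total ps u : u \in separator ps -> (\sum_q u.2 q)%N = size ps.
Proof.
have bumpS q s : (\sum_x bump_at q s x = (\sum_x s x).+1)%N.
  under eq_bigr do rewrite ffunE.
  by rewrite big_split /= sum_indicator addn1.
elim: ps u => [|p ps IHs] u /=.
  by rewrite inE => /eqP-> /=; rewrite big1 // => x _; rewrite ffunE.
by rewrite mem_cat => /orP[] /mapP[v /IHs <- ->] /=; rewrite bumpS.
Qed.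

(** When every difference z_(p.2) - z_(p.1) has p.1 in a strictly earlier block,
    taking z_(p.2) throughout moves as much degree as possible to late blocks; this
    is the unique lexicographically smallest choice of block degrees. *)
Lemma separator_lead (ps : seq (Q * Q)) : (forall p, p \in ps -> (p.1.1 < p.2.1)%N) ->
  exists s0 rest, separator ps = (1, s0) :: rest /\
    forall u, u \in rest -> lex_lt (block s0) (block u.2).
Proof.
elim: ps => [_|p ps IHs pps]; first by exists [ffun=> 0%N], [::].
have [|s0 [rest [sepE restP]]] := IHs; first by move=> q qs; apply: pps; rewrite inE qs orbT.
have lt12 : (p.1.1 < p.2.1)%N by apply: pps; rewrite mem_head.
exists (bump_at p.2 s0); eexists; split; first by rewrite /= sepE.
have shift q s1 s2 : lex_lt (block s1) (block s2) ->
    lex_lt (block (bump_at q s1)) (block (bump_at q s2)).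
  by move=> [i [ei li]]; exists i; split=> [j /ei|]; rewrite !block_bump ?ltn_add2r // => ->.
have p21 s : lex_lt (block (bump_at p.2 s)) (block (bump_at p.1 s)).
  exists p.1.1; split=> [j jp|]; rewrite !block_bump.
    congr addn; rewrite -!val_eqE /= (gtn_eqF jp) gtn_eqF //.
    exact: ltn_trans lt12.
  by rewrite eqxx -val_eqE /= (gtn_eqF lt12) ltn_add2l.
move=> u; rewrite mem_cat => /orP[/mapP[v /restP vP ->]|/=]; first exact: shift.
rewrite inE => /orP[/eqP->//|/mapP[v /restP vP ->]].
exact: lex_lt_trans (p21 _) (shift _ _ _ vP).
Qed.

End Separator.

(** * Words in the letters x t^n and their filtration *)

Section Filtration.
Context {k : fieldType} {g : finDimLieType k} {A : pzAlgType k}.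
Context (m : nat) (e : m.-tuple g) (e_basis : basis_of fullv e).
Context (T : g -> nat -> A).
Hypothesis T_lin : forall n (c : k) x y, T (c *: x + y) n = c%:K * T x n + T y n.
Hypothesis T_comm : forall x a y b,
  exists z, T x a * T y b - T y b * T x a = T z (a + b)%N.

Definition word (s : seq ('I_m * nat)) : A := \prod_(v <- s) T e`_v.1 v.2.

(** With K larger than the t-degrees that matter, the potential compares words first
    by length; it is additive under concatenation and it drops under commutators. *)
Definition potential (K : nat) (s : seq ('I_m * nat)) := (\sum_(v <- s) (v.2 + K))%N.

Definition filt (K p : nat) : set A :=
  fun y => `[< lspan (fun x => exists2 s, (potential K s < p)%N & x = word s) y >].

Lemma T0 n : T 0 n = 0.
Proof.
have := T_lin n 1 0 0; rewrite scale1r addr0 kcst1 mul1r => /eqP.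
by rewrite -subr_eq subrr eq_sym => /eqP.
Qed.

Lemma TD n x y : T (x + y) n = T x n + T y n.
Proof. by have := T_lin n 1 x y; rewrite scale1r kcst1 mul1r. Qed.

Lemma TZ n c x : T (c *: x) n = c%:K * T x n.
Proof. by have := T_lin n c x 0; rewrite addr0 T0 addr0. Qed.

Lemma T_sum n I (s : seq I) (f : I -> g) : T (\sum_(i <- s) f i) n = \sum_(i <- s) T (f i) n.
Proof. by elim/big_ind2: _ => [|? ? ? ? <- <-|//]; rewrite ?T0 ?TD. Qed.

Lemma T_coord y n : T y n = \sum_(i < m) (coord e i y)%:K * T e`_i n.
Proof.
rewrite {1}(coord_basis e_basis (memvf y)) T_sum.
by apply: eq_bigr => i _; rewrite TZ.
Qed.

Lemma wordcons v s : word (v :: s) = T e`_v.1 v.2 * word s.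
Proof. by rewrite /word big_cons. Qed.

Lemma wordcat s1 s2 : word (s1 ++ s2) = word s1 * word s2.
Proof. by rewrite /word big_cat. Qed.

Lemma potentialcat K s1 s2 : potential K (s1 ++ s2) = (potential K s1 + potential K s2)%N.
Proof. by rewrite /potential big_cat. Qed.

Section Fixed.
Context (K : nat) (K_gt0 : (0 < K)%N).
Local Notation F := (filt K).

Lemma filt_subspace p : subspace (F p).
Proof.
rewrite (_ : F p = lspan (fun x => exists2 s, (potential K s < p)%N & x = word s)).
  exact: lspan_subspace.
by apply/funext => x; rewrite /filt asboolE.
Qed.
Hint Resolve filt_subspace : core.

Lemma word_filt s p : (potential K s < p)%N -> F p (word s).
Proof. by move=> sp; apply/asboolP; apply: sub_lspan; exists s. Qed.

Lemma filt_min p (W : set A) : subspace W ->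
  (forall s, (potential K s < p)%N -> W (word s)) -> forall x, F p x -> W x.
Proof.
by move=> sW Ww x /asboolP; apply: lspan_min => // _ [s sp ->]; exact: Ww.
Qed.

Lemma filt_mono p q x : (p <= q)%N -> F p x -> F q x.
Proof.
move=> pq; apply: filt_min x => // s sp; apply: word_filt.
exact: leq_trans pq.
Qed.

Lemma filt0 x : F 0 x -> x = 0.
Proof.
apply: (filt_min (W := [set 0]%classic)) => //.
by split=> // c x' y -> ->; rewrite mulr0 addr0.
Qed.

Lemma filtMl p q x y : F p x -> F q.+1 y -> F (p + q)%N (x * y).
Proof.
move=> /asboolP Fx /asboolP Fy; apply: (lspanM _ _ Fx Fy) => //.
move=> _ _ [s sp ->] [t tq ->]; rewrite -wordcat.
by apply: word_filt; rewrite potentialcat -addSn leq_add.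
Qed.

Lemma filtMr p q x y : F p.+1 x -> F q y -> F (p + q)%N (x * y).
Proof.
move=> /asboolP Fx /asboolP Fy; apply: (lspanM _ _ Fx Fy) => //.
move=> _ _ [s sp ->] [t tq ->]; rewrite -wordcat.
by apply: word_filt; rewrite potentialcat -addnS leq_add.
Qed.

Lemma filtMM p q x y : F p.+1 x -> F q.+1 y -> F (p + q).+1 (x * y).
Proof. by rewrite -addSn; exact: filtMl. Qed.

Lemma filt1 : F 1 1.
Proof.
have -> : 1 = word [::] by rewrite /word big_nil.
by apply: word_filt; rewrite /potential big_nil.
Qed.

Lemma filtT y n : F (n + K).+1 (T y n).
Proof.
rewrite T_coord; apply: subspace_sum => // i _; apply: (subspaceZ (filt_subspace _)).
have -> : T e`_i n = word [:: (i, n)] by rewrite /word big_seq1.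
by apply: word_filt; rewrite /potential big_seq1.
Qed.

Lemma filt_prod I (s : seq I) (y : I -> g) (n : I -> nat) :
  F (\sum_(i <- s) (n i + K)).+1 (\prod_(i <- s) T (y i) (n i)).
Proof.
elim: s => [|i s IHs]; first by rewrite !big_nil; exact: filt1.
by rewrite !big_cons; exact: filtMM (filtT _ _) IHs.
Qed.

(** A commutator of two letters is again one letter, so it saves one copy of K. *)
Lemma filt_comm p q x y : F p.+1 x -> F q.+1 y -> F (p + q)%N (x * y - y * x).
Proof.
have TT u a v b : F ((a + K) + (b + K))%N (T u a * T v b - T v b * T u a).
  have [z ->] := T_comm u a v b.
  by apply: filt_mono (filtT _ _); rewrite addnACA ltn_add2l -addn1 leq_add2l.
have Tw u a t : F (a + K + potential K t)%N (T u a * word t - word t * T u a).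
  elim: t => [|v t IHt].
    by rewrite /word big_nil mulr1 mul1r subrr; exact: (subspace0 (filt_subspace _)).
  rewrite wordcons /potential big_cons -/(potential K t).
  have -> : T u a * (T e`_v.1 v.2 * word t) - T e`_v.1 v.2 * word t * T u a =
    (T u a * T e`_v.1 v.2 - T e`_v.1 v.2 * T u a) * word t +
    T e`_v.1 v.2 * (T u a * word t - word t * T u a).
    by rewrite mulrBl mulrBr !mulrA addrA subrK.
  apply: (subspaceD (filt_subspace _)); first by rewrite addnA; apply: filtMl => //; exact: word_filt.
  by rewrite addnCA; apply: filtMr => //; exact: filtT.
have ww s t : F (potential K s + potential K t)%N (word s * word t - word t * word s).
  elim: s => [|v s IHs].
    by rewrite /word big_nil mulr1 mul1r subrr; exact: (subspace0 (filt_subspace _)).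
  rewrite wordcons /potential big_cons -/(potential K s) -/(potential K t).
  have -> : T e`_v.1 v.2 * word s * word t - word t * (T e`_v.1 v.2 * word s) =
    T e`_v.1 v.2 * (word s * word t - word t * word s) +
    (T e`_v.1 v.2 * word t - word t * T e`_v.1 v.2) * word s.
    by rewrite mulrBl mulrBr !mulrA addrA subrK.
  apply: (subspaceD (filt_subspace _)); first by rewrite -addnA; apply: filtMr => //; exact: filtT.
  by rewrite addnAC; apply: filtMl => //; exact: word_filt.
move=> Fx Fy.
have sW z : subspace (fun x => F (p + q)%N (x * z - z * x)).
  split=> [|c x1 x2 F1 F2]; first by rewrite mulr0 mul0r subrr; exact: (subspace0 (filt_subspace _)).
  rewrite mulrDl mulrDr -mulrA kcst_mulCA opprD addrACA -mulrBr.
  exact: (subspaceP (filt_subspace _)).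
have sW' z : subspace (fun x => F (p + q)%N (z * x - x * z)).
  split=> [|c x1 x2 F1 F2]; first by rewrite mulr0 mul0r subrr; exact: (subspace0 (filt_subspace _)).
  rewrite mulrDl mulrDr -mulrA kcst_mulCA opprD addrACA -mulrBr.
  exact: (subspaceP (filt_subspace _)).
apply: (filt_min (sW y)) Fx => s sp.
apply: (filt_min (sW' (word s))) Fy => t tq.
by apply: filt_mono (ww _ _); rewrite leq_add.
Qed.

(** Reordering letters costs commutators only, which have smaller potential. *)
Lemma filt_perm (I : eqType) (s s' : seq I) (y : I -> g) (n : I -> nat) : perm_eq s s' ->
  F (\sum_(i <- s) (n i + K))%N (\prod_(i <- s) T (y i) (n i) - \prod_(i <- s') T (y i) (n i)).
Proof.
move=> ss'; pose P t := perm_eq s t /\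
  F (\sum_(i <- s) (n i + K))%N (\prod_(i <- s) T (y i) (n i) - \prod_(i <- t) T (y i) (n i)).
suff: P s' by case.
apply: (@catCA_perm_ind _ P) ss' _; last first.
  by split; rewrite ?subrr; [|exact: subspace0].
move=> s1 s2 s3 [st Fst]; split.
  by apply: (perm_trans st); rewrite perm_catCA.
rewrite -[X in F _ X](subrKA (\prod_(i <- s1 ++ s2 ++ s3) T (y i) (n i))).
apply: (subspaceD (filt_subspace _)) => //.
rewrite (perm_big _ st) !big_cat /= !mulrA -mulrBl addnA.
exact: filtMl (filt_comm (filt_prod _ _ _) (filt_prod _ _ _)) (filt_prod _ _ _).
Qed.

End Fixed.

(** ** Derivations and the Leibniz rule *)

(** [der i a] stands for the action of the element e_i t^a of L, which exists when a
    is the degree of e_i modulo r. *)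
Context (r : nat) (deg : 'I_m -> nat) (der : 'I_m -> nat -> A -> A).
Hypothesis der_lin : forall i a, a = deg i %[mod r] ->
  forall (c : k) x y, der i a (c%:K * x + y) = c%:K * der i a x + der i a y.
Hypothesis derM : forall i a, a = deg i %[mod r] ->
  forall x y, der i a (x * y) = der i a x * y + x * der i a y.
Hypothesis derT : forall i a, a = deg i %[mod r] ->
  forall y b, der i a (T y b) = T (lie e`_i y) (a + b)%N.

Section Derivation.
Context (i : 'I_m) (a : nat) (ia : a = deg i %[mod r]).

Lemma derD x y : der i a (x + y) = der i a x + der i a y.
Proof. by have := der_lin ia 1 x y; rewrite kcst1 !mul1r. Qed.

Lemma der0 : der i a 0 = 0.
Proof. by apply: (addrI (der i a 0)); rewrite -derD !addr0. Qed.

Lemma derZ c x : der i a (c%:K * x) = c%:K * der i a x.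
Proof. by have := der_lin ia c x 0; rewrite der0 !addr0. Qed.

Lemma der_sum I (s : seq I) (f : I -> A) :
  der i a (\sum_(j <- s) f j) = \sum_(j <- s) der i a (f j).
Proof. by elim/big_ind2: _ => [|? ? ? ? <- <-|//]; rewrite ?der0 ?derD. Qed.

Lemma der1 : der i a 1 = 0.
Proof.
have := derM ia 1 1; rewrite !mulr1 mul1r => /eqP.
by rewrite -subr_eq subrr eq_sym => /eqP.
Qed.

Lemma der_prod (I : eqType) (s : seq I) (f : I -> A) : uniq s ->
  der i a (\prod_(j <- s) f j) =
  \sum_(l <- s) \prod_(j <- s) (if j == l then der i a (f j) else f j).
Proof.
elim: s => [_|j s IHs /= /andP[js us]]; first by rewrite !big_nil der1.
rewrite !big_cons derM // eqxx IHs // mulr_sumr; congr (_ + _).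
  congr (_ * _); apply: eq_big_seq => l ls; case: eqP => // lj.
  by rewrite -lj ls in js.
apply: eq_big_seq => l ls; rewrite big_cons; case: eqP => // jl.
by rewrite jl ls in js.
Qed.

Lemma filt_der K p x : filt K p x -> filt K (p + a)%N (der i a x).
Proof.
move: x; apply: filt_min.
  split=> [|c x y Fx Fy]; first by rewrite der0; exact: (subspace0 (filt_subspace _ _)).
  by rewrite der_lin //; exact: (subspaceP (filt_subspace _ _)).
move=> s sp; have Fs : filt K (potential K s + a).+1 (der i a (word s)).
  elim: s {p sp} => [|v s IHs].
    by rewrite /word big_nil der1; exact: (subspace0 (filt_subspace _ _)).
  rewrite wordcons /potential big_cons -/(potential K s) derM //.
  apply: (subspaceD (filt_subspace _ _)).
    rewrite derT // addnAC; apply: filtMM; last exact: word_filt.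
    by apply: filt_mono (filtT _ _ _); rewrite -addnA addnC.
  by rewrite -addnA; apply: filtMM => //; exact: filtT.
by apply: filt_mono Fs; rewrite -addSn leq_add2r.
Qed.

End Derivation.

(** Iterated Leibniz rule: the derivations e_(l q) t^(c q), for q in Q, get
    distributed over the D factors by all maps phi. *)
Section Leibniz.
Context (Q : finType) (D : nat) (l : Q -> 'I_m) (c : Q -> nat).
Hypothesis lc : forall q, c q = deg (l q) %[mod r].

Definition ad_word (P : pred Q) (y : g) : g :=
  foldr (fun q u => if P q then lie e`_(l q) u else u) y (enum Q).

Lemma eq_ad_word (P P' : pred Q) y : P =1 P' -> ad_word P y = ad_word P' y.
Proof. by move=> eqP'; rewrite /ad_word; elim: (enum Q) => //= q s ->; rewrite eqP'. Qed.

Lemma leibniz (y : 'I_D -> g) (n : 'I_D -> nat) :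
  foldr (fun q => der (l q) (c q)) (\prod_i T (y i) (n i)) (enum Q) =
  \sum_(phi : {ffun Q -> 'I_D})
    \prod_i T (ad_word [pred q | phi q == i] (y i))
               (\sum_(q | phi q == i) c q + n i)%N.
Proof.
pose upd (p : Q * 'I_D) (v : 'I_D -> g * nat) j :=
  if j == p.2 then (lie e`_(l p.1) (v j).1, (c p.1 + (v j).2)%N) else v j.
pose v0 j := (y j, n j).
pose P (v : 'I_D -> g * nat) := \prod_i T (v i).1 (v i).2.
have step s : foldr (fun q => der (l q) (c q)) (P v0) s =
    \sum_(t : (size s).-tuple 'I_D) P (foldr upd v0 (zip s t)).
  elim: s => [|q s IHs] /=.
    by rewrite (big_pred1 [tuple]) // => t; rewrite [t]tuple0; exact/esym/eqP.
  rewrite IHs der_sum // (reindex (fun p : 'I_D * (size s).-tuple 'I_D => cons_tuple p.1 p.2)) /=; last first.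
    exists (fun t => (thead t, [tuple of behead t])) => [[i t] _|t _] /=.
      by congr (_, _); apply: val_inj.
    by rewrite [RHS]tuple_eta; exact: val_inj.
  rewrite -(pair_bigA _ (fun i (t : (size s).-tuple 'I_D) => P (upd (q, i) (foldr upd v0 (zip s t))))).
  rewrite exchange_big; apply: eq_bigr => t _.
  rewrite /P der_prod ?index_enum_uniq //; apply: eq_bigr => i _.
  apply: eq_bigr => j _; rewrite /upd /=; case: ifP => // _.
  by rewrite derT.
have {}step s N : size s = N -> foldr (fun q => der (l q) (c q)) (P v0) s =
    \sum_(t : N.-tuple 'I_D) P (foldr upd v0 (zip s t)) by move=> <-.
rewrite (step _ _ (esym (cardE Q))) (reindex (@fgraph Q 'I_D)) /=; last first.
  by exists (@Finfun Q 'I_D) => ? _; [exact: fgraphK|exact: FinfunK].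
apply: eq_bigr => phi _; apply: eq_bigr => i _.
have -> : (\sum_(q | phi q == i) c q = \sum_(q <- enum Q | phi q == i) c q)%N.
  by rewrite big_enum_cond.
have -> : fgraph phi = [seq phi q | q <- enum Q] :> seq _ by [].
suff -> : foldr upd v0 (zip (enum Q) [seq phi q | q <- enum Q]) i =
  (ad_word [pred q | phi q == i] (y i), (\sum_(q <- enum Q | phi q == i) c q + n i)%N) by [].
rewrite /ad_word; elim: (enum Q) => [|q s IHs] /=; first by rewrite big_nil.
by rewrite big_cons /upd /= eq_sym; case: eqP => // _; rewrite IHs /= addnA.
Qed.
End Leibniz.

Section IteratedDerivation.
Context (Q : finType) (l : Q -> 'I_m) (c : Q -> nat).
Hypothesis lc : forall q, c q = deg (l q) %[mod r].
Local Notation ders := (foldr (fun q => der (l q) (c q))).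

Lemma ders_sum I (fs : seq I) (a : I -> k) (X : I -> A) s :
  ders (\sum_(f <- fs) (a f)%:K * X f) s = \sum_(f <- fs) (a f)%:K * ders (X f) s.
Proof.
elim: s => //= q s ->; rewrite der_sum //.
by apply: eq_bigr => f _; rewrite derZ.
Qed.

Lemma filt_ders K p x s :
  filt K p x -> filt K (p + \sum_(q <- s) c q)%N (ders x s).
Proof.
move=> Fx; elim: s => [|q s IHs] /=; first by rewrite big_nil addn0.
by rewrite big_cons addnCA addnC; exact: filt_der.
Qed.

End IteratedDerivation.

Section MultiLinear.
Context (D : nat).

Lemma prod_update_lin (s : seq 'I_D) (i : 'I_D) (f : 'I_D -> A) c x y :
  i \in s -> uniq s ->
  \prod_(j <- s) (if j == i then c%:K * x + y else f j) =
  c%:K * \prod_(j <- s) (if j == i then x else f j) +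
  \prod_(j <- s) (if j == i then y else f j).
Proof.
elim: s => // j s IHs; rewrite inE => + /= /andP[js us].
rewrite !big_cons eq_sym; have [ji|ji] /= := eqVneq j i.
  rewrite ji in js => _; have same z : \prod_(j <- s) (if j == i then z else f j) = \prod_(j <- s) f j.
    by apply: eq_big_seq => h; case: eqP => // -> /(negP js).
  by rewrite !same mulrDl mulrA.
by move=> /IHs->//; rewrite mulrDr kcst_mulCA.
Qed.

End MultiLinear.

(** Linear combinations of the operators ad(e_l1) ... ad(e_lM) on g that arise
    from the letters e_l1 t^c1, ..., e_lM t^cM with c1 + ... + cM = a. *)
Section OperatorSpan.
Context (M : nat).

Definition letter_op (a : nat) (u : g -> g) :=
  exists (l : 'I_M -> 'I_m) (c : 'I_M -> nat),
  [/\ forall i, c i = deg (l i) %[mod r], (\sum_i c i)%N = a &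
      forall y, u y = foldr (fun i z => lie e`_(l i) z) y (enum 'I_M)].

Inductive op_span (a : nat) : (g -> g) -> Prop :=
| op_letter u : letter_op a u -> op_span a u
| op_zero u : (forall y, u y = 0) -> op_span a u
| op_lin c u v w : op_span a u -> op_span a v ->
    (forall y, w y = c *: u y + v y) -> op_span a w.

End OperatorSpan.

Context (M' : nat).
Local Notation M := M'.+1.
Hypothesis r_gt0 : (0 < r)%N.
Hypothesis char0 : [pchar k] =i pred0.
Hypothesis T_adm : forall (i : 'I_m) n, n != deg i %[mod r] -> T e`_i n = 0.
Hypothesis matrix_units : forall (i i0 : 'I_m) a, (r * M <= a)%N ->
  a + deg i0 = deg i %[mod r] -> op_span M a (fun y => coord e i0 y *: e`_i).

(** ** Consequences of one relation *)

Section Relation.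
Context (K : nat) (K_gt0 : (0 < K)%N).
Local Notation F := (filt K).
Hint Resolve filt_subspace : core.
Context (D : nat) (p0 : nat) (fs : seq (k * {ffun 'I_D -> 'I_m * nat})).
Hypothesis fs_pot : forall f, f \in fs -> (\sum_i ((f.2 i).2 + K))%N = p0.
Hypothesis fs_rel :
  F p0 (\sum_(f <- fs) f.1%:K * \prod_i T e`_(f.2 i).1 (f.2 i).2).
Local Notation Q := ('I_D * 'I_M)%type.

(* Q indexes the D * M derivations to be applied; its first component is the block. *)
Definition block_pairs : seq (Q * Q) := [seq p : Q * Q <- enum {: Q * Q} | (p.1.1 < p.2.1)%N].

(** [phi q] is the factor that receives the derivation q.  A map separates when
    distinct blocks use distinct factors; as there are D of each, every block then
    acts on a single factor, its slot. *)
Definition separated (phi : {ffun Q -> 'I_D}) : bool :=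
  [forall q, forall q', (q.1 != q'.1) ==> (phi q != phi q')].

Implicit Types phi : {ffun Q -> 'I_D}.

Lemma separatedP phi :
  reflect (forall q q' : Q, q.1 != q'.1 -> phi q != phi q') (separated phi).
Proof.
by apply: (iffP 'forall_'forall_implyP) => H q q'; exact: H.
Qed.

Definition slot (phi : {ffun Q -> 'I_D}) (j : 'I_D) : 'I_D := phi (j, ord0).

Lemma slot_inj phi : separated phi -> injective (slot phi).
Proof.
move=> /separatedP sep i j eij; apply/eqP/negPn/negP => nij.
by have := sep (i, ord0) (j, ord0) nij; rewrite -/(slot _ _) eij eqxx.
Qed.

Lemma slotE phi q j : separated phi -> (phi q == slot phi j) = (q.1 == j).
Proof.
move=> sep; have [<-|nqj] := eqVneq q.1 j; last first.
  by apply/negbTE; move/separatedP: sep; apply.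
have /codomP[i qi] : phi q \in codom (slot phi).
  exact/(inj_card_onto (slot_inj sep)).
rewrite qi; apply/eqP; congr (slot phi _); apply/eqP/negPn/negP; rewrite eq_sym => nq.
by move/separatedP: sep => /(_ q (i, ord0) nq); rewrite -/(slot _ _) qi eqxx.
Qed.

Lemma nonseparated phi : ~~ separated phi ->
  exists2 p, p \in block_pairs & phi p.1 = phi p.2.
Proof.
rewrite negb_forall => /existsP[q]; rewrite negb_forall => /existsP[q'].
rewrite negb_imply negbK => /andP[+ /eqP eqq].
rewrite -val_eqE neq_ltn => /orP[lt|lt].
  by exists (q, q') => //; rewrite mem_filter mem_enum andbT.
by exists (q', q) => //; rewrite mem_filter mem_enum andbT.
Qed.

(** What remains of the antisymmetrized derivatives of the relation: block j acts by
    the operator U j and adds a j, plus the shift by the separator, to the degree. *)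
Definition sep_sum (U : 'I_D -> g -> g) (a : 'I_D -> nat) : A :=
  \sum_(u <- separator k block_pairs) u.1%:K *
    \sum_(f <- fs) f.1%:K * \sum_(phi | separated phi)
      \prod_j T (U j e`_(f.2 (slot phi j)).1)
                ((f.2 (slot phi j)).2 + a j + r * block u.2 j)%N.

(** Only the maps phi that send different blocks to different factors survive
    the antisymmetrisation by the separator. *)
Lemma sep_sum_letters (l : Q -> 'I_m) (c : Q -> nat) :
  (forall q, c q = deg (l q) %[mod r]) ->
  F (p0 + \sum_q c q + r * size block_pairs)%N
    (sep_sum (fun j => ad_word l [pred q | q.1 == j])
             (fun j => \sum_(q | q.1 == j) c q)%N).
Proof.
move=> lc; pose cs (s : {ffun Q -> nat}) q := (c q + r * s q)%N.
have lcs s q : cs s q = deg (l q) %[mod r] by rewrite /cs mulnC addnC modnMDl.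
pose rel := \sum_(f <- fs) f.1%:K * \prod_i T e`_(f.2 i).1 (f.2 i).2.
pose E s := foldr (fun q => der (l q) (cs s q)) rel (enum {: Q}).
pose P s (f : k * {ffun 'I_D -> 'I_m * nat}) (phi : {ffun Q -> 'I_D}) :=
  \prod_i T (ad_word l [pred q | phi q == i] e`_(f.2 i).1)
            (\sum_(q | phi q == i) cs s q + (f.2 i).2)%N.
have EE s : E s = \sum_(f <- fs) f.1%:K * \sum_phi P s f phi.
  by rewrite /E ders_sum //; apply: eq_bigr => f _; rewrite leibniz.
set p := (p0 + _ + _)%N.
have FE u : u \in separator k block_pairs -> F p (E u.2).
  move=> /separator_total utot.
  have := filt_ders (lcs u.2) (enum {: Q}) fs_rel.
  by rewrite big_enum /= big_split /= -big_distrr utot addnA.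
have bad0 f phi : ~~ separated phi ->
    \sum_(u <- separator k block_pairs) u.1%:K * P u.2 f phi = 0.
  case/nonseparated => q qps phiq.
  apply: (separator_vanish (H := fun s => P s f phi) qps) => s.
  apply: eq_bigr => i _; congr (T _ (_ + _)%N).
  rewrite /cs !big_split /=; congr addn; rewrite -!big_distrr /=; congr muln.
  under eq_bigr do rewrite ffunE; under [RHS]eq_bigr do rewrite ffunE.
  by rewrite !big_split /= !sum_indicator /= phiq.
rewrite /sep_sum.
have FP f phi u : separated phi -> f \in fs -> u \in separator k block_pairs ->
    F p (P u.2 f phi - \prod_j T (ad_word l [pred q | q.1 == j] e`_(f.2 (slot phi j)).1)
      ((f.2 (slot phi j)).2 + \sum_(q | q.1 == j) c q + r * block u.2 j)%N).
  move=> sep ffs /separator_total utot.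
  have perm_slot : perm_eq (index_enum 'I_D) [seq slot phi j | j <- index_enum 'I_D].
    rewrite uniq_perm ?index_enum_uniq ?map_inj_uniq ?index_enum_uniq //.
      exact: slot_inj.
    move=> i; rewrite mem_index_enum; apply/esym.
    have /codomP[j ->] : i \in codom (slot phi) by exact/(inj_card_onto (slot_inj sep)).
    by apply: map_f; exact: mem_index_enum.
  have := filt_perm K_gt0 (fun i => ad_word l [pred q | phi q == i] e`_(f.2 i).1)
    (fun i => \sum_(q | phi q == i) cs u.2 q + (f.2 i).2)%N perm_slot.
  rewrite [X in F X](_ : _ = p); last first.
    under eq_bigr do rewrite -addnA.
    rewrite big_split /= fs_pot // addnC /p -addnA; congr addn.
    rewrite -utot big_distrr -big_split /=.
    by rewrite (partition_big phi predT).
  rewrite big_map /P; congr (F p (_ - _)); apply: eq_bigr => j _.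
  rewrite (eq_ad_word _ (P' := [pred q | q.1 == j])) => [|q /=]; last exact: slotE.
  rewrite (eq_bigl (fun q => q.1 == j)) => [|q]; last exact: slotE.
  by rewrite /cs big_split /= -big_distrr /= addnC addnA.
have sum0 : \sum_(u <- separator k block_pairs) u.1%:K *
    \sum_(f <- fs) f.1%:K * \sum_(phi | ~~ separated phi) P u.2 f phi = 0.
  under eq_bigr do rewrite mulr_sumr.
  rewrite exchange_big big1 //= => f _.
  under eq_bigr do rewrite mulr_sumr mulr_sumr.
  rewrite exchange_big big1 //= => phi /bad0 b0.
  under eq_bigr do rewrite kcst_mulCA.
  by rewrite -mulr_sumr b0 mulr0.
rewrite -[X in F _ X]addr0 -[X in F _ (_ + X)]sum0 -big_split /=.
apply: subspace_sum_seq => // u us.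
rewrite -mulrDr; apply: (subspaceZ (filt_subspace _ _)).
rewrite -big_split /=; apply: (subspace_congr (filt_subspace _ _) _ (FE u us)).
rewrite EE -sumrB; apply: subspace_sum_seq => // f ffs.
rewrite -mulrDr -mulrBr; apply: (subspaceZ (filt_subspace _ _)).
rewrite [X in _ - X](bigID separated) /= opprD addrACA addrN addr0 -sumrB.
by apply: subspace_sum => // phi sep; rewrite -opprB; apply: (subspaceN (filt_subspace _ _)); exact: FP.
Qed.

Lemma ad_word_block (l : Q -> 'I_m) j y :
  ad_word l [pred q | q.1 == j] y = foldr (fun i z => lie e`_(l (j, i)) z) y (enum 'I_M).
Proof.
have -> : ad_word l [pred q | q.1 == j] y =
    foldr (fun q u => if q.1 == j then lie e`_(l q) u else u) y
          [seq (j', i) | j' <- enum 'I_D, i <- enum 'I_M].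
  by rewrite /ad_word {1}enumT unlock.
have keep j' t z : foldr (fun q u => if q.1 == j then lie e`_(l q) u else u) z
    [seq (j', i) | i <- t] =
    if j' == j then foldr (fun i z => lie e`_(l (j, i)) z) z t else z.
  elim: t => /= [|i t ->]; first by case: ifP.
  by case: eqP => // ->.
have skip (t : seq 'I_D) z : j \notin t ->
  foldr (fun q u => if q.1 == j then lie e`_(l q) u else u) z
    [seq (j', i) | j' <- t, i <- enum 'I_M] = z.
  elim: t => //= j' t IHt; rewrite inE negb_or => /andP[jj' jt].
  by rewrite foldr_cat IHt // keep eq_sym (negbTE jj').
have := enum_uniq 'I_D; have := mem_enum 'I_D j; rewrite inE.
elim: (enum 'I_D) => //= j' t IHt; rewrite inE => + /andP[j't ut].
rewrite foldr_cat keep [j' == j]eq_sym; have [jj' _|_ /= jt] := eqVneq j j'; last by rewrite IHt.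
by rewrite skip // jj'.
Qed.

Lemma block_sum (c : Q -> nat) j : (\sum_(q | q.1 == j) c q = \sum_i c (j, i))%N.
Proof.
rewrite (reindex (fun i => (j, i))) /=; last first.
  by exists snd => [//|[j' i]]; rewrite inE /= => /eqP->.
by apply: eq_bigl => i; rewrite eqxx.
Qed.

Lemma eq_sep_sum U U' a a' : (forall j y, U j y = U' j y) -> a =1 a' ->
  sep_sum U a = sep_sum U' a'.
Proof.
move=> eqU eqa; apply: eq_bigr => u _; congr (_ * _).
apply: eq_bigr => f _; congr (_ * _).
by apply: eq_bigr => phi _; apply: eq_bigr => j _; rewrite eqU eqa.
Qed.

Lemma sep_sum_letter_ops U a : (forall j, letter_op M (a j) (U j)) ->
  F (p0 + \sum_j a j + r * size block_pairs)%N (sep_sum U a).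
Proof.
move=> /choice[l] /choice[c lc].
have := @sep_sum_letters (fun q => l q.1 q.2) (fun q => c q.1 q.2).
rewrite (partition_big fst predT) //=.
under eq_bigr do rewrite block_sum /=.
under eq_bigr => j _ do have [_ -> _] := lc j.
rewrite (@eq_sep_sum _ U _ a) => [|j y|j]; last 2 first.
- by rewrite ad_word_block /=; have [_ _ ->] := lc j.
- by rewrite block_sum /=; have [_ -> _] := lc j.
by apply=> q; have [-> _ _] := lc q.1.
Qed.

Lemma sep_sum_lin U (j : 'I_D) c (u v w : g -> g) a :
  (forall y, w y = c *: u y + v y) ->
  let upd x i := if i == j then x else U i in
  sep_sum (upd w) a = c%:K * sep_sum (upd u) a + sep_sum (upd v) a.
Proof.
move=> wE upd; rewrite mulr_sumr -big_split; apply: eq_bigr => s _ /=.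
rewrite kcst_mulCA -mulrDr; congr (_ * _).
rewrite mulr_sumr -big_split; apply: eq_bigr => f _ /=.
rewrite kcst_mulCA -mulrDr; congr (_ * _).
rewrite mulr_sumr -big_split; apply: eq_bigr => phi _ /=.
pose b i := ((f.2 (slot phi i)).2 + a i + r * block s.2 i)%N.
pose x := e`_(f.2 (slot phi j)).1.
have E z : \prod_i T (upd z i e`_(f.2 (slot phi i)).1) (b i) =
   \prod_i (if i == j then T (z x) (b j) else T (U i e`_(f.2 (slot phi i)).1) (b i)).
  by apply: eq_bigr => i _; rewrite /upd; case: eqP => // ->.
rewrite !E wE T_lin prod_update_lin ?index_enum_uniq ?mem_index_enum //.
Qed.

(** As [sep_sum] is linear in each operator, the operators produced by words of
    letters may be replaced, block after block, by their linear combinations. *)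
Lemma sep_sum_ops U a : (forall j, op_span M (a j) (U j)) ->
  F (p0 + \sum_j a j + r * size block_pairs)%N (sep_sum U a).
Proof.
set p := (X in F X) => Uspan.
suff FU n V : (forall j : 'I_D, op_span M (a j) (V j)) ->
    (forall j : 'I_D, (n <= j)%N -> letter_op M (a j) (V j)) -> F p (sep_sum V a).
  by apply: (FU D) => // j; rewrite leqNgt ltn_ord.
elim: n V => [|n IHn] V Vspan Vlet; first by apply: sep_sum_letter_ops => j; exact: Vlet.
have [Dn|nD] := leqP D n.
  by apply: IHn => // j; rewrite leqNgt (leq_trans (ltn_ord j)).
pose j := Ordinal nD; pose upd x i := if i == j then x else V i.
suff Fu u : op_span M (a j) u -> F p (sep_sum (upd u) a).
  rewrite (@eq_sep_sum V (upd (V j)) a a) //; first exact: Fu.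
  by move=> i y; rewrite /upd; case: eqP => // ->.
elim=> {u} [u ul|u u0|c u v w _ IHu _ IHv wE].
- apply: IHn => i; rewrite /upd; case: eqP => [->|ij] //; first exact: op_letter.
  by rewrite leq_eqVlt => /orP[/eqP ni|/Vlet//]; case: ij; exact/val_inj.
- have -> : sep_sum (upd u) a = (-1)%:K * sep_sum (upd u) a + sep_sum (upd u) a.
    by apply: sep_sum_lin => y; rewrite u0 scaler0 addr0.
  by rewrite rmorphN1 mulN1r addNr; exact: (subspace0 (filt_subspace _ _)).
- rewrite (@sep_sum_lin V j c u v) //.
  exact: (subspaceP (filt_subspace _ _)).
Qed.

Section Leading.
Local Notation term := (k * {ffun 'I_D -> 'I_m * nat})%type.
Local Notation slotmap := {ffun Q -> 'I_D}.
Hypothesis fs_neq0 : fs != [::].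
Hypothesis fs_uniq : uniq fs.
Hypothesis fs_coef : forall f, f \in fs -> f.1 != 0.
Hypothesis fs_adm : forall f, f \in fs -> forall j, (f.2 j).2 = deg (f.2 j).1 %[mod r].
Hypothesis fs_inj : forall f f', f \in fs -> f' \in fs ->
  perm_eq (codom f.2) (codom f'.2) -> f = f'.

Lemma prod_eq0 (I : eqType) (s : seq I) (f : I -> A) i :
  i \in s -> f i = 0 -> \prod_(j <- s) f j = 0.
Proof.
elim: s => // j s IHs; rewrite inE big_cons => /orP[/eqP<- ->|/IHs + f0].
  by rewrite mul0r.
by move->; rewrite ?mulr0.
Qed.

Lemma codom_slot phi (h : {ffun 'I_D -> 'I_m * nat}) : separated phi ->
  perm_eq (codom h) (codom (fun j => h (slot phi j))).
Proof.
move=> sep; rewrite /codom /image_mem (map_comp h (slot phi)).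
apply: perm_map; apply: uniq_perm; rewrite ?(map_inj_uniq (slot_inj sep)) -?enumT ?enum_uniq //.
move=> i; rewrite mem_enum inE; apply/esym.
have /codomP[j ->] : i \in codom (slot phi) by exact/(inj_card_onto (slot_inj sep)).
by apply: map_f; rewrite mem_enum.
Qed.

(** Let f0, with its slots phi0, have the lexicographically smallest degrees among all
    words of the relation and all orders of its factors, and let block j act by the
    matrix unit that sends the basis vector of the j-th factor of f0 to e_(t j).
    Every surviving term has the letters e_(t j), and its degrees are at least
    n in the lexicographic order.  The degree n itself comes from f0 only, with a
    coefficient that is a positive multiple of the one of f0. *)
Lemma leading_word : exists N, forall (t : 'I_D -> 'I_m) (n : 'I_D -> nat),
  (forall j, (N <= n j)%N) -> (forall i j : 'I_D, (i <= j)%N -> (n j <= n i)%N) ->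
  forall W : set A, subspace W ->
  (forall x, F (\sum_j (n j + K))%N x -> W x) ->
  (forall n', (\sum_j n' j = \sum_j n j)%N ->
     (\sum_j D.+1 ^ n j < \sum_j D.+1 ^ n' j)%N -> W (\prod_j T e`_(t j) (n' j))) ->
  W (\prod_j T e`_(t j) (n j)).
Proof.
pose fst_sep : {ffun Q -> 'I_D} := [ffun q => q.1].
have sep_fst : separated fst_sep.
  by apply/separatedP => q q' neq; rewrite !ffunE.
pose s := [seq (f, phi) | f <- fs, phi <- enum separated].
pose ex (f : term) (phi : slotmap) j := (f.2 (slot phi j)).2.
have [|[f0 phi0] fs0 lmin] := @lex_min D _ s (fun x => ex x.1 x.2).
  case: fs fs_neq0 @s => // f fs' _ s.
  have /(@map_f _ _ (fun phi => (f, phi))) : fst_sep \in enum separated by rewrite mem_enum.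
  by rewrite /s /=; case: (map _ _).
have /allpairsP[[f0' phi0'] /= [f0s sep0 [ef0 ephi0]]] := fs0.
rewrite -{}ef0 -{}ephi0 {f0' phi0'} in f0s sep0.
rewrite mem_enum in sep0.
have {lmin}exmin (f : term) (phi : slotmap) : f \in fs -> separated phi -> lex_le (ex f0 phi0) (ex f phi).
  by move=> ffs sep; apply: (lmin (f, phi)); apply: allpairs_f => //; rewrite mem_enum.
have [|s0 [rest [sepE restP]]] := @separator_lead k D M block_pairs.
  by move=> q; rewrite mem_filter => /andP[].
set n0 := ex f0 phi0 in exmin.
(* The first summand leaves room for the matrix units, the second one for the
   degrees already present in the leading term. *)
exists (r * M + \sum_j (n0 j + r * block s0 j))%N => t n nN ndec W sW WF Wn'.
have [adm|] := boolP [forall j, n j == deg (t j) %[mod r]]; last first.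
  rewrite negb_forall => /existsP[j nj].
  rewrite (@prod_eq0 _ _ _ j) ?mem_index_enum //; first exact: subspace0.
  exact: T_adm.
pose a j := (n j - (n0 j + r * block s0 j))%N.
have an j : (n j = n0 j + a j + r * block s0 j)%N.
  rewrite /a addnAC subnKC //; apply: leq_trans (nN j).
  by rewrite (bigD1 j) //= addnCA leq_addr.
pose i0 j := (f0.2 (slot phi0 j)).1.
pose U j y := coord e (i0 j) y *: e`_(t j).
have Uspan j : op_span M (a j) (U j).
  apply: matrix_units.
    rewrite /a leq_subRL; last first.
      apply: leq_trans (nN j); by rewrite (bigD1 j) //= addnCA leq_addr.
    by apply: leq_trans (nN j); rewrite (bigD1 j) //= addnCA leq_add2l addnC leq_addl.
  have /forallP/(_ j)/eqP <- := adm.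
  rewrite -modnDmr -(fs_adm f0s (slot phi0 j)) modnDmr an.
  by rewrite [in RHS]addnC [(r * _)%N]mulnC modnMDl addnC.
have totE u (f : term) (phi : slotmap) : u \in separator k block_pairs -> f \in fs -> separated phi ->
    (p0 + \sum_j a j + r * size block_pairs =
     \sum_j (ex f phi j + a j + r * block u.2 j + K))%N.
  move=> /separator_total <- ffs sep; rewrite (partition_big fst predT) //=.
  rewrite !big_split /= big_distrr /= -(fs_pot ffs) big_split /=.
  rewrite (reindex (slot phi)) /=; last first.
    by apply: onW_bij; apply: injF_bij; exact: slot_inj.
  by rewrite -!addnA; congr addn; rewrite addnC -!addnA.
have lead0 : (1, s0) \in separator k block_pairs by rewrite sepE mem_head.
have := sep_sum_ops Uspan; rewrite (totE _ _ _ lead0 f0s sep0) /=.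
under eq_bigr do rewrite -an.
move=> /WF WG.
pose n' (u : k * {ffun Q -> nat}) f phi j := (ex f phi j + a j + r * block u.2 j)%N.
pose X (u : k * {ffun Q -> nat}) (f : term) (phi : slotmap) :=
  \prod_j T (U j e`_(f.2 (slot phi j)).1) (n' u f phi j).
have coordE (i j : 'I_m) : coord e i e`_j = (i == j)%:R.
  by rewrite coord_free ?(basis_free e_basis) // eq_sym.
have X0 u (f : term) (phi : slotmap) : ~~ [forall j, (f.2 (slot phi j)).1 == i0 j] -> X u f phi = 0.
  rewrite negb_forall => /existsP[j nj].
  rewrite /X (@prod_eq0 _ _ _ j) ?mem_index_enum //.
  by rewrite /U coordE eq_sym (negbTE nj) scale0r T0.
have X1 u (f : term) (phi : slotmap) : [forall j, (f.2 (slot phi j)).1 == i0 j] ->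
    X u f phi = \prod_j T e`_(t j) (n' u f phi j).
  move=> /forallP eqi; apply: eq_bigr => j _.
  by rewrite /U (eqP (eqi j)) coordE eqxx scale1r.
have Wlow u (f : term) (phi : slotmap) : u \in separator k block_pairs -> f \in fs -> separated phi ->
    lex_lt n (n' u f phi) -> W (X u f phi).
  move=> us ffs sep ltn; have [eqi|neqi] := boolP [forall j, (f.2 (slot phi j)).1 == i0 j]; last first.
    by rewrite X0 //; exact: subspace0.
  rewrite X1 //; apply: Wn'; last exact: lex_lt_powers.
  apply/eqP; rewrite -(eqn_add2r (\sum_(j < D) K)) -!big_split /= -totE //.
  rewrite (totE _ _ _ lead0 f0s sep0); apply/eqP/eq_bigr => j _.
  by rewrite an.
pose hit (f : term) (phi : slotmap) := [forall j, f.2 (slot phi j) == f0.2 (slot phi0 j)].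
have Wrest u : u \in rest -> W (\sum_(f <- fs) f.1%:K * \sum_(phi | separated phi) X u f phi).
  move=> ur; apply: subspace_sum_seq => // f ffs; apply: (subspaceZ sW).
  apply: subspace_sum => // phi sep; apply: Wlow => //.
    by rewrite sepE inE ur orbT.
  have ltr : lex_lt (fun j => a j + r * block s0 j)%N (fun j => a j + r * block u.2 j)%N.
    have [j [ej lj]] := restP u ur.
    by exists j; split=> [i /ej ->|]; rewrite // ltn_add2l ltn_mul2l r_gt0.
  have [j [ej lj]] := lex_le_ltD (exmin f phi ffs sep) ltr.
  by exists j; split=> [i /ej|]; rewrite an /n' -!addnA.
have Wlead (f : term) (phi : slotmap) : f \in fs -> separated phi ->
    W (X (1, s0) f phi - (hit f phi)%:R * \prod_j T e`_(t j) (n j)).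
  move=> ffs sep; have [hitf|nhit] := boolP (hit f phi).
    rewrite mul1r X1; last by apply/forallP => j; rewrite (eqP (forallP hitf j)).
    rewrite [X in _ - X](_ : _ = \prod_j T e`_(t j) (n' (1, s0) f phi j)) ?subrr; first exact: subspace0.
    by apply: eq_bigr => j _; rewrite an /n' /ex (eqP (forallP hitf j)).
  rewrite mul0r subr0; case: (exmin f phi ffs sep) => [eqn|ltn].
    rewrite X0; first exact: subspace0.
    apply: contra nhit => /forallP eqi; apply/forallP => j.
    by have := eqn j; have := eqi j; rewrite /n0 /ex /i0 /=; case: (f.2 _) => ? ? /= /eqP -> <-; case: (f0.2 _).
  apply: Wlow => //; have [j [ej lj]] := ltn.
  exists j; split=> [i ij|]; rewrite an /n' /= ?ltn_add2r //; by rewrite ej.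
rewrite /sep_sum sepE big_cons /= kcst1 mul1r in WG.
have {WG Wrest}W0 : W (\sum_(f <- fs) f.1%:K * \sum_(phi | separated phi) X (1, s0) f phi).
  rewrite -[X in W X](addrK (\sum_(u <- rest) u.1%:K * \sum_(f <- fs) f.1%:K * \sum_(phi | separated phi) X u f phi)).
  apply: (subspaceB sW WG); apply: subspace_sum_seq => // u ur.
  by apply: (subspaceZ sW); exact: Wrest.
have W1 : W ((\sum_(f <- fs) \sum_(phi | separated phi) f.1 * (hit f phi)%:R)%:K *
    \prod_j T e`_(t j) (n j)).
  rewrite rmorph_sum mulr_suml /=.
  move: W0; set Z := (X in W X -> _); set Z' := (X in _ -> W X) => W0.
  apply: (subspace_congr sW _ W0); rewrite -opprB; apply: (subspaceN sW).
  rewrite /Z /Z' -sumrB; apply: subspace_sum_seq => // f ffs.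
  rewrite rmorph_sum /= mulr_suml mulr_sumr -sumrB; apply: subspace_sum => // phi sep.
  rewrite rmorphM /= -mulrA -mulrBr; apply: (subspaceZ sW).
  by rewrite rmorph_nat; exact: Wlead.
have hitf0 (f : term) (phi : slotmap) : f \in fs -> separated phi -> hit f phi -> f = f0.
  move=> ffs sep /forallP hitf; apply: fs_inj => //.
  rewrite (perm_trans (codom_slot _ sep)) // perm_sym (perm_trans (codom_slot _ sep0)) //.
  suff -> : codom (fun j => f.2 (slot phi j)) = codom (fun j => f0.2 (slot phi0 j)) by [].
  by apply: eq_codom => j; exact/eqP.
move: W1; rewrite (bigD1_seq f0) //= [X in _ + X]big1_seq ?addr0; last first.
  move=> f /andP[nf ffs]; rewrite big1 // => phi sep.
  case hitf: (hit f phi); last by rewrite mulr0.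
  by rewrite (hitf0 f phi) ?eqxx in nf.
rewrite -mulr_sumr -natr_sum => W1.
have nz : f0.1 * (\sum_(phi | separated phi) hit f0 phi)%N%:R != 0.
  rewrite mulf_neq0 ?fs_coef // ((pcharf0P k).1 char0).
  by rewrite (bigD1 phi0) //= (_ : hit f0 phi0) //; exact/forallP.
have := subspaceZ sW (f0.1 * (\sum_(phi | separated phi) hit f0 phi)%N%:R)^-1 W1.
by rewrite mulrA -rmorphM /= mulVf // rmorph1 mul1r.
Qed.

End Leading.
End Relation.

(** ** Normal forms and their growth *)

Section NormalForms.
Context (K : nat) (K_gt0 : (0 < K)%N) (D N : nat).
Local Notation F := (filt K).
Hint Resolve filt_subspace : core.
Local Notation letter := ('I_m * nat)%type.
Hypothesis leading : forall (t : 'I_D -> 'I_m) (n : 'I_D -> nat),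
  (forall j, (N <= n j)%N) -> (forall i j : 'I_D, (i <= j)%N -> (n j <= n i)%N) ->
  forall W : set A, subspace W ->
  (forall x, F (\sum_j (n j + K))%N x -> W x) ->
  (forall n', (\sum_j n' j = \sum_j n j)%N ->
     (\sum_j D.+1 ^ n j < \sum_j D.+1 ^ n' j)%N -> W (\prod_j T e`_(t j) (n' j))) ->
  W (\prod_j T e`_(t j) (n j)).

Definition key p : finType :=
  ({ffun 'I_m * 'I_N -> 'I_p.+1} * D.-tuple (option ('I_m * 'I_p.+1)))%type.

(** The monomial with prescribed exponents in the finitely many letters of
    t-degree below N, times at most D letters of higher degree. *)
Definition key_word p (h : key p) : seq letter :=
  flatten [seq nseq (h.1 v) (v.1, val v.2) | v <- enum {: 'I_m * 'I_N}] ++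
  [seq (v.1, val v.2) | v <- pmap id h.2].

Definition normal p : set A := lspan [set` [seq word (key_word h) | h <- enum (key p)]].

(** The second induction parameter: it grows at each rewriting step within a fixed
    potential and is bounded there. *)
Definition powers (s : seq letter) := (\sum_(v <- s) D.+1 ^ v.2)%N.

Lemma word_perm s s' : perm_eq s s' -> F (potential K s) (word s - word s').
Proof.
move=> ss'; exact: (filt_perm K_gt0 (fun v : letter => e`_v.1) (fun v : letter => v.2) ss').
Qed.

Lemma mem_potential v s : v \in s -> (v.2 < potential K s)%N.
Proof.
move=> /perm_to_rem /(perm_big _) E; rewrite /potential E big_cons /=.
by apply: leq_trans (leq_addr _ _); rewrite -addn1 leq_add2l.
Qed.

Lemma size_potential s : (size s <= potential K s)%N.
Proof.
rewrite /potential -sum1_size leq_sum // => v _.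
by rewrite (leq_trans K_gt0) ?leq_addl.
Qed.

Lemma powers_bound s : (powers s <= potential K s * D.+1 ^ potential K s)%N.
Proof.
apply: (@leq_trans (size s * D.+1 ^ potential K s)).
  rewrite /powers -sum1_size big_distrl big_seq [X in (_ <= X)%N]big_seq /=.
  by apply: leq_sum => v vs; rewrite mul1n leq_pexp2l // ltnW // mem_potential.
by rewrite leq_mul2r size_potential orbT.
Qed.

Lemma key_word_perm p (s : seq letter) : (potential K s <= p)%N ->
  (size [seq v <- s | (N <= v.2)%N] < D)%N -> exists h : key p, perm_eq s (key_word h).
Proof.
move=> sp bigD.
have small_p v : v \in s -> (v.2 < p.+1)%N.
  by move=> /mem_potential vs; rewrite ltnS ltnW // (leq_trans vs).
pose h1 := [ffun v : 'I_m * 'I_N => inord (count_mem (v.1, val v.2) s) : 'I_p.+1].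
pose b := [seq Some (v.1, inord v.2 : 'I_p.+1) | v <- s & (N <= v.2)%N].
pose b' := b ++ nseq (D - size b) None.
have sb' : size b' == D by rewrite size_cat size_nseq subnKC // size_map ltnW.
exists (h1, Tuple sb'); rewrite -(perm_filterC (fun v : letter => v.2 < N)%N s) perm_sym.
apply: perm_cat => /=.
  apply/permP => a; rewrite count_flatten sumnE big_map big_map big_enum /=.
  have h1E v : h1 v = count_mem (v.1, val v.2) [seq u <- s | (u.2 < N)%N] :> nat.
    rewrite ffunE inordK; last first.
      by rewrite ltnS (leq_trans (count_size _ _)) // (leq_trans (size_potential _)).
    rewrite count_filter; apply: eq_count => u /=.
    by case: eqP => // -> /=; rewrite ltn_ord.
  under eq_bigr => v _ do rewrite count_nseq h1E -sum1_count big_mkcond big_distrr /=.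
  rewrite exchange_big -sum1_count [RHS]big_mkcond /=.
  apply: eq_big_seq => -[u1 u2]; rewrite mem_filter /= => /andP[uN _].
  rewrite (bigD1 (u1, Ordinal uN)) //= eqxx muln1.
  rewrite big1 ?addn0 => [|[v1 v2] vu /=]; first by case: (a _).
  case: eqP => [[uv1 uv2]|]; last by rewrite muln0.
  by case/eqP: vu; rewrite uv1; congr pair; exact/val_inj.
rewrite /b' pmap_cat (_ : pmap id (nseq _ _) = [::]) ?cats0; last by elim: (_ - _)%N.
have -> : pmap id b = [seq (v.1, inord v.2 : 'I_p.+1) | v <- s & (N <= v.2)%N].
  by rewrite /b; elim: [seq _ <- s | _] => //= v l ->.
rewrite -map_comp map_id_in => [|v] /=; last first.
  by rewrite mem_filter => /andP[_ /small_p vp]; rewrite inordK // -surjective_pairing.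
by rewrite (eq_filter (a2 := predC (fun v : letter => v.2 < N)%N)) // => v; rewrite /= leqNgt.
Qed.

Lemma normal_subspace p : subspace (normal p). Proof. exact: lspan_subspace. Qed.

Lemma normal_word p (s : seq letter) : (potential K s <= p)%N ->
  (forall x, F (potential K s) x -> normal p x) ->
  (size [seq v <- s | (N <= v.2)%N] < D)%N -> normal p (word s).
Proof.
move=> sp FZ /(key_word_perm sp)[h sh].
apply: (subspace_congr (normal_subspace p) (FZ _ (word_perm sh))).
by apply: sub_lspan; apply: map_f; rewrite mem_enum.
Qed.

(** Induction on the potential and, inside it, on how far [powers] is from its bound:
    a word with D letters of degree at least N is rewritten by the leading relation,
    applied to its D letters of highest degree. *)
Lemma filt_normal p q : (q <= p.+1)%N -> forall x, F q x -> normal p x.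
Proof.
elim: q => [_ x /filt0 ->|q IHq qp]; first exact: (subspace0 (normal_subspace p)).
have {}IHq := IHq (ltnW qp).
apply: filt_min; first exact: normal_subspace.
move=> s; rewrite ltnS leq_eqVlt => /orP[/eqP sq|sq]; last first.
  by apply: IHq; exact: word_filt.
move: s sq; suff Z B s : potential K s = q -> (q * D.+1 ^ q < powers s + B)%N ->
    normal p (word s).
  by move=> s sq; apply: (Z (q * D.+1 ^ q).+1%N) => //; rewrite addnS ltnS leq_addl.
elim: B s => [|B IHB] s sq sB.
  by have := powers_bound s; rewrite sq leqNgt -[powers s]addn0 sB.
have [Dbig|bigD] := leqP D (size [seq v <- s | (N <= v.2)%N]); last first.
  by apply: normal_word; rewrite ?sq.
pose dec : rel letter := fun u v => (v.2 <= u.2)%N.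
pose big := sort dec [seq v <- s | (N <= v.2)%N].
pose rest := drop D big ++ [seq v <- s | (v.2 < N)%N].
have sizet : size (take D big) == D by rewrite size_takel // size_sort.
pose t : D.-tuple letter := Tuple sizet.
have st : perm_eq s (t ++ rest).
  rewrite catA cat_take_drop -(perm_filterC (fun v : letter => v.2 < N)%N s) perm_catC.
  apply: perm_cat => //; rewrite perm_sym perm_sort.
  by rewrite (eq_filter (a2 := predC (fun v : letter => v.2 < N)%N)) // => v; rewrite /= leqNgt.
apply: (subspace_congr (normal_subspace p) (IHq _ _)).
  by rewrite -sq; exact: word_perm st.
have pot_t : (\sum_j ((tnth t j).2 + K) = potential K t)%N by rewrite /potential big_tuple.
have potE : (potential K t + potential K rest = q)%N.
  by rewrite -potentialcat -sq /potential (perm_big _ st).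
rewrite wordcat {1}/word big_tuple.
apply: (@leading (fun j => (tnth t j).1) (fun j => (tnth t j).2) _ _
  (fun x => normal p (x * word rest))) => [j|i j ij||x|n' n'sum n'pow].
- have : tnth t j \in big by apply: (mem_take (mem_tnth j t)).
  by rewrite mem_sort mem_filter => /andP[].
- have dec_sorted : sorted dec t.
    apply: take_sorted; apply: sort_sorted => u v; exact: leq_total.
  have x0 := tnth t i; rewrite !(tnth_nth x0).
  apply: (sorted_leq_nth _ _ x0 dec_sorted) => //; rewrite ?inE ?size_tuple //.
    by move=> u v w uv vw; exact: leq_trans vw uv.
  by move=> u; exact: leqnn.
- exact: subspace_mulr (normal_subspace p).
- rewrite pot_t => Fx; apply: IHq; rewrite -potE.
  by apply: filtMl => //; exact: word_filt.
pose t' := [tuple ((tnth t j).1, n' j) | j < D].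
have -> : \prod_j T e`_(tnth t j).1 (n' j) = word t'.
  by rewrite /word big_tuple; apply: eq_bigr => j _; rewrite tnth_mktuple.
rewrite -wordcat; apply: IHB.
  rewrite potentialcat -potE; congr addn; rewrite -pot_t /potential big_tuple.
  rewrite !big_split /= -n'sum; congr addn.
  by apply: eq_bigr => j _; rewrite tnth_mktuple.
apply: leq_trans sB _; rewrite addnS -addSn leq_add2r.
have -> : powers s = (powers t + powers rest)%N by rewrite /powers (perm_big _ st) /= big_cat.
rewrite [powers (_ ++ _)]big_cat /= -addSn leq_add2r.
rewrite /powers !(big_tuple _ _ t) (big_tuple _ _ t'); apply: leq_trans n'pow _.
by apply/eq_leq; apply: eq_bigr => j _; rewrite tnth_mktuple.
Qed.

Let leq_exp a b c : (a <= b -> a ^ c <= b ^ c)%N.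
Proof. by move=> ab; case: c => // c; rewrite leq_exp2r. Qed.

Lemma sdim_filt p (V : set A) : (forall x, V x -> F p.+1 x) ->
  (sdim V <= (p + m + 3) ^ (m * N + 2 * D))%N.
Proof.
move=> VF; apply: (leq_trans (sdim_le (s := [seq word (key_word h) | h <- enum (key p)]) _)).
  by move=> x /VF; exact: filt_normal.
rewrite size_map -cardE card_prod card_ffun card_tuple card_option !card_prod !card_ord.
rewrite expnD mulnC [(_ ^ (2 * D))%N]expnM [X in (_ <= X)%N]mulnC.
apply: leq_mul; apply: leq_exp; last by lia.
by nia.
Qed.

End NormalForms.

Section Growth.
Local Notation letter := ('I_m * nat)%type.
Hypothesis words_span : forall a, lspan (fun x => exists s, x = word s) a.

Lemma filt_exhausts K a : exists p, filt K p.+1 a.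
Proof.
pose W x := exists p, filt K p.+1 x.
apply: (lspan_min (W := W) _ _ (words_span a)) => [|x [s ->]]; last first.
  by exists (potential K s); exact: word_filt.
split; first by exists 0%N; exact: (subspace0 (filt_subspace _ _)).
move=> c x y [p Fx] [q Fy]; exists (p + q)%N; apply: (subspaceP (filt_subspace _ _)).
  by apply: filt_mono Fx; rewrite ltnS leq_addr.
by apply: filt_mono Fy; rewrite ltnS leq_addl.
Qed.

Lemma expS_filt K q (V : set A) n : (forall x, V x -> filt K q.+1 x) ->
  forall x, expS V n x -> filt K (q * n).+1 x.
Proof.
move=> VF; elim: n => [|n IHn] /=.
  apply: lspan_min; first exact: filt_subspace.
  by move=> x ->; rewrite muln0; exact: filt1.
apply: lspan_min; first exact: filt_subspace.
move=> _ [x Vx [y Vy <-]]; rewrite mulnS; apply: filtMM; first exact: VF.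
exact: IHn.
Qed.

Lemma fin_dim_filt K (V : set A) : fin_dim V -> exists q, forall x, V x -> filt K q.+1 x.
Proof.
move=> [s ->]; suff [q qs] : exists q, forall x, x \in s -> filt K q.+1 x.
  by exists q; apply: lspan_min => //; exact: filt_subspace.
elim: s => [|x s [q qs]]; first by exists 0%N.
have [p px] := filt_exhausts K x; exists (p + q)%N => y; rewrite inE => /orP[/eqP->|/qs].
  by apply: filt_mono px; rewrite ltnS leq_addr.
by apply: filt_mono; rewrite ltnS leq_addl.
Qed.

(** Words may be sorted modulo smaller potential; this picks one word in each class
    of words up to permutation. *)
Lemma sorted_expansion x : exists (ms : seq (seq letter)) (c : seq letter -> k),
  [/\ uniq ms, forall s, s \in ms -> c s != 0,
      forall s v, s \in ms -> v \in s -> v.2 = deg v.1 %[mod r],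
      {in ms &, forall s s', perm_eq s s' -> s = s'} &
      x = \sum_(s <- ms) (c s)%:K * word s].
Proof.
pose le_letter : rel letter := fun u v => (choice.pickle u <= choice.pickle v)%N.
pose P (s : seq letter) := sorted le_letter s && all (fun v => v.2 == deg v.1 %[mod r]) s.
have sort_inj s s' : P s -> P s' -> perm_eq s s' -> s = s'.
  move=> /andP[ss _] /andP[ss' _]; apply: (sorted_eq _ _ ss ss').
    by move=> u v w; exact: leq_trans.
  by move=> u v /anti_leq /(pcan_inj choice.pickleK).
pose W x := exists (ms : seq (seq letter)) (c : seq letter -> k),
  [/\ uniq ms, all P ms & x = \sum_(s <- ms) (c s)%:K * word s].
have sW : subspace W.
  split; first by exists [::], (fun=> 0); rewrite big_nil.
  move=> d _ _ [ms1 [c1 [u1 P1 ->]]] [ms2 [c2 [u2 P2 ->]]].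
  pose ms := undup (ms1 ++ ms2).
  pose ext (msi : seq (seq letter)) (ci : seq letter -> k) s := if s \in msi then ci s else 0.
  have extE msi ci : uniq msi -> {subset msi <= ms} ->
      \sum_(s <- msi) (ci s)%:K * word s = \sum_(s <- ms) (ext msi ci s)%:K * word s.
    move=> ui sub; transitivity (\sum_(s <- ms | s \in msi) (ci s)%:K * word s).
      rewrite -[RHS]big_filter; apply: perm_big; apply: uniq_perm => //.
        by rewrite filter_uniq ?undup_uniq.
      by move=> s; rewrite mem_filter; case: (boolP (s \in msi)) => // /sub ->.
    rewrite big_mkcond; apply: eq_bigr => s _; rewrite /ext; case: ifP => // _.
    by rewrite rmorph0 mul0r.
  exists ms, (fun s => d * ext ms1 c1 s + ext ms2 c2 s); split.
  - exact: undup_uniq.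
  - by apply/allP => s; rewrite mem_undup mem_cat => /orP[/(allP P1)|/(allP P2)].
  rewrite (extE ms1) // => [|s]; last by rewrite mem_undup mem_cat => ->.
  rewrite (extE ms2) // => [|s]; last by rewrite mem_undup mem_cat => ->; rewrite orbT.
  rewrite mulr_sumr -big_split; apply: eq_bigr => s _.
  by rewrite rmorphD rmorphM mulrDl mulrA.
have Wfilt p : forall y, filt 1 p y -> W y.
  elim: p => [y /filt0 ->|p IHp]; first exact: (subspace0 sW).
  apply: filt_min => // s sp; pose s' := sort le_letter s.
  apply: (@subspace_congr _ _ _ sW _ (word s')).
    apply: IHp; apply: (@filt_mono 1 (potential 1 s)) => //.
    by apply: word_perm => //; rewrite perm_sym perm_sort.
  have [adm|] := boolP (all (fun v => v.2 == deg v.1 %[mod r]) s').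
    exists [:: s'], (fun=> 1); rewrite big_seq1 kcst1 mul1r; split=> //=.
    rewrite andbT /P adm andbT; apply: sort_sorted => u v; exact: leq_total.
  case/allPn => v vs nv; rewrite /word (prod_eq0 vs) ?T_adm //; exact: (subspace0 sW).
have [p Fx] := filt_exhausts 1 x; have [ms [c [ums Pms xE]]] := Wfilt _ _ Fx.
exists [seq s <- ms | c s != 0], c; split.
- exact: filter_uniq.
- by move=> s; rewrite mem_filter => /andP[].
- move=> s v; rewrite mem_filter => /andP[_ /(allP Pms)/andP[_ /allP sP]].
  by move=> /sP/eqP.
- move=> s s'; rewrite !mem_filter => /andP[_ /(allP Pms) Ps] /andP[_ /(allP Pms) Ps'].
  exact: sort_inj.
rewrite xE big_filter [RHS]big_mkcond; apply: eq_bigr => s _.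
by case: eqP => // ->; rewrite rmorph0 mul0r.
Qed.

(** The words of maximal potential form the relation to be differentiated.  If V lies
    in step q of the filtration, then V^n lies in step q n, whose dimension is at
    most that of the normal forms. *)
Lemma growth_of_relation (ms : seq (seq letter)) (c : seq letter -> k) :
  ms != [::] -> uniq ms -> (forall s, s \in ms -> c s != 0) ->
  (forall s v, s \in ms -> v \in s -> v.2 = deg v.1 %[mod r]) ->
  {in ms &, forall s s', perm_eq s s' -> s = s'} ->
  \sum_(s <- ms) (c s)%:K * word s = 0 ->
  exists E, forall V : set A, fin_dim V ->
    \forall n \near \oo%classic, (sdim (expS V n) <= n ^ E)%N.
Proof.
move=> ms0 ums c0 adm ms_inj rel.
pose wt (s : seq letter) := (\sum_(v <- s) v.2)%N.
(* K exceeds the total degree of each word, so larger potential means greater or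
   equal length, and equal potential means equal length. *)
pose K := (\sum_(s <- ms) wt s).+1.
have potE s : potential K s = (size s * K + wt s)%N.
  by rewrite /potential big_split /= addnC big_const_seq count_predT iter_addn_0 mulnC.
have wtK s : s \in ms -> (wt s < K)%N.
  by move=> sms; rewrite ltnS (big_rem s) //= leq_addr.
have [s0 s0ms s0max] : exists2 s0, s0 \in ms & forall s, s \in ms -> (potential K s <= potential K s0)%N.
  elim: (ms) ms0 => // s [|s' l] IHl _.
    by exists s; rewrite ?mem_head // => s'; rewrite inE => /eqP->.
  have [//|x xl xmax] := IHl; have [sx|xs] := leqP (potential K s) (potential K x).
    exists x; first by rewrite in_cons xl orbT.
    by move=> y; rewrite in_cons => /orP[/eqP->|/xmax].
  exists s; rewrite ?mem_head // => y; rewrite in_cons => /orP[/eqP->//|/xmax yx].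
  exact: leq_trans yx (ltnW xs).
pose D := size s0; pose p0 := potential K s0.
have sizeD s : s \in ms -> potential K s == p0 -> size s = D.
  move=> sms /eqP; rewrite /p0 !potE => /(congr1 (divn^~ K)).
  by rewrite !divnMDl // !divn_small ?addn0 ?wtK.
pose top := [seq s <- ms | potential K s == p0].
pose ts : seq (D.-tuple letter) := pmap insub top.
have tsE : map val ts = top.
  rewrite /ts pmap_filter; last exact: insubK.
  apply/all_filterP/allP => s; rewrite mem_filter => /andP[sp sms].
  by rewrite insubT /= ?sizeD.
pose f_of (t : D.-tuple letter) : k * {ffun 'I_D -> letter} := (c t, finfun (tnth t)).
pose fs := map f_of ts.
have word_f t : \prod_i T e`_((f_of t).2 i).1 ((f_of t).2 i).2 = word t.
  by rewrite /word big_tuple; apply: eq_bigr => i _; rewrite ffunE.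
have fsP f : f \in fs -> exists t : D.-tuple letter,
    [/\ f = f_of t, val t \in ms & potential K t = p0].
  case/mapP => t tts ->; exists t; split => //;
    have : val t \in top by [rewrite -tsE map_f | rewrite -tsE map_f].
    by rewrite mem_filter => /andP[].
  by rewrite mem_filter => /andP[/eqP].
have codom_f t : codom (f_of t).2 = t.
  rewrite (eq_codom (g := tnth t)) => [|i]; last by rewrite ffunE.
  by rewrite codomE map_tnth_enum.
have [|||||||N Nlead] := @leading_word K isT D p0 fs.
- move=> f /fsP[t [-> _ <-]]; rewrite /potential big_tuple.
  by apply: eq_bigr => i _; rewrite ffunE.
- have -> : \sum_(f <- fs) f.1%:K * \prod_i T e`_(f.2 i).1 (f.2 i).2 =
     \sum_(s <- top) (c s)%:K * word s.
    by rewrite -tsE !big_map; apply: eq_bigr => t _; rewrite word_f.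
  move: rel; rewrite (bigID (fun s => potential K s == p0)) /= -big_filter -/top.
  move/eqP; rewrite addr_eq0 => /eqP->; apply: (subspaceN (filt_subspace _ _)).
  rewrite big_seq_cond; apply: (subspace_sum (filt_subspace _ _)) => s /andP[sms np].
  apply: (subspaceZ (filt_subspace _ _)); apply: word_filt.
  by rewrite ltn_neqAle np s0max.
- rewrite -size_eq0 size_map -(size_map val) tsE size_eq0 -has_filter.
  by apply/hasP; exists s0.
- rewrite map_inj_uniq; last by move=> t t' [_ /ffunP tt']; apply: eq_from_tnth => i; have := tt' i; rewrite !ffunE.
  by rewrite -(map_inj_uniq val_inj) tsE filter_uniq.
- by move=> f /fsP[t [-> tms _]]; exact: c0.
- by move=> f /fsP[t [-> tms _]] j; rewrite ffunE; apply: (adm _ _ tms); exact: mem_tnth.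
- move=> f f' /fsP[t [-> tms _]] /fsP[t' [-> t'ms _]]; rewrite !codom_f => tt'.
  by congr f_of; apply/val_inj/ms_inj.
exists (m * N + 2 * D).+1 => V /(fin_dim_filt K)[q Vq].
(* The bound (q n + m + 3)^(m N + 2 D) on the number of normal forms is at most
   n^(m N + 2 D) times a constant, which one more factor n absorbs. *)
exists ((q + m + 4) ^ (m * N + 2 * D))%N => //= n /= qn.
apply: leq_trans (sdim_filt _ Nlead (expS_filt (n := n) Vq)) _ => //.
have n_gt0 : (0 < n)%N by apply: leq_trans qn; rewrite expn_gt0 addnS.
rewrite expnS; apply: leq_trans (leq_mul qn (leqnn _)); rewrite -expnMn.
have le_exp a b d : (a <= b -> a ^ d <= b ^ d)%N by move=> ab; case: d => // d; rewrite leq_exp2r.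
by apply: le_exp; nia.
Qed.

End Growth.
End Filtration.

(** * Burnside's theorem for transitive matrix spaces *)

Section Burnside.
Context (k : closedFieldType) (m : nat) (W : {vspace 'M[k]_m}).
Hypothesis m_gt0 : (0 < m)%N.
Hypothesis W_mul : forall X Y, X \in W -> Y \in W -> X *m Y \in W.
Hypothesis W_trans : forall u v : 'rV[k]_m, u != 0 -> exists2 X, X \in W & u *m X = v.

(** A nonzero element of minimal rank n factors as C R; compressing W to the
    n x n matrices R S C leaves only scalars, since an eigenvalue of R S C would
    lower the rank.  Transitivity then forces n = 1. *)
Lemma rank1_elt : exists (C : 'cV[k]_m) (R : 'rV[k]_m),
  [/\ C *m R \in W, C != 0 & R != 0].
Proof.
pose P n := `[< exists X, [/\ X \in W, X != 0 & \rank X = n] >].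
have exP : exists n, P n.
  pose i := Ordinal m_gt0; pose u : 'rV[k]_m := delta_mx 0 i.
  have u0 : u != 0 by apply/rV0Pn; exists i; rewrite mxE !eqxx oner_eq0.
  have [X XW uX] := W_trans u u0; exists (\rank X); apply/asboolP; exists X; split => //.
  by apply: contra_eq_neq uX => ->; rewrite mulmx0 eq_sym.
case: (ex_minnP exP) => n /asboolP[X [XW X0 rX]] nmin.
have [C [R [XE Cfull Rfree]]] :
    exists (C : 'M[k]_(m, (\rank X))) (R : 'M[k]_((\rank X), m)),
    [/\ C *m R = X, row_full C & row_free R].
  by exists (col_base X), (row_base X); rewrite mulmx_base col_base_full row_base_free.
have /row_fullP[L LC] := Cfull; have /row_freeP[L' RL'] := Rfree.
have Rk_gt0 : (0 < \rank X)%N by rewrite lt0n mxrank_eq0.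
have scal S : S \in W -> exists a, R *m S *m C = a%:M.
  move=> SW; have [a /eigenvalueP[v veig v0]] : exists a, eigenvalue (R *m S *m C) a.
    have /closed_rootP[a rt] : size (char_poly (R *m S *m C)) != 1.
      by rewrite size_char_poly eqSS -lt0n.
    by exists a; rewrite eigenvalue_root_char.
  exists a; apply/eqP; rewrite -subr_eq0; apply/negPn/negP => N0.
  pose N := R *m S *m C - a%:M.
  have NW : C *m N *m R \in W.
    have -> : C *m N *m R = X *m S *m X - a *: X.
      by rewrite /N mulmxBr mulmxBl mul_mx_scalar -scalemxAl !mulmxA XE -(mulmxA _ C R) XE.
    by rewrite rpredB ?rpredZ ?W_mul.
  have N'0 : C *m N *m R != 0.
    apply: contra N0 => /eqP E; have := congr1 (fun Z => L *m Z *m L') E.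
    by rewrite mulmx0 mul0mx !mulmxA LC mul1mx -mulmxA RL' mulmx1 => /eqP.
  have /nmin : P (\rank (C *m N *m R)) by apply/asboolP; exists (C *m N *m R).
  rewrite leqNgt -rX; case/negP; apply: (@leq_ltn_trans (\rank N)).
    exact: leq_trans (mxrankM_maxl _ _) (mxrankM_maxr _ _).
  rewrite ltn_neqAle rank_leq_row andbT; apply: contra v0 => Nfree.
  by rewrite -(mulmx_free_eq0 _ Nfree) mulmxBr veig mul_mx_scalar subrr.
have r1 : \rank X = 1%N.
  apply/eqP; rewrite eqn_leq Rk_gt0 andbT leqNgt; apply/negP => gt1.
  pose i0 := Ordinal Rk_gt0; pose i1 := Ordinal gt1.
  have u0 : (delta_mx 0 i0 : 'rV[k]_((\rank X))) *m R != 0.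
    apply/negP => /eqP E; have := congr1 (fun Z => Z *m L') E.
    rewrite -mulmxA RL' mulmx1 mul0mx => /(congr1 (fun Z : 'rV_ _ => Z 0 i0)).
    by rewrite !mxE !eqxx => /eqP; rewrite oner_eq0.
  have [S SW ES] := W_trans (delta_mx 0 i1 *m L) u0; have [a Ea] := scal S SW.
  have := congr1 (fun Z => (delta_mx 0 i0 *m Z : 'rV_ _) 0 i1) Ea.
  rewrite !mulmxA ES -mulmxA LC mulmx1 mul_mx_scalar !mxE !eqxx /= mulr0.
  by move=> /eqP; rewrite oner_eq0.
have : exists (C' : 'M[k]_(m, (\rank X))) (R' : 'M[k]_((\rank X), m)), C' *m R' = X by exists C, R.
rewrite r1 => -[C' [R' E]]; exists C', R'; rewrite E; split => //.
  by apply: contra_neq X0 => C0; rewrite -E C0 mul0mx.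
by apply: contra_neq X0 => R0; rewrite -E R0 mulmx0.
Qed.

(** From one matrix C R of rank 1, transitivity produces all matrices of the form
    (column) R, then all matrix units. *)
Lemma burnside : W = fullv.
Proof.
have [C [R [CRW C0 R0]]] := rank1_elt.
pose V := (linfun (mulmxr C) @: W)%VS.
have VT : V = fullv.
  apply/eqP; rewrite eqEdim subvf dimvf /dim /= muln1 leqNgt; apply/negP => Vm.
  pose B := \matrix_(i, j) (vbasis V)`_j i 0 : 'M[k]_(m, \dim V).
  have : kermx B != 0.
    by rewrite -mxrank_eq0 mxrank_ker subn_eq0 -ltnNge (leq_ltn_trans (rank_leq_col _)).
  case/rowV0Pn => u /sub_kermxP uB u0.
  have uV v : v \in V -> u *m v = 0.
    move=> /coord_vbasis ->; rewrite mulmx_sumr big1 // => j _.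
    rewrite -scalemxAr; suff -> : u *m (vbasis V)`_j = 0 by rewrite scaler0.
    apply/rowP => l; rewrite ord1 !mxE.
    have := congr1 (fun Z : 'rV_ _ => Z 0 j) uB; rewrite !mxE => uBj.
    rewrite -[RHS]uBj; by apply: eq_bigr => h _; rewrite mxE.
  have /cV0Pn[i Ci] := C0.
  have [S SW uS] := W_trans (delta_mx 0 i) u0.
  have /uV : S *m C \in V by apply/memv_imgP; exists S => //; rewrite lfunE.
  rewrite mulmxA uS -rowE => /(congr1 (fun Z : 'M[k]_(1, 1) => Z 0 0)).
  by rewrite !mxE => /eqP; rewrite (negbTE Ci).
apply/eqP; rewrite eqEsubv subvf; apply/subvP => X _.
rewrite [X]matrix_sum_delta; apply: rpred_sum => i _; apply: rpred_sum => j _.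
apply: rpredZ.
have /memv_imgP[S SW SC] : (delta_mx i 0 : 'cV_m) \in V by rewrite VT memvf.
have [S' S'W RS'] := W_trans (delta_mx 0 j) R0.
have -> : delta_mx i j = S *m (C *m R) *m S'.
  have {}SC : delta_mx i 0 = S *m C by rewrite SC lfunE.
  by rewrite mulmxA -mulmxA RS' -SC mul_delta_mx.
by rewrite !W_mul.
Qed.

End Burnside.

(** * The grading of g by the eigenspaces of sigma *)

Section Grading.
Context (k : fieldType) (char0 : [pchar k] =i pred0) (g : lieType k).
Context (sigma : lie_aut g) (r : nat) (eta : k).
Hypothesis sigma_r : iter r sigma =1 id.
Hypothesis eta_prim : r.-primitive_root eta.

Definition homog (n : nat) (x : g) := sigma x = eta ^+ n *: x.

(** The projection of g onto the eigenspace of sigma for eta^n. *)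
Definition proj (n : nat) (x : g) : g :=
  (r%:R : k)^-1 *: \sum_(j < r) (eta ^- n) ^+ j *: iter j sigma x.

Let r_gt0 : (0 < r)%N. Proof. exact: prim_order_gt0 eta_prim. Qed.
Let eta_neq0 : eta != 0.
Proof.
apply/negP => /eqP eta0; have := prim_expr_order eta_prim.
by rewrite eta0 expr0n eqn0Ngt r_gt0 => /esym/eqP; rewrite oner_eq0.
Qed.
Let r_neq0 : r%:R != 0 :> k.
Proof. by rewrite ((pcharf0P k).1 char0) -lt0n. Qed.

Lemma iter_linear j c x y : iter j sigma (c *: x + y) = c *: iter j sigma x + iter j sigma y.
Proof. by elim: j => //= j ->; rewrite linearP. Qed.

Lemma proj_linear n c x y : proj n (c *: x + y) = c *: proj n x + proj n y.
Proof.
rewrite /proj scalerA mulrC -scalerA -scalerDr; congr (_ *: _).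
rewrite scaler_sumr -big_split; apply: eq_bigr => j _ /=.
by rewrite iter_linear scalerDr !scalerA mulrC.
Qed.

Lemma homog_mod a b x : a = b %[mod r] -> homog a x -> homog b x.
Proof.
by move=> ab; rewrite /homog -(prim_expr_mod eta_prim a) ab prim_expr_mod.
Qed.

Lemma homog_iter a x j : homog a x -> iter j sigma x = (eta ^+ a) ^+ j *: x.
Proof.
move=> ax; elim: j => [|j /= ->]; first by rewrite scale1r.
by rewrite linearZ /= ax scalerA exprSr.
Qed.

Lemma proj_homog n x : homog n (proj n x).
Proof.
rewrite /homog /proj linearZ /= scalerA mulrC -scalerA; congr (_ *: _).
rewrite linear_sum scaler_sumr /=.
have [r' rE] : exists r', r = r'.+1 by exists r.-1; rewrite prednK.
have etar : (eta ^- n) ^+ r = 1.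
  by rewrite exprVn -exprM mulnC exprM (prim_expr_order eta_prim) expr1n invr1.
move: etar sigma_r; rewrite rE => etar sr.
rewrite big_ord_recr [RHS]big_ord_recl addrC /=; congr (_ + _).
  apply: eq_bigr => j _; rewrite linearZ /= scalerA; congr (_ *: _).
  by rewrite exprS mulrA divff ?expf_neq0 ?mul1r.
rewrite linearZ /=; have := sr x; rewrite /= => ->.
rewrite scalerA expr0 mulr1; congr (_ *: _).
apply: (mulfI (_ : eta ^- n != 0)); first by rewrite invr_neq0 ?expf_neq0.
by rewrite -exprS etar mulVf ?expf_neq0.
Qed.

(** Orthogonality of the characters of the cyclic group generated by sigma. *)
Lemma proj_of_homog n a x : homog a x -> proj n x = if a == n %[mod r] then x else 0.
Proof.
move=> ax; rewrite /proj; under eq_bigr do rewrite (homog_iter _ ax) scalerA -exprMn.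
rewrite -scaler_suml scalerA; set w := eta ^- n * eta ^+ a.
have [an|an] := ifPn.
  have -> : w = 1.
    rewrite /w; have /eqP <- : eta ^+ a == eta ^+ n by rewrite (eq_prim_root_expr eta_prim).
    by rewrite mulVf ?expf_neq0.
  by under eq_bigr do rewrite expr1n; rewrite sumr_const card_ord mulVf // scale1r.
have w1 : w - 1 != 0.
  rewrite subr_eq0; apply: contra an => /eqP w1; rewrite -(eq_prim_root_expr eta_prim).
  by apply/eqP; apply: (mulfI (_ : eta ^- n != 0)); rewrite ?invr_neq0 ?expf_neq0 // mulVf ?expf_neq0.
have -> : \sum_(i < r) w ^+ i = 0.
  apply: (mulfI w1); rewrite mulr0 -subrX1 /w exprMn exprVn -!exprM ![(_ * r)%N]mulnC.
  by rewrite !exprM (prim_expr_order eta_prim) !expr1n invr1 mulr1 subrr.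
by rewrite mulr0 scale0r.
Qed.

Lemma proj_mod a b x : a = b %[mod r] -> proj a x = proj b x.
Proof.
by move=> ab; rewrite /proj -(prim_expr_mod eta_prim a) ab prim_expr_mod.
Qed.

Lemma sum_proj x : \sum_(n < r) proj n x = x.
Proof.
rewrite /proj -scaler_sumr exchange_big /=.
under eq_bigr do rewrite -scaler_suml.
rewrite (bigD1 (Ordinal r_gt0)) //= [X in _ + X]big1 ?addr0 => [|j j0]; last first.
  have w1 : eta ^- j - 1 != 0.
    rewrite subr_eq0 invr_eq1 -(prim_order_dvd eta_prim); apply/negP => /eqP rj.
    by case/eqP: j0; apply/val_inj; rewrite /= -rj modn_small.
  suff -> : \sum_(i < r) (eta ^- i) ^+ j = 0 by rewrite scale0r.
  under eq_bigr do rewrite -exprVn -exprM mulnC exprM exprVn.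
  apply: (mulfI w1); rewrite mulr0 -subrX1 exprVn -exprM mulnC exprM.
  by rewrite (prim_expr_order eta_prim) expr1n invr1 subrr.
by under eq_bigr do rewrite expr0; rewrite sumr_const card_ord scalerA mulVf // scale1r.
Qed.

Lemma homog_lie a b x y : homog a x -> homog b y -> homog (a + b) (lie x y).
Proof.
move=> ax bx; rewrite /homog aut_lie ax bx lieZl linearZ /= scalerA.
by rewrite exprD.
Qed.

Lemma proj_lie a b x y : homog a x -> proj (a + b) (lie x y) = lie x (proj b y).
Proof.
move=> ax; rewrite {1}[y](esym (sum_proj y)) linear_sum /=.
have projD u v : proj (a + b) (u + v) = proj (a + b) u + proj (a + b) v.
  by rewrite -[u in LHS]scale1r proj_linear scale1r.
have proj0 : proj (a + b) 0 = 0 by apply: (addrI (proj (a + b) 0)); rewrite -projD !addr0.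
rewrite (big_morph _ projD proj0).
pose c := Ordinal (ltn_pmod b r_gt0).
rewrite (bigD1 c) //= [X in _ + X]big1 ?addr0 => [|j jc]; last first.
  rewrite (proj_of_homog _ (homog_lie ax (proj_homog _ _))) ifN //.
  rewrite eqn_modDl; apply: contra jc => /eqP jb; apply/eqP/val_inj => /=.
  by rewrite -jb modn_small.
rewrite (proj_of_homog _ (homog_lie ax (proj_homog _ _))) ifT.
  by congr lie; apply: proj_mod; rewrite modn_mod.
by rewrite eqn_modDl modn_mod.
Qed.

End Grading.

(** * Matrix units as combinations of words in the adjoint operators *)

Section SimpleLie.
Context (k : closedFieldType) (char0 : [pchar k] =i pred0) (g : finDimLieType k).
Hypothesis g_simple : simple_lie g.
Context (sigma : lie_aut g) (r : nat) (eta : k).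
Hypothesis sigma_r : iter r sigma =1 id.
Hypothesis eta_prim : r.-primitive_root eta.

Lemma free_subseq (V : vectType k) (X : seq V) :
  exists Y, [/\ {subset Y <= X}, free Y & <<Y>>%VS = <<X>>%VS].
Proof.
elim: X => [|x X [Y [YX Yfree YE]]]; first by exists [::]; rewrite nil_free.
have [xY|xY] := boolP (x \in <<Y>>%VS).
  exists Y; split => //; first by move=> y /YX; rewrite inE orbC => ->.
  by rewrite span_cons YE; apply/esym/addv_idPr; rewrite -YE -memvE.
exists (x :: Y); rewrite free_cons xY Yfree !span_cons YE; split => //.
by move=> y; rewrite !inE => /orP[->|/YX->]//; rewrite orbT.
Qed.

Lemma homog_basis : exists m (e : m.-tuple g) (deg : 'I_m -> nat),
  [/\ basis_of fullv e, forall i, homog sigma eta (deg i) e`_i & forall i, (deg i < r)%N].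
Proof.
pose X := [seq proj sigma r eta (val n) x | n <- enum 'I_r, x <- vbasis {:g}].
have [Y [YX Yfree YE]] := free_subseq X.
have XT : <<X>>%VS = fullv.
  apply/eqP; rewrite eqEsubv subvf -(span_basis (vbasisP fullv)); apply/span_subvP => x xb.
  rewrite -(sum_proj char0 sigma eta_prim x); apply: rpred_sum => n _.
  by apply: memv_span; apply/allpairsP; exists (n, x); rewrite mem_enum.
have degP (i : 'I_(size Y)) : exists n : 'I_r, homog sigma eta n Y`_i.
  have /YX/allpairsP[[n x] [/= _ _ ->]] : Y`_i \in Y by apply: mem_nth.
  by exists n; exact: proj_homog.
have [deg degE] := choice degP.
exists (size Y), (in_tuple Y), (fun i => val (deg i)); split => //.
  by rewrite /basis_of YE XT eqxx Yfree.
by move=> i; exact: ltn_ord.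
Qed.

Context (m : nat) (e : m.-tuple g) (e_basis : basis_of fullv e) (deg : 'I_m -> nat).
Hypothesis e_homog : forall i, homog sigma eta (deg i) e`_i.
Hypothesis deg_lt : forall i, (deg i < r)%N.

Let ecoord (y : g) : 'rV[k]_m := \row_i coord e i y.
Let evec (w : 'rV[k]_m) : g := \sum_j w 0 j *: e`_j.

Let evec_linear : linear evec.
Proof.
move=> c u v; rewrite scaler_sumr -big_split; apply: eq_bigr => j _ /=.
by rewrite !mxE scalerDl scalerA.
Qed.
HB.instance Definition _ := GRing.isLinear.Build k 'rV[k]_m g _ evec evec_linear.

Let ecoordK y : evec (ecoord y) = y.
Proof.
rewrite [RHS](coord_basis e_basis (memvf y)); apply: eq_bigr => j _.
by rewrite mxE.
Qed.

Let coordE (i j : 'I_m) : coord e i e`_j = (i == j)%:R.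
Proof. by rewrite coord_free ?(basis_free e_basis) // eq_sym. Qed.

Let evecK w : ecoord (evec w) = w.
Proof.
apply/rowP => i; rewrite mxE linear_sum (bigD1 i) //= linearZ /= coordE eqxx.
rewrite big1 ?addr0 => [|j ji]; first by rewrite [LHS]mulr1.
by rewrite linearZ /= coordE eq_sym (negbTE ji) [LHS]mulr0.
Qed.

Definition ad_mx (x : g) : 'M[k]_m := \matrix_(p, q) coord e q (lie x e`_p).

Let ad_mxE x y : ecoord y *m ad_mx x = ecoord (lie x y).
Proof.
apply/rowP => q; rewrite !mxE -[in RHS](ecoordK y) !linear_sum /=.
by apply: eq_bigr => p _; rewrite !mxE !linearZ.
Qed.

Let ecoord_inj X Y : (forall y, ecoord y *m X = ecoord y *m Y) -> X = Y :> 'M[k]_m.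
Proof. by move=> XY; apply/row_matrixP => i; rewrite !rowE -(evecK (delta_mx 0 i)). Qed.

Lemma ad_mx_linear : linear ad_mx.
Proof. move=> c x y; by apply/matrixP => p q; rewrite !mxE lieDZl linearP. Qed.

HB.instance Definition _ := GRing.isLinear.Build k g 'M[k]_m _ ad_mx ad_mx_linear.

Lemma ad_mx_lie x y : ad_mx (lie x y) = ad_mx y *m ad_mx x - ad_mx x *m ad_mx y.
Proof.
apply: ecoord_inj => z; rewrite mulmxBr !mulmxA !ad_mxE.
have ecoordB u v : ecoord (u - v) = ecoord u - ecoord v.
  by apply/rowP => i; rewrite !mxE linearB.
rewrite -ecoordB; congr ecoord; apply/eqP; rewrite eq_sym subr_eq; apply/eqP.
have := lie_jacobi x y z; rewrite [lie z x]lieC [lie z _]lieC linearN /= => /eqP.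
by rewrite subr_eq0 => /eqP E; rewrite -E subrK.
Qed.

Definition word_mx (s : seq 'I_m) : 'M[k]_m := foldr (fun (i : 'I_m) X => X *m ad_mx e`_i) 1%:M s.

Lemma word_mx_cat s t : word_mx (s ++ t) = word_mx t *m word_mx s.
Proof. by elim: s => [|i s IHs] /=; rewrite ?mulmx1 // IHs mulmxA. Qed.

Definition words_mx (M : nat) : {vspace 'M[k]_m} :=
  <<[seq word_mx (val t) | t : M.-tuple 'I_m]>>%VS.

Lemma word_mx_mem s : word_mx s \in words_mx (size s).
Proof. by apply: memv_span; apply/mapP; exists (in_tuple s); rewrite ?mem_enum. Qed.

Lemma words_mx_min M (V : {vspace 'M[k]_m}) :
  (forall s, size s = M -> word_mx s \in V) -> (words_mx M <= V)%VS.
Proof.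
by move=> sV; apply/span_subvP => X /mapP[t _ ->]; apply: sV; rewrite size_tuple.
Qed.

Lemma words_mxM M N X Y : X \in words_mx M -> Y \in words_mx N -> X *m Y \in words_mx (N + M).
Proof.
move=> XM YN.
pose V1 := (linfun (mulmxr Y) @^-1: words_mx (N + M))%VS.
suff /subvP/(_ X XM) : (words_mx M <= V1)%VS by rewrite -memv_preim lfunE.
apply: words_mx_min => s ss; rewrite -memv_preim lfunE /=.
pose V2 := (linfun (mulmx (word_mx s)) @^-1: words_mx (N + M))%VS.
suff /subvP/(_ Y YN) : (words_mx N <= V2)%VS by rewrite -memv_preim lfunE.
apply: words_mx_min => t tt; rewrite -memv_preim lfunE /= -word_mx_cat.
by rewrite -tt -ss -size_cat word_mx_mem.
Qed.

Lemma derived_full : lie_vspace fullv fullv = fullv :> {vspace g}.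
Proof.
have lieI (x y : g) : lie x y \in lie_vspace fullv fullv.
  rewrite [x](coord_vbasis (memvf x)) lie_suml; apply: rpred_sum => i _.
  rewrite lieZl; apply: rpredZ; rewrite [y](coord_vbasis (memvf y)) linear_sum.
  apply: rpred_sum => j _; rewrite linearZ; apply: rpredZ; apply: memv_span.
  by apply/allpairsP; exists ((vbasis fullv)`_i, (vbasis fullv)`_j); split=> //=;
    apply: mem_nth; rewrite size_tuple.
have [[x [y xy]] simple] := g_simple.
have ideal (u v : g) : v \in lie_vspace fullv fullv -> lie u v \in lie_vspace fullv fullv by [].
have [I0|//] := simple _ ideal.
by have := lieI x y; rewrite I0 memv0 (negbTE xy).
Qed.

Lemma ad_mx_words1 x : ad_mx x \in words_mx 1.
Proof.
rewrite (coord_basis e_basis (memvf x)) linear_sum; apply: rpred_sum => i _.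
by rewrite linearZ; apply: rpredZ; have := word_mx_mem [:: i]; rewrite /= mul1mx.
Qed.

(** As g = [g, g], an operator ad x is a combination of products of two such
    operators; hence the spans of words of fixed length increase. *)
Lemma ad_mx_words2 x : ad_mx x \in words_mx 2.
Proof.
pose V := (linfun ad_mx @^-1: words_mx 2)%VS.
suff /subvP/(_ x) : (lie_vspace fullv fullv <= V)%VS.
  by rewrite derived_full memvf -memv_preim lfunE; apply.
apply/span_subvP => _ /allpairsP[[u v] [_ _ ->]]; rewrite -memv_preim lfunE /=.
by rewrite ad_mx_lie rpredB // (words_mxM (ad_mx_words1 _) (ad_mx_words1 _)).
Qed.

Lemma words_mxS M : (words_mx M.+1 <= words_mx M.+2)%VS.
Proof.
apply: words_mx_min => -[//|i s] [ss] /=.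
have := words_mxM (word_mx_mem s) (ad_mx_words2 e`_i).
by rewrite ss.
Qed.

Lemma words_mx_mono M N : (0 < M)%N -> (M <= N)%N -> (words_mx M <= words_mx N)%VS.
Proof.
move=> M0 /subnK <-; elim: (N - M)%N => // n IHn.
by apply: (subv_trans IHn); case: M M0 {IHn} => // M _; rewrite !addnS; exact: words_mxS.
Qed.

Lemma dim_gt0 : (0 < m)%N.
Proof.
have [[x [y xy]] _] := g_simple; rewrite lt0n; apply: contra xy => /eqP m0.
rewrite (coord_basis e_basis (memvf x)) big1 ?lie0l // => i _.
by exfalso; move: i; rewrite m0 => -[].
Qed.

(** Words of one fixed length exhaust the matrix algebra: their spans increase,
    hence stabilize at an algebra, which acts irreducibly as g is simple. *)
Lemma words_mx_full : exists M, words_mx M.+1 = fullv.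
Proof.
have [M Mmax] : exists M, forall N, (\dim (words_mx N.+1) <= \dim (words_mx M.+1))%N.
  pose P n := `[< exists M, \dim (words_mx M.+1) = n >].
  have exP : exists n, P n by exists (\dim (words_mx 1)); apply/asboolP; exists 0%N.
  have Pub n : P n -> (n <= \dim {:'M[k]_m})%N.
    by move=> /asboolP[M <-]; exact/dimvS/subvf.
  case: (ex_maxnP exP Pub) => n /asboolP[M <-] nmax; exists M => N.
  by apply: nmax; apply/asboolP; exists N.
have stable N : (M <= N)%N -> words_mx N.+1 = words_mx M.+1.
  move=> MN; apply/esym/eqP; rewrite eqEdim words_mx_mono //=; exact: Mmax.
exists M; apply: burnside; first exact: dim_gt0.
  move=> X Y XM YM; rewrite -(stable (M.+1 + M)%N) ?leq_addl // -addnS.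
  exact: words_mxM.
move=> u v u0; have [[x0 [y0 xy0]] simple] := g_simple.
pose rows := (linfun (mulmx u) @: words_mx M.+1)%VS.
pose I : {vspace g} := (linfun evec @: rows)%VS.
have memI X : X \in words_mx M.+1 -> evec (u *m X) \in I.
  move=> XW; apply/memv_imgP; exists (u *m X); last by rewrite lfunE.
  by apply/memv_imgP; exists X; rewrite // lfunE.
have lie_evec x w : lie x (evec w) = evec (w *m ad_mx x).
  by rewrite -(evecK w) ad_mxE !ecoordK.
have idealI (x y : g) : y \in I -> lie x y \in I.
  move=> /memv_imgP[_ /memv_imgP[X XW ->] ->]; rewrite !lfunE /= lie_evec -mulmxA.
  apply: memI; rewrite -(stable M.+1) // -add1n.
  exact: words_mxM XW (ad_mx_words1 _).
have [I0|IT] := simple I idealI; last first.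
  have : evec v \in I by rewrite IT memvf.
  move=> /memv_imgP[_ /memv_imgP[X XW ->]]; rewrite !lfunE /= => /(congr1 ecoord).
  by rewrite !evecK => ->; exists X.
have z0 : evec u != 0.
  by apply: contra_neq u0 => z0; rewrite -(evecK u) z0; apply/rowP => i; rewrite !mxE linear0.
have center x : lie x (evec u) = 0.
  apply/eqP; rewrite lie_evec -memv0 -I0; apply: memI.
  exact: subvP (words_mx_mono _ _) _ (ad_mx_words1 x).
have idealz (x y : g) : y \in <[evec u]>%VS -> lie x y \in <[evec u]>%VS.
  by move=> /vlineP[c ->]; rewrite linearZ /= center scaler0 mem0v.
have [zl|zl] := simple _ idealz.
  by have := memv_line (evec u); rewrite zl memv0 (negbTE z0).
have /vlineP[c yc] : y0 \in <[evec u]>%VS by rewrite zl memvf.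
by move: xy0; rewrite yc linearZ /= center scaler0 eqxx.
Qed.

Lemma ad_mx_homog (i p q : 'I_m) : ad_mx e`_i p q != 0 -> deg q = deg p + deg i %[mod r].
Proof.
rewrite mxE => c0; apply/eqP; rewrite -(eq_prim_root_expr eta_prim); apply/negPn/negP => nq.
case/negP: c0; apply/eqP.
have hom : homog sigma eta (deg p + deg i) (lie e`_i e`_p).
  by rewrite addnC; exact: homog_lie.
have sE : sigma (lie e`_i e`_p) = \sum_j (coord e j (lie e`_i e`_p) * eta ^+ deg j) *: e`_j.
  rewrite {1}(coord_basis e_basis (memvf (lie e`_i e`_p))) linear_sum.
  by apply: eq_bigr => j _; rewrite linearZ /= (e_homog j) scalerA.
have := congr1 (coord e q) hom; rewrite linearZ /= {1}sE linear_sum (bigD1 q) //= big1.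
  rewrite addr0 linearZ /= coordE eqxx => /eqP; rewrite [X in X == _]mulr1 mulrC -subr_eq0 -mulrBl.
  by rewrite mulf_eq0 subr_eq0 (negbTE nq) => /eqP.
by move=> j jq; rewrite linearZ /= coordE eq_sym (negbTE jq) [LHS]mulr0.
Qed.

(** Words in homogeneous letters are homogeneous operators, so that the words whose
    degree has the wrong class modulo r may be dropped from any expansion of a
    matrix unit. *)
Lemma word_mx_homog s (p q : 'I_m) : word_mx s p q != 0 ->
  deg q = (deg p + \sum_(i <- s) deg i)%N %[mod r].
Proof.
elim: s q => [|i s IHs] q /=.
  by rewrite big_nil addn0 mxE; have [->//|_] := eqVneq p q; rewrite eqxx.
rewrite mxE => /eqP ne; have [j /eqP] : exists j, word_mx s p j * ad_mx e`_i j q <> 0.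
  by apply/existsNP => H; apply: ne; rewrite big1 // => j _; exact: H.
rewrite mulf_eq0 negb_or => /andP[/IHs Ej /ad_mx_homog ->].
by rewrite -modnDml Ej modnDml big_cons -addnA [(deg i + _)%N]addnC.
Qed.

Let op (X : 'M[k]_m) (y : g) : g := evec (ecoord y *m X).

Lemma op_word s y : op (word_mx s) y = foldr (fun (i : 'I_m) z => lie e`_i z) y s.
Proof.
elim: s => [|i s IHs] /=; first by rewrite /op mulmx1 ecoordK.
by rewrite -IHs /op mulmxA -[_ *m word_mx s]evecK ad_mxE !ecoordK.
Qed.

(** Once the degree classes agree modulo r, the missing multiple of r is added to the
    t-degree of the first letter. *)
Lemma matrix_unit_op_span : exists M, forall (i i0 : 'I_m) a, (r * M.+1 <= a)%N ->
  a + deg i0 = deg i %[mod r] ->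
  op_span e r deg M.+1 a (fun y => coord e i0 y *: e`_i).
Proof.
have [M MT] := words_mx_full; exists M => i i0 a ra ai.
have [c cE] : exists c : M.+1.-tuple 'I_m -> k, delta_mx i0 i = \sum_(t : M.+1.-tuple 'I_m) c t *: word_mx t.
  have : delta_mx i0 i \in words_mx M.+1 by rewrite MT memvf.
  rewrite -[words_mx _]/(span (in_tuple [seq word_mx (val t) | t : M.+1.-tuple 'I_m])) => /coord_span ->.
  set X := in_tuple _; have sX : size X = #|{: M.+1.-tuple 'I_m}| by rewrite /X /= size_map -cardE.
  have rk (t : M.+1.-tuple 'I_m) : (enum_rank t < size X)%N by rewrite sX.
  exists (fun t => coord X (Ordinal (rk t)) (delta_mx i0 i)).
  rewrite (reindex (fun t : M.+1.-tuple 'I_m => Ordinal (rk t))) /=; last first.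
    exists (fun l => enum_val (cast_ord sX l)) => [t _|l _] /=.
      by rewrite (_ : cast_ord _ _ = enum_rank t) ?enum_rankK //; exact/val_inj.
    by apply: val_inj; rewrite /= enum_valK.
  apply: eq_bigr => t _; congr (_ *: _).
  by rewrite /X /image_mem (nth_map t) -?cardE // nth_enum_rank.
pose cls (t : M.+1.-tuple 'I_m) := (\sum_(j <- t) deg j)%N.
have cE' : delta_mx i0 i = \sum_(t : M.+1.-tuple 'I_m | cls t == a %[mod r]) c t *: word_mx t.
  apply/matrixP => p q; rewrite summxE.
  have [dq|dq] := eqVneq (deg q %% r)%N ((deg p + a) %% r)%N; last first.
    rewrite mxE big1 => [|t /eqP ta].
      have [pi|//] := eqVneq p i0; have [qi|//] := eqVneq q i.
      by case/eqP: dq; rewrite pi qi addnC ai.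
    rewrite mxE; apply/eqP; rewrite mulf_eq0; apply/orP; right.
    apply: contraNT dq => /word_mx_homog ->.
    by rewrite -modnDmr ta modnDmr.
  rewrite cE summxE [LHS](bigID (fun t => cls t == a %[mod r])) /= [X in _ + X]big1 ?addr0 // => t ta.
  rewrite mxE; apply/eqP; rewrite mulf_eq0; apply/orP; right.
  apply: contraNT ta => /word_mx_homog; rewrite dq => /eqP; rewrite eqn_modDl eq_sym.
  by [].
have word_ops (t : M.+1.-tuple 'I_m) : cls t == a %[mod r] -> op_span e r deg M.+1 a (op (word_mx t)).
  move=> ta; apply: op_letter.
  have cls_le : (cls t <= a)%N.
    apply: leq_trans ra; rewrite /cls big_tuple.
    apply: (@leq_trans (\sum_(j < M.+1) r)); first by apply: leq_sum => j _; exact: ltnW.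
    by rewrite sum_nat_const card_ord mulnC.
  have ra' : (r %| a - cls t)%N by rewrite -eqn_mod_dvd // eq_sym.
  exists (tnth t), (fun j => deg (tnth t j) + (j == ord0) * (a - cls t))%N; split.
  - move=> j; case: (j == ord0); rewrite ?mul0n ?addn0 // mul1n.
    by rewrite -modnDmr (eqP ra') addn0.
  - rewrite big_split /= -big_distrl /= sum_indicator mul1n.
    by rewrite -(big_tuple _ _ t predT) subnKC.
  - move=> y; rewrite op_word -{1}(map_tnth_enum t).
    by rewrite foldr_map.
have -> : (fun y => coord e i0 y *: e`_i) = op (delta_mx i0 i).
  apply/funext => y; rewrite /op /evec (bigD1 i) //= big1 ?addr0 => [|j ji].
    rewrite !mxE (bigD1 i0) //= big1 ?addr0 => [|l li]; last by rewrite !mxE (negbTE li) mulr0.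
    by rewrite !mxE !eqxx mulr1.
  rewrite !mxE big1 ?scale0r // => l _; by rewrite !mxE (negbTE ji) andbF mulr0.
have op_lin_comb X Y d y : op (d *: X + Y) y = d *: op X y + op Y y.
  by rewrite /op mulmxDr -scalemxAr linearP.
rewrite cE'; elim/big_rec: _ => [|t X ta IH].
  by apply: op_zero => y; rewrite /op mulmx0 linear0.
exact: op_lin (word_ops t ta) IH (op_lin_comb _ _ _).
Qed.

End SimpleLie.

(** * Quotients of free and tensor algebras *)

Section QuotientMorphism.
Context {k : fieldType} {B : pzAlgType k} (I : ideal B).
Local Notation pi := (quot_pi I).

Lemma pi_mul x y : pi (x * y) = pi x * pi y. Proof. exact/esym/quot_piM. Qed.

Lemma pi_sub x y : pi (x - y) = pi x - pi y.
Proof. by apply/eqP; rewrite eq_sym subr_eq -quot_piD subrK. Qed.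

HB.instance Definition _ := GRing.isZmodMorphism.Build B (quot_alg I) pi pi_sub.
HB.instance Definition _ := GRing.isMonoidMorphism.Build B (quot_alg I) pi
  (conj (erefl _) pi_mul).

Lemma pi_cst c : pi c%:K = c%:K. Proof. by []. Qed.

Lemma pi_eq0 x : pi x = 0 <-> I x.
Proof. by rewrite -[0](raddf0 pi) quot_piP subr0. Qed.

Lemma pi_commutator a b c :
  pi (a * b - b * a - c) = pi a * pi b - pi b * pi a - pi c.
Proof. by rewrite !pi_sub !pi_mul. Qed.

Lemma pi_commutator2 a b : pi (a * b - b * a) = pi a * pi b - pi b * pi a.
Proof. by rewrite pi_sub !pi_mul. Qed.

Lemma pi_lincomb T (s : seq T) (c : T -> k) (f : T -> B) :
  pi (\sum_(i <- s) (c i)%:K * f i) = \sum_(i <- s) (c i)%:K * pi (f i).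
Proof. by rewrite raddf_sum; apply: eq_bigr => i _; rewrite /= pi_mul. Qed.

Lemma pi_prod T (s : seq T) (f : T -> B) :
  pi (\prod_(i <- s) f i) = \prod_(i <- s) pi (f i).
Proof. exact: rmorph_prod. Qed.

Lemma pi_lspan (X : set B) (Y : set (quot_alg I)) : (forall x, X x -> Y (pi x)) ->
  forall x, lspan X x -> lspan Y (pi x).
Proof.
move=> XY; pose W x := lspan Y (pi x).
suff: forall x, lspan X x -> W x by [].
apply: lspan_min => [|x Xx]; last by apply: sub_lspan; exact: XY.
split=> [|c x y Wx Wy]; first by rewrite /W raddf0; exact: (subspace0 (lspan_subspace _)).
by rewrite /W rmorphD rmorphM; exact: (subspaceP (lspan_subspace _)).
Qed.

End QuotientMorphism.

Section FreeSpan.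
Context (k : fieldType) (X : choiceType).

Definition monomial (w : fmonom X) (c : k) : free_alg k X := mkmalgU w c.

Lemma monomialM w w' c c' : monomial w c * monomial w' c' = monomial (mmul w w') (c * c').
Proof. by rewrite /monomial -[RHS](fgmulUU c c' w w') -malgM_def. Qed.

Lemma monomialE (s : seq X) c :
  monomial (FMonom s) c = c%:K * \prod_(v <- s) free_gen k v.
Proof.
elim: s c => [|v s IHs] c; first by rewrite big_nil mulr1 -fmoneE.
rewrite big_cons -kcst_mulCA -IHs [RHS](monomialM (fmu v)) mul1r; congr monomial.
by rewrite [RHS]fmmulE fmuE.
Qed.

Lemma free_span (z : free_alg k X) :
  lspan (fun x => exists s : seq X, x = \prod_(v <- s) free_gen k v) z.
Proof.
have -> : z = \sum_(w <- finmap.enum_fset (msupp (z : malg _ _))) monomial w (mcoeff w z) by exact: monalgE.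
apply: (subspace_sum (lspan_subspace _)) => -[s] _.
rewrite monomialE; apply: (subspaceZ (lspan_subspace _)).
by apply: sub_lspan; exists s.
Qed.

End FreeSpan.

Section TensorQuotient.
Context {k : fieldType} {V : lmodType k} (I : ideal (tensor_alg V)).

Lemma ideal_gen_sub (A : pzAlgType k) (G : set A) x : G x -> ideal_gen G x.
Proof. by move=> Gx J [_]; apply. Qed.

Lemma tensor_in_linear c (x y : V) :
  tensor_in (c *: x + y) = c%:K * tensor_in x + tensor_in y.
Proof.
rewrite /tensor_in -pi_cst -pi_mul -quot_piD; apply/quot_piP.
by apply: ideal_gen_sub; exists c, x, y.
Qed.

Definition quot_in (x : V) : quot_alg I := quot_pi I (tensor_in x).

Lemma quot_in_linear c x y : quot_in (c *: x + y) = c%:K * quot_in x + quot_in y.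
Proof. by rewrite /quot_in tensor_in_linear quot_piD pi_mul. Qed.

Lemma quot_in_span (a : quot_alg I) :
  lspan (fun x => exists s : seq V, x = \prod_(v <- s) quot_in v) a.
Proof.
have tensor_span (b : tensor_alg V) :
    lspan (fun x => exists s : seq V, x = \prod_(v <- s) tensor_in v) b.
  rewrite -[b]quot_reprK; apply: (pi_lspan _ (free_span _)) => _ [s ->]; exists s.
  by rewrite rmorph_prod.
rewrite -[a]quot_reprK; apply: (pi_lspan _ (tensor_span _)) => _ [s ->]; exists s.
by rewrite rmorph_prod.
Qed.

End TensorQuotient.

(** * Twisted current algebras *)

Section TwistedCurrent.
Context (k : closedFieldType) (char0 : [pchar k] =i pred0) (g : finDimLieType k).
Context (sigma : lie_aut g) (r : nat) (eta : k).
Hypothesis sigma_r : iter r sigma =1 id.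
Hypothesis eta_prim : r.-primitive_root eta.
Local Notation L := (twisted_current sigma eta).
Local Notation proj := (proj sigma r eta).
Local Notation homog := (homog sigma eta).

Definition current_coef (x : g) (n : nat) : nat -> g := fun i => if i == n then proj n x else 0.

Lemma current_subproof x n : current_coef x n \in twisted_pred sigma eta.
Proof.
apply/asboolP; split.
  by exists n.+1 => i ni; rewrite /current_coef gtn_eqF.
move=> i; rewrite /current_coef; case: eqP => [->|_]; last by rewrite linear0 scaler0.
exact: proj_homog.
Qed.

(** x t^n when x lies in the eigenspace of eta^n; other x are first projected,
    which makes the family linear in x over the whole of g. *)
Definition current (x : g) (n : nat) : L := TwistedCurrent (current_subproof x n).

Lemma tc_ext (u v : L) : (forall n, u n = v n) -> u = v.
Proof. by move=> uv; apply/val_inj/funext. Qed.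

Lemma current_linear n c x y : current (c *: x + y) n = c *: current x n + current y n.
Proof.
apply: tc_ext => i; change (current_coef (c *: x + y) n i =
  c *: current_coef x n i + current_coef y n i).
rewrite /current_coef; case: eqP => _; last by rewrite scaler0 addr0.
exact: proj_linear.
Qed.

Lemma current_sum (u : L) : exists N, u = \sum_(n < N) current (u n) n.
Proof.
have := tc_coefP u; rewrite inE => -[[N uN] uh]; exists N.
have coef_sum (s : seq 'I_N) i : (\sum_(n <- s) current (u n) n : L) i =
    \sum_(n <- s) current_coef (u n) n i.
  elim: s => [|n s IHs]; first by rewrite !big_nil.
  by rewrite !big_cons -IHs.
apply: tc_ext => i; rewrite coef_sum /current_coef.
have projE : proj i (u i) = u i by rewrite (proj_of_homog char0 eta_prim _ (uh i)) eqxx.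
have [iN|Ni] := ltnP i N.
  rewrite (bigD1 (Ordinal iN)) //= eqxx projE big1 ?addr0 // => n ni.
  by case: eqP => // E; case/eqP: ni; exact/val_inj.
rewrite uN // big1 // => n _; case: eqP => // E.
by move: (ltn_ord n); rewrite -E ltnNge Ni.
Qed.

Lemma lie_current x a y b :
  lie (current x a) (current y b) = current (lie (proj a x) (proj b y)) (a + b).
Proof.
apply: tc_ext => n; change (tc_bracket_coef (current_coef x a) (current_coef y b) n =
  current_coef (lie (proj a x) (proj b y)) (a + b) n).
rewrite /tc_bracket_coef [RHS]/current_coef.
have projE : proj (a + b) (lie (proj a x) (proj b y)) = lie (proj a x) (proj b y).
  have hom := homog_lie (proj_homog sigma_r eta_prim a x) (proj_homog sigma_r eta_prim b y).
  by rewrite (proj_of_homog char0 eta_prim _ hom) eqxx.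
rewrite projE; have [->|nab] := eqVneq n (a + b)%N.
  have aab : (a < (a + b).+1)%N by rewrite ltnS leq_addr.
  rewrite (bigD1 (Ordinal aab)) //= /current_coef addKn !eqxx big1 ?addr0 // => i ia.
  by case: eqP => [E|_]; rewrite ?lie0l //; case/eqP: ia; exact/val_inj.
rewrite big1 // => i _; rewrite /current_coef; case: eqP => [E|_]; last by rewrite lie0l.
case: eqP => [F|_]; last by rewrite raddf0.
by case/eqP: nab; rewrite -F -E subnKC // -ltnS.
Qed.

Lemma lie_current_homog x a y b : homog a x ->
  lie (current x a) (current y b) = current (lie x y) (a + b).
Proof.
move=> ax; rewrite lie_current; apply: tc_ext => n.
change (current_coef (lie (proj a x) (proj b y)) (a + b) n = current_coef (lie x y) (a + b) n).
rewrite /current_coef; case: eqP => // _.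
rewrite (proj_of_homog char0 eta_prim _ ax) eqxx -(proj_lie char0 sigma_r eta_prim _ _ ax).
have hom := proj_homog sigma_r eta_prim (a + b) (lie x y).
by rewrite (proj_of_homog char0 eta_prim _ hom) eqxx.
Qed.

Lemma current_eq0 x a n : homog a x -> n != a %[mod r] -> current x n = 0.
Proof.
move=> ax na; apply: tc_ext => i; change (current_coef x n i = 0).
rewrite /current_coef; case: eqP => // _.
by rewrite (proj_of_homog char0 eta_prim _ ax) eq_sym (negbTE na).
Qed.

(** The common features of U(L) and S(L) and of their stable ideals: letters commute
    up to letters, and L acts by derivations that extend its adjoint action. *)
Section Quotients.
Hypothesis g_simple : simple_lie g.
Context (B : pzAlgType k) (inB : L -> B).
Hypothesis inB_linear : forall (c : k) u v, inB (c *: u + v) = c%:K * inB u + inB v.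
Hypothesis inB_span : forall b,
  lspan (fun x => exists s : seq L, x = \prod_(u <- s) inB u) b.
Hypothesis inB_comm : forall u v : L,
  (inB u * inB v = inB v * inB u) \/ (inB u * inB v - inB v * inB u = inB (lie u v)).
Context (J : ideal B) (D : L -> B -> B).
Hypothesis D_linear : forall u (c : k) x y, D u (c%:K * x + y) = c%:K * D u x + D u y.
Hypothesis D_leibniz : forall u x y, D u (x * y) = D u x * y + x * D u y.
Hypothesis D_in : forall u v, D u (inB v) = inB (lie u v).
Hypothesis D_ideal : forall u x, J x -> J (D u x).

Let T (x : g) (n : nat) : B := inB (current x n).

Let T_linear n (c : k) x y : T (c *: x + y) n = c%:K * T x n + T y n.
Proof. by rewrite /T current_linear inB_linear. Qed.

Let inB0 : inB 0 = 0.
Proof.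
have := inB_linear (-1) 0 0.
by rewrite scaler0 addr0 rmorphN1 mulN1r addNr.
Qed.

Let T_comm x a y b : exists z, T x a * T y b - T y b * T x a = T z (a + b)%N.
Proof.
have [eq|eq] := inB_comm (current x a) (current y b).
  by exists 0; rewrite (T0 T_linear) /T eq subrr.
by exists (lie (proj a x) (proj b y)); rewrite /T eq lie_current.
Qed.

Lemma words_span m (e : m.-tuple g) : basis_of fullv e -> forall b : B,
  lspan (fun x => exists s, x = word e T s) b.
Proof.
move=> e_basis b; pose W := lspan (fun x => exists s, x = word e T s).
have sW : subspace W := lspan_subspace _.
have WM x y : W x -> W y -> W (x * y).
  apply: (lspanM sW) => _ _ [s ->] [t ->]; rewrite -wordcat.
  by apply: sub_lspan; exists (s ++ t).
apply: (lspan_min sW) (inB_span b) => _ [s ->].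
elim: s => [|u s IHs]; first by rewrite big_nil; apply: sub_lspan; exists [::]; rewrite /word big_nil.
rewrite big_cons; apply: WM => //.
have [N ->] := current_sum u; have inD v w : inB (v + w) = inB v + inB w.
  by have := inB_linear 1 v w; rewrite scale1r kcst1 mul1r.
rewrite (big_morph _ inD inB0); apply: (subspace_sum sW) => n _.
rewrite -/(T _ _) (T_coord e_basis T_linear); apply: (subspace_sum sW) => i _.
apply: (subspaceZ sW); apply: sub_lspan; exists [:: (i, val n)].
by rewrite /word big_seq1.
Qed.

Lemma current_adm m (e : m.-tuple g) (deg : 'I_m -> nat) :
  (forall i, homog (deg i) e`_i) ->
  forall (i : 'I_m) n, n != deg i %[mod r] -> T e`_i n = 0.
Proof. by move=> e_homog i n ni; rewrite /T (current_eq0 (e_homog i) ni) inB0. Qed.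

Lemma current_expansion m (e : m.-tuple g) (deg : 'I_m -> nat) :
  basis_of fullv e -> (forall i, homog (deg i) e`_i) ->
  forall x : B, exists (ms : seq (seq ('I_m * nat))) (c : seq ('I_m * nat) -> k),
  [/\ uniq ms, forall s, s \in ms -> c s != 0,
      forall s v, s \in ms -> v \in s -> v.2 = deg v.1 %[mod r],
      {in ms &, forall s s', perm_eq s s' -> s = s'} &
      x = \sum_(s <- ms) (c s)%:K * \prod_(v <- s) inB (current e`_v.1 v.2)].
Proof.
move=> e_basis e_homog x.
exact: (sorted_expansion e_basis T_linear T_comm (current_adm e_homog) (words_span e_basis) x).
Qed.

(** The derivations D u pass to the quotient by J, where an expansion of a nonzero
    element of J becomes the relation that [growth_of_relation] asks for. *)
Lemma growth_of_quotient : nonzero_ideal J ->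
  exists E, forall V : set (quot_alg J), fin_dim V ->
    \forall n \near \oo%classic, (sdim (expS V n) <= n ^ E)%N.
Proof.
move=> [x0 Jx0 x00].
have [m [e [deg [e_basis e_homog deg_lt]]]] := homog_basis char0 sigma_r eta_prim.
have r_gt0 := prim_order_gt0 eta_prim.
have [M munits] := matrix_unit_op_span g_simple eta_prim e_basis e_homog deg_lt.
have [ms [c [ums c0 adm ms_inj xE]]] := current_expansion e_basis e_homog x0.
pose TJ x n := quot_pi J (T x n).
have word_pi s : word e TJ s = quot_pi J (word e T s) by rewrite /word rmorph_prod.
have pi_repr b : J (quot_repr (quot_pi J b) - b) by exact: quot_repr_pi.
have pi_surj (b : quot_alg J) : exists b' : B, quot_pi J b' = b.
  by exists (quot_repr b); exact: quot_reprK.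
pose DJ u (b : quot_alg J) := quot_pi J (D u (quot_repr b)).
have DB u x y : D u (x - y) = D u x - D u y.
  have := D_linear u (-1) y x; rewrite !rmorphN1 !mulN1r => DE.
  by rewrite addrC DE addrC.
have DJE u b : DJ u (quot_pi J b) = quot_pi J (D u b).
  by apply/quot_piP; rewrite -DB; exact/D_ideal/pi_repr.
have DJ_linear u (d : k) x y : DJ u (d%:K * x + y) = d%:K * DJ u x + DJ u y.
  have [[x' <-] [y' <-]] := (pi_surj x, pi_surj y).
  transitivity (DJ u (quot_pi J (d%:K * x' + y'))).
    by congr (DJ u _); rewrite quot_piD pi_mul.
  by rewrite !DJE D_linear quot_piD pi_mul.
have DJ_leibniz u x y : DJ u (x * y) = DJ u x * y + x * DJ u y.
  have [[x' <-] [y' <-]] := (pi_surj x, pi_surj y).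
  transitivity (DJ u (quot_pi J (x' * y'))); first by rewrite pi_mul.
  by rewrite !DJE D_leibniz quot_piD !pi_mul.
have TJ_linear n (d : k) x y : TJ (d *: x + y) n = d%:K * TJ x n + TJ y n.
  by rewrite /TJ T_linear quot_piD pi_mul.
have TJ_comm x a y b : exists z, TJ x a * TJ y b - TJ y b * TJ x a = TJ z (a + b)%N.
  have [z zE] := T_comm x a y b; exists z.
  by rewrite /TJ -zE pi_sub !pi_mul.
have DJ_T i a : a = deg i %[mod r] -> forall y b,
    DJ (current e`_i a) (TJ y b) = TJ (lie e`_i y) (a + b).
  move=> ai y b; rewrite /TJ DJE /T D_in lie_current_homog //.
  by apply: (homog_mod eta_prim (esym ai)); exact: e_homog.
have TJ_adm (i : 'I_m) n : n != deg i %[mod r] -> TJ e`_i n = 0.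
  by move=> ni; rewrite /TJ (current_adm e_homog) // raddf0.
apply: (@growth_of_relation _ _ _ _ _ e_basis _ TJ_linear TJ_comm r deg
  (fun i a => DJ (current e`_i a)) _ _ DJ_T M r_gt0 char0 TJ_adm munits _ ms c) => //.
- move=> b; rewrite -[b]quot_reprK; apply: (pi_lspan _ (words_span e_basis _)) => _ [s ->].
  by exists s; rewrite word_pi.
- by apply: contra_neq x00 => ms0; rewrite xE ms0 big_nil.
transitivity (quot_pi J x0); last exact/pi_eq0.
by rewrite xE raddf_sum; apply: eq_bigr => s _; rewrite /= pi_mul word_pi.
Qed.

End Quotients.
End TwistedCurrent.

(** * Functionals on words and the relations of U(L) and S(L) *)

Section TensorAction.
Context (k : fieldType) (L : lieType k) (P : nat).
Implicit Types (G : ('I_P -> L) -> k) (v : 'I_P -> L) (u : L).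

Definition update v (p : 'I_P) (x : L) : 'I_P -> L := fun q => if q == p then x else v q.

Definition multilinear G := forall v p (c : k) x y,
  G (update v p (c *: x + y)) = c * G (update v p x) + G (update v p y).

(** The contragredient of the diagonal action of L on its P-th tensor power. *)
Definition act u G : ('I_P -> L) -> k := fun v => - \sum_p G (update v p (lie u (v p))).

Definition act_word (w : seq L) G := foldr act G w.

Lemma update_update v p x y : update (update v p x) p y = update v p y.
Proof. by apply/funext => q; rewrite /update; case: eqP. Qed.

Lemma update_at v p x : update v p x p = x.
Proof. by rewrite /update eqxx. Qed.

Lemma update_other v p q x : q != p -> update v p x q = v q.
Proof. by rewrite /update => /negbTE ->. Qed.

Lemma updateC v p q x y : p != q -> update (update v p x) q y = update (update v q y) p x.
Proof.
move=> pq; apply/funext => l; rewrite /update.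
by case: eqP => // ->; rewrite eq_sym (negbTE pq).
Qed.

Lemma act_multilinear u G : multilinear G -> multilinear (act u G).
Proof.
move=> mG v p c x y; rewrite /act mulrN -opprD; congr (- _).
rewrite mulr_sumr -big_split; apply: eq_bigr => q _ /=.
have [->|qp] := eqVneq q p; first by rewrite !update_at !update_update lieDZr mG.
by rewrite !update_other // !(updateC _ _ _ (_ : p != q)) 1?eq_sym // mG.
Qed.

Lemma act_word_multilinear w G : multilinear G -> multilinear (act_word w G).
Proof. by move=> mG; elim: w => //= u w; exact: act_multilinear. Qed.

Lemma act_linear u c G G' v :
  act u (fun v => c * G v + G' v) v = c * act u G v + act u G' v.
Proof. by rewrite /act big_split /= -mulr_sumr opprD mulrN. Qed.

Lemma act_word_linear w c G G' v :
  act_word w (fun v => c * G v + G' v) v = c * act_word w G v + act_word w G' v.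
Proof.
elim: w v => //= u w IHw v; rewrite -act_linear; congr act.
by apply/funext.
Qed.

Lemma act_linear_letter (c : k) u u' G v : multilinear G ->
  act (c *: u + u') G v = c * act u G v + act u' G v.
Proof.
move=> mG; rewrite /act mulrN -opprD; congr (- _).
by rewrite mulr_sumr -big_split; apply: eq_bigr => p _; rewrite lieDZl mG.
Qed.

(** The terms in which u and u' act on different tensor factors are symmetric in u
    and u'; those on the same factor give the bracket, by the Jacobi identity. *)
Lemma act_lie u u' G v : multilinear G ->
  act u (act u' G) v = act u' (act u G) v + act (lie u u') G v.
Proof.
move=> mG.
have actE a b : act a (act b G) v = \sum_p G (update v p (lie b (lie a (v p)))) +
    \sum_p \sum_(q | q != p) G (update (update v p (lie a (v p))) q (lie b (v q))).
  rewrite /act sumrN opprK -big_split; apply: eq_bigr => p _ /=.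
  rewrite (bigD1 p) //= update_at update_update; congr (_ + _).
  by apply: eq_bigr => q qp; rewrite update_other.
rewrite !actE addrAC; congr (_ + _); last first.
  rewrite (exchange_big_dep predT) //=; apply: eq_bigr => p _.
  rewrite (eq_bigl (fun q => q != p)) => [|q]; last by rewrite eq_sym.
  by apply: eq_bigr => q qp; rewrite updateC.
rewrite /act -sumrB; apply: eq_bigr => p _.
have -> : lie u' (lie u (v p)) = (-1) *: lie (lie u u') (v p) + lie u (lie u' (v p)).
  have := lie_jacobi u u' (v p); rewrite [lie (v p) u]lieC [lie (v p) _]lieC linearN /=.
  by rewrite scaleN1r addrAC => /eqP; rewrite subr_eq0 => /eqP <-; rewrite addrC.
by rewrite mG mulN1r addrC.
Qed.

Lemma act_word_cat s t G v : act_word (s ++ t) G v = act_word s (act_word t G) v.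
Proof. by rewrite /act_word foldr_cat. Qed.

Lemma act_word_letter s t (c : k) x y G v : multilinear G ->
  act_word (s ++ (c *: x + y) :: t) G v =
  c * act_word (s ++ x :: t) G v + act_word (s ++ y :: t) G v.
Proof.
move=> mG; rewrite !act_word_cat /= -act_word_linear; congr (act_word s _ v).
by apply/funext => v'; exact/act_linear_letter/act_word_multilinear.
Qed.

Lemma act_word_lie s t x y G v : multilinear G ->
  act_word (s ++ x :: y :: t) G v =
  act_word (s ++ y :: x :: t) G v + act_word (s ++ lie x y :: t) G v.
Proof.
move=> mG; rewrite !act_word_cat /= -[act_word s _ v in RHS]mul1r -act_word_linear.
congr (act_word s _ v); apply/funext => v'; rewrite mul1r.
exact/act_lie/act_word_multilinear.
Qed.

End TensorAction.

Lemma ideal_gen_min (k : fieldType) (A : pzAlgType k) (G I : set A) :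
  two_sided_ideal I -> (forall x, G x -> I x) -> forall x, ideal_gen G x -> I x.
Proof. by move=> tI GI x Gx; apply: Gx; split. Qed.

(** To show that an ideal of a quotient lies in N it is enough to lift generators. *)
Lemma ideal_gen_pi (k : fieldType) (A : pzAlgType k) (I : ideal A) (N : set A)
    (G : set (quot_alg I)) :
  two_sided_ideal N -> (forall x, I x -> N x) ->
  (forall y, G y -> exists2 z, N z & quot_pi I z = y) ->
  forall z, ideal_gen G (quot_pi I z) -> N z.
Proof.
move=> tN IN GN z; pose N' (y : quot_alg I) := exists2 z, N z & quot_pi I z = y.
have [N0 NB Nl Nr] := tN.
have tN' : two_sided_ideal N'.
  split=> [|_ _ [x Nx <-] [y Ny <-]|a _ [x Nx <-]|a _ [x Nx <-]].
  - by exists 0; rewrite ?raddf0.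
  - by exists (x - y); [exact: NB|rewrite pi_sub].
  - by exists (quot_repr a * x); [exact: Nl|rewrite pi_mul quot_reprK].
  - by exists (x * quot_repr a); [exact: Nr|rewrite pi_mul quot_reprK].
move=> /(ideal_gen_min tN' GN)[z' Nz'] /quot_piP /IN Nz.
by rewrite -[z](subKr z'); exact: NB.
Qed.

(** To prove that words are independent modulo the relations of U(L) or S(L) it is
    enough to give functionals on words that respect these relations: the elements
    killed by all of them in every context form an ideal of the free algebra. *)
Section WordFunctionals.
Context (k : fieldType) (L : lmodType k) (E : set (seq L -> k)).
Hypothesis E_linear : forall f, E f -> forall s t (c : k) x y,
  f (s ++ (c *: x + y) :: t) = c * f (s ++ x :: t) + f (s ++ y :: t).

(** The free algebra enters only through its basis of words and the linear
    functionals with prescribed values on it. *)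
Section FreeAlgebraBasis.
Context (A : pzAlgType k) (mono : seq L -> A) (ev : (seq L -> k) -> A -> k).
Hypothesis monoM : forall s t, mono s * mono t = mono (s ++ t).
Hypothesis mono_span : forall z, lspan (fun x => exists s, x = mono s) z.
Hypothesis ev_linear : forall f c x y, ev f (c%:K * x + y) = c * ev f x + ev f y.
Hypothesis ev_mono : forall f s, ev f (mono s) = f s.

Lemma ev0 f : ev f 0 = 0.
Proof.
have := ev_linear f (-1) 0 0.
by rewrite mulr0 addr0 mulN1r addNr.
Qed.

Definition annihilated (z : A) := forall a b f, E f -> ev f (a * z * b) = 0.

Lemma annihilated_ideal : two_sided_ideal (annihilated : set A).
Proof.
split=> [a b f Ef|x y x0 y0 a b f Ef|c x x0 a b f Ef|c x x0 a b f Ef].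
- by rewrite mulr0 mul0r ev0.
- have -> : a * (x - y) * b = (-1)%:K * (a * y * b) + a * x * b.
    by rewrite mulrBr mulrBl rmorphN1 mulN1r addrC.
  by rewrite ev_linear (x0 _ _ _ Ef) (y0 _ _ _ Ef) mulr0 addr0.
- by rewrite mulrA; exact: x0.
- by rewrite mulrA -mulrA; exact: x0.
Qed.

Lemma annihilated_words (z : A) :
  (forall s t f, E f -> ev f (mono s * z * mono t) = 0) -> annihilated z.
Proof.
move=> z0 a b f Ef.
have sub0 : subspace (fun x => ev f x = 0).
  split=> [|c x y x0 y0]; first exact: ev0.
  by rewrite ev_linear x0 y0 mulr0 addr0.
apply: (lspan_min (subspace_mulr z (subspace_mulr b sub0))) (mono_span a) => _ [s ->].
apply: (lspan_min (subspace_mull (mono s * z) sub0)) (mono_span b) => _ [t ->].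
exact: z0.
Qed.

Lemma annihilated_linear (c : k) x y :
  annihilated (mono [:: c *: x + y] - (c%:K * mono [:: x] + mono [:: y])).
Proof.
apply: annihilated_words => s t f Ef.
have -> : mono s * (mono [:: c *: x + y] - (c%:K * mono [:: x] + mono [:: y])) * mono t =
    (- 1)%:K * (c%:K * mono (s ++ x :: t) + mono (s ++ y :: t)) + mono (s ++ (c *: x + y) :: t).
  rewrite mulrBr mulrBl mulrDr mulrDl -!mulrA !kcst_mulCA !monoM /=.
  by rewrite rmorphN1 mulN1r addrC.
by rewrite !ev_linear !ev_mono E_linear // mulN1r addNr.
Qed.

Lemma annihilated_lie x y z :
  (forall f, E f -> forall s t, f (s ++ x :: y :: t) = f (s ++ y :: x :: t) + f (s ++ z :: t)) ->
  annihilated (mono [:: x] * mono [:: y] - mono [:: y] * mono [:: x] - mono [:: z]).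
Proof.
move=> E_lie; apply: annihilated_words => s t f Ef.
have -> : mono s * (mono [:: x] * mono [:: y] - mono [:: y] * mono [:: x] -
      mono [:: z]) * mono t =
    (- 1)%:K * (1%:K * mono (s ++ y :: x :: t) + mono (s ++ z :: t)) +
    mono (s ++ x :: y :: t).
  rewrite !mulrBr !mulrBl !monoM -!catA /= kcst1 mul1r.
  by rewrite rmorphN1 mulN1r [RHS]addrC opprD addrA.
by rewrite !ev_linear !ev_mono E_lie // mulN1r mul1r addNr.
Qed.

Lemma annihilated_commutator x y :
  (forall f, E f -> forall s t, f (s ++ x :: y :: t) = f (s ++ y :: x :: t)) ->
  annihilated (mono [:: x] * mono [:: y] - mono [:: y] * mono [:: x]).
Proof.
move=> E_comm; apply: annihilated_words => s t f Ef.
have -> : mono s * (mono [:: x] * mono [:: y] - mono [:: y] * mono [:: x]) * mono t =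
    (- 1)%:K * mono (s ++ y :: x :: t) + mono (s ++ x :: y :: t).
  rewrite !mulrBr !mulrBl !monoM -!catA /=.
  by rewrite rmorphN1 mulN1r addrC.
by rewrite !ev_linear !ev_mono E_comm // mulN1r addNr.
Qed.

End FreeAlgebraBasis.

Let mono (s : seq L) : free_alg k L := monomial (FMonom s) 1.

Let ev (f : seq L -> k) (z : free_alg k L) : k :=
  mmap idfun (fun w : fmonom L => f w) (z : malg (fmonom L) k).

Let monoM s t : mono s * mono t = mono (s ++ t).
Proof. by rewrite /mono monomialM mulr1; congr monomial; exact: fmmulE. Qed.

Let monoE s : mono s = \prod_(v <- s) free_gen k v.
Proof. by rewrite /mono monomialE kcst1 mul1r. Qed.

Let mono_gen x : mono [:: x] = free_gen k x.
Proof. by rewrite monoE big_seq1. Qed.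

Let mono_span z : lspan (fun x => exists s, x = mono s) z.
Proof.
by apply: lspan_sub (free_span z) => _ [s ->]; exists s; rewrite monoE.
Qed.

Let ev_mono f s : ev f (mono s) = f s.
Proof. by rewrite /ev /mono /monomial mmapU mul1r. Qed.

Let ev_linear f c x y : ev f (c%:K * x + y) = c * ev f x + ev f y.
Proof.
have evD u v : ev f (u + v) = ev f u + ev f v by exact: (raddfD (mmap idfun _)).
have ev0 : ev f 0 = 0 by exact: (raddf0 (mmap idfun _)).
rewrite evD; congr (_ + _).
have xE : x = \sum_(w <- finmap.enum_fset (msupp (x : malg _ _))) monomial w (mcoeff w x).
  exact: monalgE.
rewrite xE mulr_sumr !(big_morph _ evD ev0) mulr_sumr; apply: eq_bigr => w _.
move: (mcoeff w x) => a; case: w => s.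
have evm b : ev f (monomial (FMonom s) b) = b * f s by exact: mmapU.
have -> : c%:K * monomial (FMonom s) a = monomial (FMonom s) (c * a).
  by rewrite (monomialE s a) (monomialE s (c * a)) rmorphM mulrA.
by rewrite (evm a) (evm (c * a)) mulrA.
Qed.

Lemma word_relation_eval (G : set (tensor_alg L)) :
  (forall y, G y -> exists2 z, annihilated ev z & quot_pi _ z = y) ->
  forall I (ms : seq I) (c : I -> k) (w : I -> seq L),
  \sum_(i <- ms) (c i)%:K * \prod_(u <- w i) quot_in (ideal_gen G) u = 0 ->
  forall f, E f -> \sum_(i <- ms) c i * f (w i) = 0.
Proof.
move=> G_ann I ms c w rel f Ef; pose z := \sum_(i <- ms) (c i)%:K * mono (w i).
have tN := annihilated_ideal ev_linear.
suff : annihilated ev z.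
  move=> /(_ 1 1 f Ef); rewrite mul1r mulr1 => zE; rewrite -[RHS]zE.
  rewrite /z; elim: ms {rel z zE} => [|s ms IHms].
    by rewrite !big_nil; exact/esym/(ev0 ev_linear).
  by rewrite !big_cons IHms ev_linear ev_mono.
apply: (ideal_gen_pi (I := ideal_gen (tensor_rel (V := L))) tN _ G_ann).
- apply: ideal_gen_min tN _ => _ [d [x [y ->]]].
  have := annihilated_linear monoM mono_span ev_linear ev_mono d x y.
  by rewrite (mono_gen x) (mono_gen y) (mono_gen (d *: x + y)).
apply/pi_eq0; rewrite -[RHS]rel /z pi_lincomb pi_lincomb; apply: eq_bigr => s _.
by rewrite monoE pi_prod pi_prod.
Qed.

Lemma word_relation_eval_sym :
  (forall f, E f -> forall s t x y, f (s ++ x :: y :: t) = f (s ++ y :: x :: t)) ->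
  forall I (ms : seq I) (c : I -> k) (w : I -> seq L),
  \sum_(i <- ms) (c i)%:K * \prod_(u <- w i) quot_in (ideal_gen (@sym_rel _ L)) u = 0 ->
  forall f, E f -> \sum_(i <- ms) c i * f (w i) = 0.
Proof.
move=> E_comm; apply: word_relation_eval => _ [x [y ->]].
exists (free_gen k x * free_gen k y - free_gen k y * free_gen k x).
  have := @annihilated_commutator _ _ _ monoM mono_span ev_linear ev_mono x y.
  rewrite (mono_gen x) (mono_gen y); apply => f Ef s t; exact: E_comm.
exact: pi_commutator2.
Qed.

Lemma word_relation_eval_lie (brk : L -> L -> L) (G : set (tensor_alg L)) :
  (forall f, E f -> forall s t x y,
     f (s ++ x :: y :: t) = f (s ++ y :: x :: t) + f (s ++ brk x y :: t)) ->
  (forall z, G z -> exists x y,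
     z = tensor_in x * tensor_in y - tensor_in y * tensor_in x - tensor_in (brk x y)) ->
  forall I (ms : seq I) (c : I -> k) (w : I -> seq L),
  \sum_(i <- ms) (c i)%:K * \prod_(u <- w i) quot_in (ideal_gen G) u = 0 ->
  forall f, E f -> \sum_(i <- ms) c i * f (w i) = 0.
Proof.
move=> E_lie GE; apply: word_relation_eval => _ /GE[x [y ->]].
exists (free_gen k x * free_gen k y - free_gen k y * free_gen k x - free_gen k (brk x y)).
  have := @annihilated_lie _ _ _ monoM mono_span ev_linear ev_mono x y (brk x y).
  rewrite (mono_gen x) (mono_gen y) (mono_gen (brk x y)); apply => f Ef s t; exact: E_lie.
exact: pi_commutator.
Qed.

End WordFunctionals.

Lemma env_relation_eval (k : fieldType) (L : lieType k) P I (ms : seq I) (c : I -> k)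
    (w : I -> seq L) :
  \sum_(i <- ms) (c i)%:K * \prod_(u <- w i) quot_in (ideal_gen (@env_rel _ L)) u = 0 ->
  forall G (v : 'I_P -> L), multilinear G -> \sum_(i <- ms) c i * act_word (w i) G v = 0.
Proof.
move=> rel G v mG.
pose E := [set f : seq L -> k | exists2 H : ('I_P -> L) -> k, multilinear H &
  f = fun w => act_word w H v]%classic.
refine (@word_relation_eval_lie _ _ E _ lie _ _ _ I ms c w rel (fun u => act_word u G v) _);
  last by exists G.
- by move=> _ [H mH ->] s t d x y; exact: act_word_letter.
- by move=> _ [H mH ->] s t x y; exact: act_word_lie.
- by [].
Qed.

(** A linear map lam from L to polynomials extends to S(L); the functionals on words
    are the coefficients of the resulting product. *)
Lemma sym_relation_eval (k : fieldType) (L : lmodType k) (lam : L -> {poly k}) :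
  (forall (c : k) x y, lam (c *: x + y) = c *: lam x + lam y) ->
  forall I (ms : seq I) (c : I -> k) (w : I -> seq L),
  \sum_(i <- ms) (c i)%:K * \prod_(u <- w i) quot_in (ideal_gen (@sym_rel _ L)) u = 0 ->
  \sum_(i <- ms) c i *: \prod_(u <- w i) lam u = 0.
Proof.
move=> lam_linear I ms c w rel; apply/polyP => j; rewrite coef0 coef_sum.
pose E := [set f : seq L -> k | exists j, f = fun w => (\prod_(u <- w) lam u)`_j]%classic.
under eq_bigr do rewrite coefZ.
refine (@word_relation_eval_sym _ _ E _ _ I ms c w rel (fun u => (\prod_(v <- u) lam v)`_j) _);
  last by exists j.
- move=> _ [i ->] s t d x y; rewrite !big_cat !big_cons /= lam_linear.
  by rewrite mulrDl mulrDr -scalerAl -scalerAr coefD coefZ.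
- by move=> _ [i ->] s t x y; rewrite !big_cat !big_cons /= [lam x * _]mulrCA.
Qed.

(** * Separating monomials of U(L) by functionals on tensor powers *)

Section WordCount.
Context (k : fieldType) (char0 : [pchar k] =i pred0) (L : lieType k).
Context (h : nat -> L) (y0 : L) (F : nat -> L -> k).
Hypothesis F_linear : forall n c x y, F n (c *: x + y) = c * F n x + F n y.
Hypothesis F0 : forall n, F n y0 = 0.
Hypothesis F1 : forall n b, F n (lie (h b) y0) = (b == n)%:R.

Section Target.
Context (P : nat) (cs : P.-tuple nat).
Implicit Types (zs : seq (nat * 'I_P)) (v : 'I_P -> L).

Definition target (v : 'I_P -> L) : k := \prod_p F (tnth cs p) (v p).

Lemma target_multilinear : multilinear target.
Proof.
move=> v p c x y; rewrite /target !(bigD1 p (P := predT)) //= !update_at F_linear.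
have same z : \prod_(i | i != p) F (tnth cs i) (update v p z i) =
    \prod_(i | i != p) F (tnth cs i) (v i).
  by apply: eq_bigr => i ip; rewrite update_other.
by rewrite !same mulrDl mulrA.
Qed.

(** When the letters z.1 act on the tensor factors z.2, in the order of zs, the factor
    p receives the letters [hits zs p]. *)
Definition hits zs (p : 'I_P) : seq nat := [seq z.1 | z <- zs & z.2 == p].

Definition strike zs v : 'I_P -> L :=
  foldl (fun v z => update v z.2 (lie (h z.1) (v z.2))) v zs.

Lemma strikeE zs v p : strike zs v p = foldl (fun y b => lie (h b) y) (v p) (hits zs p).
Proof.
rewrite /strike /hits; elim: zs v => //= z zs IHzs v; rewrite IHzs.
by have [<-|zp] := eqVneq z.2 p; rewrite /= ?update_at // update_other // eq_sym.
Qed.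

Lemma act_word_sum bs (G : ('I_P -> L) -> k) v :
  act_word (map h bs) G v =
  (-1) ^+ size bs * \sum_(t : (size bs).-tuple 'I_P) G (strike (zip bs t) v).
Proof.
elim: bs v => [|b bs IHbs] v /=.
  rewrite mul1r (big_pred1 [tuple]) // => t; rewrite [t]tuple0; exact/esym/eqP.
rewrite /act exprS mulN1r mulNr; congr (- _).
rewrite (reindex (fun p : 'I_P * (size bs).-tuple 'I_P => cons_tuple p.1 p.2)) /=; last first.
  exists (fun t => (thead t, [tuple of behead t])) => [[i t] _|t _] /=.
    by congr (_, _); apply: val_inj.
  by rewrite [RHS]tuple_eta; exact: val_inj.
rewrite -(pair_bigA _ (fun i (t : (size bs).-tuple 'I_P) => G (strike (zip (b :: bs) (i :: t)) v))).
by rewrite mulr_sumr; apply: eq_bigr => p _; rewrite IHbs.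
Qed.

Lemma size_hits zs : (\sum_p size (hits zs p))%N = size zs.
Proof.
elim: zs => [|z zs IHzs]; first by rewrite big1.
rewrite /= -IHzs -add1n -[1%N](sum_indicator xpredT z.2) -big_split /=.
by apply: eq_bigr => p _; rewrite /hits /= eq_sym; case: eqP.
Qed.

(** Each factor y0 must be hit at least once in order not to be killed; with at most P
    letters, it is hit exactly once, and by the letter that its form expects. *)
Lemma target_strike zs : (size zs <= P)%N ->
  target (strike zs (fun=> y0)) = [forall p, hits zs p == [:: tnth cs p]]%:R.
Proof.
move=> szP; rewrite /target; under eq_bigr do rewrite strikeE.
have [/forallP nz|] := boolP [forall p, hits zs p != [::]]; last first.
  rewrite negb_forall => /existsP[p]; rewrite negbK => /eqP hp.
  rewrite (bigD1 p) //= hp /= F0 mul0r [X in nat_of_bool X](_ : _ = false) //.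
  by apply/negP => /forallP/(_ p); rewrite hp.
have size1 p : size (hits zs p) = 1%N.
  have ge1 q : (1 <= size (hits zs q))%N by rewrite lt0n size_eq0.
  apply/eqP; rewrite eqn_leq ge1 andbT leqNgt; apply/negP => gt1.
  have : (P < \sum_p size (hits zs p))%N.
    rewrite (bigD1 p) //=.
    have {1}-> : P = (1 + \sum_(q | q != p) 1)%N.
      by rewrite -[in LHS](card_ord P) -sum1_card (bigD1 p).
    by rewrite -addSn leq_add // leq_sum.
  by rewrite size_hits ltnNge szP.
have [/forallP eqc|] := boolP [forall p, hits zs p == [:: tnth cs p]].
  by rewrite big1 // => p _; rewrite (eqP (eqc p)) /= F1 eqxx.
rewrite negb_forall => /existsP[p np]; rewrite (bigD1 p) //=.
move: np (size1 p); case: (hits zs p) => [|b [|? ?]] //= np _.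
rewrite F1; case: eqP => [bp|_]; last by rewrite mul0r.
by rewrite bp eqxx in np.
Qed.

Lemma hits_perm zs : (forall p, hits zs p = [:: tnth cs p]) -> perm_eq (unzip1 zs) cs.
Proof.
move=> eqc; apply/permP => a.
have -> : count a cs = (\sum_p count a (hits zs p))%N.
  rewrite -sum1_count big_mkcond big_tuple; apply: eq_bigr => p _.
  by rewrite eqc /= addn0; case: (a _).
elim: zs {eqc} => [|z zs IHzs]; first by rewrite big1.
have az : a z.1 = (\sum_p a z.1 * (p == z.2))%N :> nat.
  by rewrite -big_distrr /= sum_indicator muln1.
rewrite /= IHzs az -big_split; apply: eq_bigr => p _ /=.
by rewrite /hits /= eq_sym; case: eqP => _; rewrite /= ?muln1 ?muln0.
Qed.

Lemma act_word_target bs : (size bs <= P)%N -> ~~ perm_eq bs cs ->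
  act_word (map h bs) target (fun=> y0) = 0.
Proof.
move=> sP nperm; rewrite act_word_sum big1 ?mulr0 // => t _.
have szip : size (zip bs t) = size bs by rewrite size1_zip // size_tuple.
rewrite target_strike ?szip //; case: (boolP [forall p, hits (zip bs t) p == [:: tnth cs p]]) => // /forallP eqc.
case/negP: nperm; rewrite -[bs](@unzip1_zip _ _ bs t) ?size_tuple //.
by apply: hits_perm => p; exact/eqP.
Qed.

(** All contributing distributions enter with the same sign, and there is at least
    one; characteristic 0 prevents the sum from vanishing. *)
Lemma act_word_target_self : act_word (map h cs) target (fun=> y0) != 0.
Proof.
rewrite act_word_sum mulf_neq0 ?signr_eq0 //.
have sP : size cs = P by rewrite size_tuple.
pose N := (\sum_(t : (size cs).-tuple 'I_P) [forall p, hits (zip cs t) p == [:: tnth cs p]])%N.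
have -> : \sum_(t : (size cs).-tuple 'I_P) target (strike (zip cs t) (fun=> y0)) = N%:R.
  rewrite natr_sum; apply: eq_bigr => t _; rewrite target_strike //.
  by rewrite size1_zip ?sP // (size_tuple t).
rewrite ((pcharf0P k).1 char0) /N.
have st : size (enum 'I_P) == size cs by rewrite size_enum_ord sP.
rewrite (bigD1 (Tuple st)) //= addn_eq0 negb_and.
suff -> : [forall p, hits (zip cs (enum 'I_P)) p == [:: tnth cs p]] by [].
apply/forallP => p; apply/eqP; rewrite /hits -{1}(map_tnth_enum cs).
have -> : zip [seq tnth cs i | i <- enum 'I_P] (enum 'I_P) = [seq (tnth cs i, i) | i <- enum 'I_P].
  by elim: (enum 'I_P) => //= i s ->.
rewrite filter_map -map_comp (eq_filter (a2 := pred1 p)) //.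
by rewrite filter_pred1_uniq ?enum_uniq ?mem_enum.
Qed.

End Target.
End WordCount.

(** * Growth from independent monomials *)

Section LowerBound.
Context {k : fieldType} {B : pzAlgType k}.

Fixpoint power_gens (s : seq B) n : seq B :=
  if n is n'.+1 then [seq x * y | x <- s, y <- power_gens s n'] else [:: 1].

Lemma expS_gens (s : seq B) n : expS (lspan [set` s]) n = lspan [set` power_gens s n].
Proof.
elim: n => [|n IHn] /=.
  by apply/seteqP; split=> x; apply: lspan_sub => y; rewrite /= inE => /eqP.
rewrite IHn; apply/seteqP; split=> x.
  apply: lspan_min; first exact: lspan_subspace.
  move=> _ [y ys] [z zs] <-.
  apply: (lspanM (lspan_subspace _)) ys zs => {}y {}z ys zs.
  by apply: sub_lspan; apply/allpairsP; exists (y, z).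
apply: lspan_min; first exact: lspan_subspace.
move=> _ /allpairsP[[y z] /= [ys zs ->]].
by apply: sub_lspan; exists y; [exact: sub_lspan|exists z => //; exact: sub_lspan].
Qed.

Lemma prod_power_gens (s t : seq B) n : 1 \in s -> {subset t <= s} -> (size t <= n)%N ->
  \prod_(x <- t) x \in power_gens s n.
Proof.
move=> s1; elim: n t => [|n IHn] [|x t] //= ts sz; first by rewrite big_nil mem_seq1.
  by apply/allpairsP; exists (1, \prod_(x <- [::] : seq B) x); rewrite /= mul1r; split=> //; exact: IHn.
apply/allpairsP; exists (x, \prod_(x <- t) x) => /=; rewrite big_cons.
split=> //; first by apply: ts; rewrite mem_head.
by apply: IHn => // y yt; apply: ts; rewrite in_cons yt orbT.
Qed.

Lemma lin_indep_enum (I : finType) (f : I -> B) :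
  (forall c : I -> k, \sum_(a <- enum I) (c a)%:K * f a = 0 -> forall a, c a = 0) ->
  lin_indep [tuple f (enum_val i) | i < #|I|].
Proof.
move=> indep c sum0 i; rewrite -[i]enum_valK; apply: (indep (c \o enum_rank)).
rewrite -[RHS]sum0 big_enum (reindex (fun j : 'I_#|I| => enum_val j)) /=; last first.
  by apply: onW_bij; exact: enum_val_bij.
by apply: eq_bigr => j _; rewrite tnth_mktuple enum_valK.
Qed.

(** The monomials in f 0, ..., f (d-1) with exponents below q are products of at most
    d q elements of the space V spanned by 1 and these generators. *)
Lemma power_growth (f : nat -> B) :
  (forall (I : finType) (bs : I -> seq nat) (c : I -> k),
    (forall i j, perm_eq (bs i) (bs j) -> i = j) ->
    \sum_(i <- enum I) (c i)%:K * \prod_(b <- bs i) f b = 0 -> forall i, c i = 0) ->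
  forall d q n, (d * q <= n)%N ->
    (q ^ d <= sdim (expS (lspan [set` 1%R :: [seq f b | b <- iota 0 d]]) n))%N.
Proof.
move=> indep d q n dqn.
pose bs (a : {ffun 'I_d -> 'I_q}) : seq nat := flatten [seq nseq (a b) (val b) | b <- enum 'I_d].
have count_bs a (b : 'I_d) : count_mem (val b) (bs a) = a b.
  rewrite count_flatten -map_comp sumnE big_map big_enum (bigD1 b) //= count_nseq /= eqxx mul1n.
  by rewrite big1 ?addn0 // => i ib /=; rewrite count_nseq /= val_eqE (negbTE ib).
have bs_inj a a' : perm_eq (bs a) (bs a') -> a = a'.
  move=> /permP aa'; apply/ffunP => b; apply: val_inj.
  by rewrite /= -!count_bs; exact: aa'.
have size_bs a : (size (bs a) <= d * q)%N.
  rewrite size_flatten /shape -map_comp sumnE big_map big_enum.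
  rewrite -[X in (X * _)%N]card_ord -sum_nat_const leq_sum // => b _.
  by rewrite /= size_nseq ltnW.
have := lin_indep_enum (indep _ bs ^~ bs_inj); set b := mktuple _ => b_indep.
rewrite -{1}(card_ord q) -{1}(card_ord d) -card_ffun.
apply: (sdim_ge (expS_gens _ _) b_indep) => i; rewrite tnth_mktuple expS_gens.
apply: sub_lspan; rewrite /= -(big_map f xpredT id) /=.
apply: prod_power_gens; first exact: mem_head; last by rewrite size_map (leq_trans (size_bs _)).
move=> x /mapP[j jb ->]; rewrite in_cons map_f ?orbT // mem_iota /=.
by case/flatten_mapP: jb => b' _ /nseqP[-> _]; rewrite add0n; exact: ltn_ord.
Qed.

End LowerBound.

(** * Eventual bounds on dimensions and growth *)

Section GrowthRate.
Context {R : realType}.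
Local Open Scope ereal_scope.

Let rate (N n : nat) : \bar R := lne (N%:R)%:E * ((ln n%:R)^-1)%:E.

Let ln_nat_gt0 n : (1 < n)%N -> (0 < ln (n%:R : R))%R.
Proof. by move=> n1; rewrite ln_gt0 // ltr1n. Qed.

Lemma rate_le N n E : (1 < n)%N -> (N <= n ^ E)%N -> rate N n <= (E%:R)%:E.
Proof.
move=> n1 NE; have ln0 := ln_nat_gt0 n1; have n0 := ltnW n1; rewrite /rate; case: N NE => [|N] NE.
  by rewrite le0_lneNy // gt0_mulNye ?leNye // lte_fin invr_gt0.
rewrite lne_EFin ?ltr0n // -EFinM lee_fin ler_pdivrMr // mulr_natl -lnXn ?ltr0n //.
by rewrite ler_ln ?posrE ?exprn_gt0 ?ltr0n // -natrX ler_nat.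
Qed.

Lemma rate_ge N n E : (1 < n)%N -> (n ^ E <= N)%N -> (E%:R)%:E <= rate N n.
Proof.
move=> n1 EN; have ln0 := ln_nat_gt0 n1; have n0 := ltnW n1; rewrite /rate.
have N0 : (0 < N)%N by rewrite (leq_trans _ EN) // expn_gt0 n0.
rewrite lne_EFin ?ltr0n // -EFinM lee_fin ler_pdivlMr // mulr_natl -lnXn ?ltr0n //.
by rewrite ler_ln ?posrE ?exprn_gt0 ?ltr0n // -natrX ler_nat.
Qed.

Lemma limn_esup_le (u : (\bar R)^nat) l : (\forall n \near \oo%classic, u n <= l) ->
  limn_esup u <= l.
Proof.
move=> ul; apply: (@le_trans _ _ (ereal_sup (u @` [set n | u n <= l])%classic)).
  by apply: ereal_inf_lbound; exists [set n | u n <= l]%classic.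
by apply: ge_ereal_sup => _ [n /= ? <-].
Qed.

Lemma limn_esup_ge (u : (\bar R)^nat) l : (\forall n \near \oo%classic, l <= u n) ->
  l <= limn_esup u.
Proof.
move=> ul; apply: le_ereal_inf_tmp => _ [A Aoo <-].
have [n [An ln]] : exists n, A n /\ l <= u n.
  by apply: (@filter_ex _ \oo%classic _); near do split.
by apply: le_trans ln (ereal_sup_ubound _); exists n.
Unshelve. all: by end_near. Qed.

Context {k : fieldType} {A : pzAlgType k}.

Lemma GKdim_fin E : (forall V : set A, fin_dim V ->
    \forall n \near \oo%classic, (sdim (expS V n) <= n ^ E)%N) ->
  GKdim R A < +oo.
Proof.
move=> growth; apply: (@le_lt_trans _ _ (E%:R)%:E); last exact: ltry.
apply: ge_ereal_sup => _ [V fV <-]; apply: limn_esup_le.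
near=> n; apply: rate_le; first by near: n; exists 2%N.
by near: n; exact: growth.
Unshelve. all: by end_near. Qed.

Lemma GKdim_infty : (forall E, exists2 V : set A, fin_dim V &
    \forall n \near \oo%classic, (n ^ E <= sdim (expS V n))%N) ->
  GKdim R A = +oo.
Proof.
move=> growth; apply/eqyP => M M0; have [V fV V_growth] := growth (Num.bound M).
apply: (@le_trans _ _ ((Num.bound M)%:R)%:E).
  by rewrite lee_fin ltW // archi_boundP // ltW.
apply: le_trans (ereal_sup_ubound _); last by exists V.
apply: limn_esup_ge; near=> n; apply: rate_ge; first by near: n; exists 2%N.
by near: n; exact: V_growth.
Unshelve. all: by end_near. Qed.

Lemma polynomial_growth_fin E : (forall V : set A, fin_dim V ->
    \forall n \near \oo%classic, (sdim (expS V n) <= n ^ E)%N) ->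
  polynomial_growth R A.
Proof.
move=> growth; exists 'X^E => V fV; apply: filterS (growth V fV) => n nE.
by rewrite hornerXn -natrX ler_nat.
Qed.

End GrowthRate.

(** * U of a twisted current algebra has infinite Gelfand-Kirillov dimension *)

Section EnvGrowth.
Context (k : fieldType) (char0 : [pchar k] =i pred0) (L : lieType k).
Context (h : nat -> L) (y0 : L) (F : nat -> L -> k).
Hypothesis F_linear : forall n c x y, F n (c *: x + y) = c * F n x + F n y.
Hypothesis F0 : forall n, F n y0 = 0.
Hypothesis F1 : forall n b, F n (lie (h b) y0) = (b == n)%:R.

(** In a relation, a longest monomial with nonzero coefficient is detected by its own
    target form, which vanishes on all other monomials of at most that length. *)
Lemma words_indep (I : finType) (bs : I -> seq nat) (c : I -> k) :
  (forall i j, perm_eq (bs i) (bs j) -> i = j) ->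
  \sum_(i <- enum I) (c i)%:K * \prod_(b <- bs i) quot_in (ideal_gen (@env_rel _ L)) (h b) = 0 ->
  forall i, c i = 0.
Proof.
move=> bs_inj rel; have [/forallP c0 i|] := boolP [forall i, c i == 0]; first exact/eqP.
rewrite negb_forall => /existsP[i0 ci0].
have [j cj jmax] := @arg_maxnP I i0 (fun i => c i != 0) (size \o bs) ci0.
have rel' : \sum_(i <- enum I) (c i)%:K *
    \prod_(u <- map h (bs i)) quot_in (ideal_gen (@env_rel _ L)) u = 0.
  by under eq_bigr do rewrite big_map.
have := env_relation_eval rel' (fun=> y0) (target_multilinear F_linear (in_tuple (bs j))).
rewrite big_enum (bigD1 j) //= big1 => [|i ij].
  by move/eqP; rewrite addr0 mulf_eq0 (negbTE cj) (negbTE (act_word_target_self char0 F0 F1 _)).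
have [->|ci] := eqVneq (c i) 0; first by rewrite mul0r.
rewrite (act_word_target F0 F1) ?mulr0 //; first exact: jmax.
by apply: contra_neqN ij => /bs_inj.
Qed.

End EnvGrowth.

Section Loops.
Context (k : closedFieldType) (char0 : [pchar k] =i pred0) (g : finDimLieType k).
Hypothesis g_simple : simple_lie g.
Context (sigma : lie_aut g) (r : nat) (eta : k).
Hypothesis sigma_r : iter r sigma =1 id.
Hypothesis eta_prim : r.-primitive_root eta.
Local Notation L := (twisted_current sigma eta).
Local Notation homog := (homog sigma eta).

(** If no basis vectors e_i, e_j gave a bracket with a component outside e_j, then
    skew-symmetry would make all brackets of basis vectors vanish. *)
Lemma homog_separated_pair : exists a b (x y : g) (xi : g -> k),
  [/\ homog a x, homog b y, (forall c u v, xi (c *: u + v) = c * xi u + xi v), xi y = 0 &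
      xi (lie x y) = 1].
Proof.
have [m [e [deg [e_basis e_homog _]]]] := homog_basis char0 sigma_r eta_prim.
have [/existsP[i /existsP[j /existsP[p /andP[pj nz]]]]|] :=
    boolP [exists i : 'I_m, exists j : 'I_m, exists p, (p != j) && (coord e p (lie e`_i e`_j) != 0)].
  exists (deg i), (deg j), e`_i, e`_j, (fun u => coord e p u / coord e p (lie e`_i e`_j)).
  split=> [||c u v||]; [exact: e_homog|exact: e_homog|..].
  - by rewrite linearP mulrDl mulrA.
  - by rewrite coord_free ?(basis_free e_basis) // eq_sym (negbTE pj) mul0r.
  - by rewrite divff.
move=> /existsPn none; have coord0 (i j p : 'I_m) : p != j -> coord e p (lie e`_i e`_j) = 0.
  have /existsPn/(_ j)/existsPn/(_ p) := none i.
  by rewrite negb_and => /orP[/negPn/eqP-> /eqP|/negPn/eqP].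
have lie0 (i j : 'I_m) : lie e`_i e`_j = 0.
  rewrite (coord_basis e_basis (memvf (lie e`_i e`_j))) big1 // => p _.
  have [->|/coord0->] := eqVneq p j; last by rewrite scale0r.
  have [->|ij] := eqVneq i j; first by rewrite liexx linear0 scale0r.
  by rewrite lieC linearN /= coord0 ?oppr0 ?scale0r // eq_sym.
case: g_simple => -[x [y /negP nz]] _; case: nz; apply/eqP.
rewrite (coord_basis e_basis (memvf x)) lie_suml big1 // => i _.
rewrite (coord_basis e_basis (memvf y)) linear_sum big1 // => j _.
by rewrite linearZ /= lieZl lie0 !scaler0.
Qed.

(** Take h_n = x t^(a + r n) and y0 = y t^b: the brackets with y0 are [x, y] times
    distinct powers of t. *)
Lemma loop_family : exists (h : nat -> L) (y0 : L) (F : nat -> L -> k),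
  [/\ (forall n c u v, F n (c *: u + v) = c * F n u + F n v), (forall n, F n y0 = 0) &
      (forall n b, F n (lie (h b) y0) = (b == n)%:R)].
Proof.
have [a [b [x [y [xi [ax by_ xi_linear xiy xixy]]]]]] := homog_separated_pair.
have xi0 : xi 0 = 0 by have := xi_linear (-1) 0 0; rewrite scaler0 addr0 mulN1r addNr.
exists (fun n => current sigma_r eta_prim x (a + r * n)), (current sigma_r eta_prim y b).
exists (fun n (u : L) => xi (u (a + r * n + b)%N)).
split=> [n c u v|n|n n'].
- exact: xi_linear.
- change (xi (current_coef sigma r eta y b (a + r * n + b)) = 0).
  rewrite /current_coef; case: eqP => // _.
  by rewrite (proj_of_homog char0 eta_prim _ by_) eqxx.
have ax' : homog (a + r * n') x by apply: (homog_mod eta_prim) ax; rewrite addnC mulnC modnMDl.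
rewrite lie_current_homog //.
change (xi (current_coef sigma r eta (lie x y) (a + r * n' + b) (a + r * n + b)) = (n' == n)%:R).
rewrite /current_coef eqn_add2r eqn_add2l eqn_pmul2l ?(prim_order_gt0 eta_prim) // eq_sym.
case: eqP => // _; rewrite (proj_of_homog char0 eta_prim _ (homog_lie ax' by_)).
by rewrite eqxx.
Qed.

End Loops.

(** With d = e + 1 generators and exponents below n / d one gets (n / d)^d monomials;
    the extra factor n pays for the constant (2 d)^d. *)
Lemma expn_le_div_expn e n : ((e.+1.*2) ^ e.+1 <= n)%N -> (n ^ e <= (n %/ e.+1) ^ e.+1)%N.
Proof.
set d := e.+1 => nd; have d0 : (0 < d.*2 ^ d)%N by rewrite expn_gt0 double_gt0.
have dn : (d <= n)%N.
  apply: leq_trans nd; rewrite -[X in (X <= _)%N]expn1 (@leq_trans (d.*2 ^ 1)%N) ?leq_pexp2l //.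
  by rewrite !expn1 -addnn leq_addr.
have halfn : (n <= d.*2 * (n %/ d))%N.
  have q0 : (0 < n %/ d)%N by rewrite divn_gt0.
  by have := divn_eq n d; have := @ltn_pmod n d isT; nia.
rewrite -(leq_pmul2l d0) -expnMn (@leq_trans (n * n ^ e)%N) ?leq_mul2r ?nd ?orbT //.
by rewrite -expnS leq_exp2r.
Qed.

Section EnvInfinite.
Context (R : realType) (k : closedFieldType) (char0 : [pchar k] =i pred0) (g : finDimLieType k).
Hypothesis g_simple : simple_lie g.
Context (sigma : lie_aut g) (r : nat) (eta : k).
Hypothesis sigma_r : iter r sigma =1 id.
Hypothesis eta_prim : r.-primitive_root eta.

Lemma GKdim_env_infty : GKdim R (env_alg (twisted_current sigma eta)) = +oo%E.
Proof.
have [h [y0 [F [F_linear F0 F1]]]] := loop_family char0 g_simple sigma_r eta_prim.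
apply: GKdim_infty => e.
have grow := power_growth (words_indep char0 F_linear F0 F1).
exists (lspan [set` 1 :: [seq quot_in (ideal_gen (@env_rel _ (twisted_current sigma eta))) (h b)
  | b <- iota 0 e.+1]]); first by eexists.
near=> n; apply: leq_trans (grow e.+1 (n %/ e.+1)%N n _); last by rewrite mulnC leq_divM.
by apply: expn_le_div_expn; near: n; exists (e.+1.*2 ^ e.+1)%N.
Unshelve. all: by end_near. Qed.

End EnvInfinite.

(** * S of a twisted current algebra is a commutative domain *)

(** Uniqueness of digits in base M, in terms of multisets: the largest exponent in one
    multiset outweighs any collection of fewer than M smaller ones. *)
Lemma power_sum_perm M (s s' : seq nat) : (size s < M)%N -> (size s' < M)%N ->
  (\sum_(a <- s) M ^ a = \sum_(a <- s') M ^ a)%N -> perm_eq s s'.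
Proof.
have dominated (a : nat) (t : seq nat) : (size t < M)%N -> (forall b, b \in t -> (b < a)%N) ->
    (\sum_(b <- t) M ^ b < M ^ a)%N.
  move=> tM ta; have M0 : (0 < M)%N by case: (M) tM.
  rewrite -(ltn_pmul2l M0) big_distrr /= (@leq_ltn_trans (size t * M ^ a)) ?ltn_pmul2r ?expn_gt0 ?M0 //.
  rewrite -sum1_size big_distrl /= big_seq [X in (_ <= X)%N]big_seq leq_sum // => b bt.
  by rewrite mul1n -expnS leq_pexp2l // ta.
have top (a : nat) (t t' : seq nat) : (size t' < M)%N -> a \in t -> {in t', forall b, (b <= a)%N} ->
    (\sum_(b <- t) M ^ b = \sum_(b <- t') M ^ b)%N -> a \in t'.
  move=> t'M at_ t'a E; apply/negPn/negP => at'.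
  have : (\sum_(b <- t') M ^ b < M ^ a)%N.
    by apply: dominated => // b bt'; rewrite ltn_neqAle t'a // andbT; apply: contraNneq at' => <-.
  by rewrite -E (perm_big _ (perm_to_rem at_)) big_cons ltnNge leq_addr.
elim: {s}(size s) {-2}s (erefl (size s)) s' => [|n IHn] s sz s' sM s'M E.
  rewrite (size0nil sz) big_nil in E *; case: s' {s'M} E => // a s'.
  move=> /esym /eqP; rewrite big_cons addn_eq0 expn_eq0.
  by case: (M) sM => //.
pose a := \max_(b <- s ++ s') b.
have amax b : b \in s ++ s' -> (b <= a)%N by move=> bs; exact: leq_bigmax_seq.
have : a \in s ++ s'.
  have : s ++ s' != [::] by case: (s) sz.
  rewrite /a; elim: (s ++ s') => // b t IHt _; rewrite big_cons.
  have [->|t0] := eqVneq t [::]; first by rewrite big_nil maxn0 mem_head.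
  by rewrite /maxn in_cons; case: ltnP => _; rewrite ?eqxx ?IHt ?orbT.
have sa : {in s, forall b, (b <= a)%N} by move=> b bs; rewrite amax // mem_cat bs.
have s'a : {in s', forall b, (b <= a)%N} by move=> b bs; rewrite amax // mem_cat bs orbT.
move=> a_mem; have [as_ as'] : a \in s /\ a \in s'.
  move: a_mem; rewrite mem_cat => /orP[am|am]; split=> //; first exact: (top a s).
  by apply: (top a s') => //; exact/esym.
rewrite (perm_trans (perm_to_rem as_)) // perm_sym (perm_trans (perm_to_rem as')) // perm_cons perm_sym.
apply: IHn; rewrite ?size_rem ?sz //; [by rewrite ltnW // -sz|by rewrite (leq_ltn_trans (leq_pred _))|].
apply/eqP; rewrite -(eqn_add2l (M ^ a)); apply/eqP.
by have := E; rewrite (perm_big _ (perm_to_rem as_)) (perm_big _ (perm_to_rem as')) !big_cons.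
Qed.

Lemma mul_lincomb_words (k : fieldType) (B : pzAlgType k) (U V : Type) (inB : U -> B)
    (f : V -> U) (ms ms' : seq (seq V)) (c c' : seq V -> k) :
  (\sum_(s <- ms) (c s)%:K * \prod_(v <- s) inB (f v)) *
  (\sum_(s <- ms') (c' s)%:K * \prod_(v <- s) inB (f v)) =
  \sum_(s <- ms) \sum_(s' <- ms')
    (c s * c' s')%:K * \prod_(u <- map f s ++ map f s') inB u.
Proof.
rewrite mulr_suml; apply: eq_bigr => s _; rewrite mulr_sumr; apply: eq_bigr => s' _.
by rewrite big_cat !big_map rmorphM -!mulrA [in LHS]kcst_mulCA.
Qed.

Lemma commutative_of_words (k : fieldType) (B : pzAlgType k) (U : Type) (inB : U -> B) :
  (forall u v, inB u * inB v = inB v * inB u) ->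
  (forall b, lspan (fun x => exists s : seq U, x = \prod_(u <- s) inB u) b) ->
  forall x y : B, x * y = y * x.
Proof.
move=> inB_comm inB_span x y.
have sub (z : B) : subspace (fun t => t * z = z * t).
  split=> [|c t u tz uz]; first by rewrite mul0r mulr0.
  by rewrite mulrDl mulrDr uz kcst_mulCA -mulrA tz.
have sub' (z : B) : subspace (fun t => z * t = t * z).
  by split=> [|c t u tz uz]; rewrite ?mul0r ?mulr0 // mulrDl mulrDr uz kcst_mulCA -mulrA tz.
have word_comm (z : B) (s : seq U) : (forall u, inB u * z = z * inB u) ->
    (\prod_(u <- s) inB u) * z = z * \prod_(u <- s) inB u.
  move=> uz; elim: s => [|u s IHs]; first by rewrite !big_nil mul1r mulr1.
  by rewrite !big_cons -mulrA IHs mulrA uz mulrA.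
apply: (lspan_min (sub y)) (inB_span x) => _ [s ->].
apply: (word_comm y s) => u; apply: (lspan_min (sub' (inB u))) (inB_span y) => _ [t ->].
apply: esym; apply: word_comm => v; exact: inB_comm.
Qed.

Section SymmetricDomain.
Context (k : closedFieldType) (char0 : [pchar k] =i pred0) (g : finDimLieType k).
Context (sigma : lie_aut g) (r : nat) (eta : k).
Hypothesis sigma_r : iter r sigma =1 id.
Hypothesis eta_prim : r.-primitive_root eta.
Local Notation L := (twisted_current sigma eta).
Local Notation inS := (quot_in (ideal_gen (@sym_rel _ L))).

Lemma inS_comm u v : inS u * inS v = inS v * inS u.
Proof.
suff : inS u * inS v - inS v * inS u = 0 by move/eqP; rewrite subr_eq0 => /eqP.
rewrite -pi_commutator2; apply/pi_eq0; apply: ideal_gen_sub; by exists u, v.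
Qed.

Section Kronecker.
Context (m : nat) (e : m.-tuple g) (deg : 'I_m -> nat).
Hypothesis e_basis : basis_of fullv e.
Hypothesis e_homog : forall i, homog sigma eta (deg i) e`_i.
Local Notation letter := ('I_m * nat)%type.
Implicit Types (v : letter) (s : seq letter).

Definition letter_index v : nat := (v.2 * m + v.1)%N.

Lemma letter_index_inj : injective letter_index.
Proof.
move=> [i n] [j n'] /eqP; rewrite /letter_index /=.
have m0 : (0 < m)%N by exact: leq_ltn_trans (ltn_ord i).
move/eqP => E; have En := congr1 (divn^~ m) E; have Ei := congr1 (modn^~ m) E.
rewrite /= !divnMDl // !divn_small // !addn0 in En.
rewrite /= !modnMDl !modn_small // in Ei.
by rewrite En (val_inj Ei).
Qed.

(** The Kronecker substitution of one variable for many: monomials with fewer than M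
    factors go to distinct powers, since their exponents in base M record the
    multiplicities of the letters. *)
Definition kronecker M N (u : L) : {poly k} :=
  \sum_(n < N) \sum_(i < m) coord e i (u n) *: 'X^(M ^ letter_index (i, val n)).

Lemma kronecker_linear M N (c : k) (x y : L) :
  kronecker M N (c *: x + y) = c *: kronecker M N x + kronecker M N y.
Proof.
rewrite scaler_sumr -big_split; apply: eq_bigr => n _.
rewrite scaler_sumr -big_split; apply: eq_bigr => i _.
change (coord e i (c *: x n + y n) *: 'X^(M ^ letter_index (i, val n)) =
  c *: (coord e i (x n) *: 'X^(M ^ letter_index (i, val n))) +
  coord e i (y n) *: 'X^(M ^ letter_index (i, val n))).
by rewrite linearP scalerDl scalerA.
Qed.

Lemma kronecker_letter M N v : (v.2 < N)%N -> v.2 = deg v.1 %[mod r] ->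
  kronecker M N (current sigma_r eta_prim e`_v.1 v.2) = 'X^(M ^ letter_index v).
Proof.
case: v => i n /= nN adm.
have coefE n' : current_coef sigma r eta e`_i n n' = if n' == n then e`_i else 0.
  rewrite /current_coef; case: eqP => // _.
  by rewrite (proj_of_homog char0 eta_prim _ (e_homog i)) adm eqxx.
rewrite /kronecker (bigD1 (Ordinal nN)) //= [X in _ + X]big1 ?addr0 => [|n' n'n]; last first.
  rewrite big1 // => j _; rewrite coefE ifN ?linear0 ?scale0r //; exact: n'n.
rewrite (bigD1 i) //= coefE eqxx coord_free ?(basis_free e_basis) // eqxx scale1r.
rewrite big1 ?addr0 // => j ji.
by rewrite coord_free ?(basis_free e_basis) // eq_sym (negbTE ji) scale0r.
Qed.

Lemma kronecker_word M N s : (forall v, v \in s -> (v.2 < N)%N /\ v.2 = deg v.1 %[mod r]) ->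
  \prod_(v <- s) kronecker M N (current sigma_r eta_prim e`_v.1 v.2) =
  'X^(\sum_(v <- s) M ^ letter_index v).
Proof.
elim: s => [|v s IHs] sN; first by rewrite !big_nil.
have [vN v_adm] := sN v (mem_head _ _).
rewrite !big_cons exprD kronecker_letter // IHs // => w ws.
by apply: sN; rewrite in_cons ws orbT.
Qed.

Lemma kronecker_neq0 M (ms : seq (seq letter)) (c : seq letter -> k) : ms != [::] ->
  uniq ms -> (forall s, s \in ms -> c s != 0) ->
  {in ms &, forall s s', perm_eq s s' -> s = s'} ->
  (forall s, s \in ms -> (size s < M)%N) ->
  \sum_(s <- ms) c s *: 'X^(\sum_(v <- s) M ^ letter_index v) != 0 :> {poly k}.
Proof.
case: ms => // s0 ms _ ums c0 ms_inj msM.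
apply/eqP => /(congr1 (fun p : {poly k} => p`_(\sum_(v <- s0) M ^ letter_index v))).
move/eqP; rewrite coef0 coef_sum big_cons coefZ coefXn eqxx mulr1 big_seq big1 ?addr0.
  by rewrite (negbTE (c0 _ (mem_head _ _))).
move=> s sms; rewrite coefZ coefXn; case: eqP => [E|_]; last by rewrite mulr0.
have sms' : s \in s0 :: ms by rewrite in_cons sms orbT.
have perm : perm_eq (map letter_index s) (map letter_index s0).
  apply: (@power_sum_perm M); rewrite ?size_map ?msM ?mem_head //.
  by rewrite !big_map.
have ss0 := ms_inj _ _ sms' (mem_head _ _) (perm_map_inj letter_index_inj perm).
by move: ums sms; rewrite ss0 /= => /andP[/negbTE->].
Qed.

End Kronecker.

(** A single Kronecker substitution, with M and N large enough for both factors, sends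
    nonzero elements to nonzero polynomials. *)
Lemma sym_domain (x y : sym_alg L) : x * y = 0 -> x = 0 \/ y = 0.
Proof.
have [m [e [deg [e_basis e_homog _]]]] := homog_basis char0 sigma_r eta_prim.
have S_comm u v : inS u * inS v = inS v * inS u \/ inS u * inS v - inS v * inS u = inS (lie u v).
  by left; exact: inS_comm.
have expand := @current_expansion _ char0 _ _ _ _ sigma_r eta_prim (sym_alg L) inS
  (@quot_in_linear _ _ _) (@quot_in_span _ _ _) S_comm m e deg e_basis e_homog.
have [ms [c [ums c0 adm ms_inj ->]]] := expand x.
have [ms' [c' [ums' c'0 adm' ms'_inj ->]]] := expand y.
have [->|ms0] := eqVneq ms [::]; first by left; rewrite big_nil.
have [->|ms'0] := eqVneq ms' [::]; first by right; rewrite big_nil.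
move=> xy0; exfalso.
pose letters := flatten (ms ++ ms').
pose N := (\max_(v <- letters) v.2).+1; pose M := (\max_(s <- ms ++ ms') size s).+1.
have small s : s \in ms ++ ms' -> (size s < M)%N by move=> sms; rewrite ltnS leq_bigmax_seq.
have lettersN s v : s \in ms ++ ms' -> v \in s -> (v.2 < N)%N.
  move=> sms vs; rewrite ltnS (@leq_bigmax_seq _ letters _ (fun v => v.2) v) //.
  by apply/flattenP; exists s.
pose PK ms0 (c0 : seq ('I_m * nat) -> k) : {poly k} :=
  \sum_(s <- ms0) c0 s *: 'X^(\sum_(v <- s) M ^ letter_index v).
have : PK ms c * PK ms' c' != 0.
  by rewrite mulf_neq0 // kronecker_neq0 // => s sms; rewrite small // mem_cat sms ?orbT.
case/negP; apply/eqP.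
pose w s : seq L := [seq current sigma_r eta_prim e`_v.1 v.2 | v : 'I_m * nat <- s].
have wordE s : s \in ms ++ ms' -> \prod_(u <- w s) kronecker e M N u =
    'X^(\sum_(v <- s) M ^ letter_index v).
  move=> sms; rewrite big_map (kronecker_word e_basis e_homog) // => v vs.
  split; first exact: lettersN vs.
  by move: sms; rewrite mem_cat => /orP[|] sms; [exact: adm vs|exact: adm' vs].
have := @sym_relation_eval _ L (kronecker e M N) (kronecker_linear e M N) _
  [seq (s, s') | s <- ms, s' <- ms'] (fun p => c p.1 * c' p.2) (fun p => w p.1 ++ w p.2).
rewrite !big_allpairs /= => rel.
rewrite -[RHS]rel; last first.
  by rewrite -[RHS]xy0; exact/esym/mul_lincomb_words.
rewrite mulr_suml big_seq [RHS]big_seq; apply: eq_bigr => s sms.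
rewrite mulr_sumr big_seq [RHS]big_seq; apply: eq_bigr => s' sms'.
rewrite big_cat /= !wordE ?mem_cat ?sms ?sms' ?orbT //.
by rewrite -scalerAl -scalerAr scalerA.
Qed.

Lemma sym_comm (x y : sym_alg L) : x * y = y * x.
Proof. exact: (commutative_of_words inS_comm (@quot_in_span _ _ _)). Qed.

End SymmetricDomain.

(** * Skew-symmetry of Poisson brackets on a domain *)

(** The bracket is additive in its left argument only.  For a fixed x, the idea is to
    compare the maps a = { -, x + c } and b = { -, x } for a constant c.  The Jacobi
    identity at x, x^2 and (x + c)^2 makes the symmetric form a(z) a(y) - b(z) b(y)
    a derivation in y.  This forces a and b to be proportional unless
    b(x y) = x b(y) for all y, and { x y, x y } = 0 excludes the former. *)
Section PoissonDomain.
Context (S : comPzRingType) (pb : S -> S -> S).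
Hypothesis domS : forall x y : S, x * y = 0 -> x = 0 \/ y = 0.
Hypothesis two_regular : forall x : S, 2 * x = 0 -> x = 0.
Hypothesis pbD : forall x y z, pb (x + y) z = pb x z + pb y z.
Hypothesis pbxx : forall x, pb x x = 0.
Hypothesis jacobi : forall x y z, pb x (pb y z) + pb y (pb z x) + pb z (pb x y) = 0.
Hypothesis pbM : forall x y z, pb x (y * z) = pb x y * z + y * pb x z.

Let cancel2 (x y : S) : 2 * x = 2 * y -> x = y.
Proof.
move=> xy; apply/eqP; rewrite -subr_eq0; apply/eqP/two_regular.
by rewrite mulrBr xy subrr.
Qed.

Let eq_of_comb (u v s t : S) : s = t -> u - v = s - t -> u = v.
Proof. by move=> -> /eqP; rewrite subrr subr_eq0 => /eqP. Qed.

Let pb0l y : pb 0 y = 0.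
Proof. by apply: (@addrI _ (pb 0 y)); rewrite -pbD !addr0. Qed.

Let pb0r x : pb x 0 = 0.
Proof. by have := pbM x 0 0; rewrite !mulr0 mul0r addr0. Qed.

Let pb1r x : pb x 1 = 0.
Proof. by apply: (@addrI _ (pb x 1)); rewrite -[in RHS](mulr1 1) pbM mulr1 mul1r addr0. Qed.

Let pb2l x y : pb (2 * x) y = 2 * pb x y.
Proof. by rewrite mulr_natl mulr2n pbD mulr_natl mulr2n. Qed.

Let pb2r x : pb x 2 = 0.
Proof.
have := pbxx (2 * x); rewrite pb2l pbM pbxx mulr0 addr0 => /two_regular /domS[//|->].
exact: pb0l.
Qed.

(* By the Jacobi identity { 1, { y, - } } is additive; comparing its values at w^2 and
   (w + 1)^2 gives { 1, w + 1 } { y, w + 1 } = { 1, w } { y, w }.  At y = w = z - 1 the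
   right side vanishes and the left side is - { 1, z }^2. *)
Let pb_1l z : pb 1 z = 0.
Proof.
have phiE y w : pb 1 (pb y w) = - pb w (pb 1 y).
  by have := jacobi 1 y w; rewrite pb1r pb0r addr0 => /eqP; rewrite addr_eq0 => /eqP.
have phiD y w w' : pb 1 (pb y (w + w')) = pb 1 (pb y w) + pb 1 (pb y w').
  by rewrite !phiE pbD opprD.
have phi1 y : pb 1 (pb y 1) = 0 by rewrite pb1r pb0r.
have phi_sqr y w : pb 1 (pb y (w * w)) = 2 * (pb 1 w * pb y w + w * pb 1 (pb y w)).
  have -> : pb y (w * w) = 2 * (w * pb y w) by rewrite pbM; ring.
  by rewrite pbM pb2r mul0r add0r pbM.
have step y w : pb 1 (w + 1) * pb y (w + 1) = pb 1 w * pb y w.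
  apply: cancel2; have := phi_sqr y (w + 1); rewrite [X in X = _](_ : _ =
      pb 1 (pb y (w * w)) + 2 * pb 1 (pb y w)); last first.
    have -> : (w + 1) * (w + 1) = w * w + w + w + 1 by ring.
    by rewrite !phiD phi1; ring.
  rewrite phi_sqr phiD phi1 => E.
  by apply: (eq_of_comb (esym E)); ring.
have := step (z - 1) (z - 1); rewrite pbxx mulr0 subrK.
have -> : pb (z - 1) z = - pb 1 z.
  by apply/eqP; rewrite -addr_eq0 -pbD subrK pbxx.
by rewrite mulrN => /eqP; rewrite oppr_eq0 => /eqP /domS[].
Qed.

(** The shifts used below are by c = 1 and c = 2. *)
Section Shift.
Context (c : S) (c_l : forall y, pb c y = 0).
Hypothesis c_mul : forall x y, pb (c * x) y = c * pb x y.
Context (x : S).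

Let a y := pb y (x + c).
Let b y := pb y x.

Let shift y : pb (x + c) y = pb x y.
Proof. by rewrite pbD c_l addr0. Qed.

Let K z y := a z * a y - b z * b y.

Let pb_sqr_shift y : pb ((x + c) * (x + c)) y = pb (x * x) y + 2 * c * pb x y.
Proof.
have -> : (x + c) * (x + c) = x * x + c * x + c * x + c * c by ring.
by rewrite !pbD !c_mul c_l; ring.
Qed.

(* In { x, { y, z } } + { y, { z, x } } + { z, { x, y } } = 0 the first term is additive
   in x; so the second differences of the other two along x^2, (x + c)^2 balance. *)
Let K_jacobi z y :
  2 * K z y = pb z (pb (x * x) y) + 2 * c * pb z (pb x y) -
    pb z (pb (x * x) y + 2 * c * pb x y).
Proof.
have phi_shift : pb y (pb z (x + c)) = pb y (pb z x).
  have := jacobi (x + c) y z; rewrite !shift -(jacobi x y z).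
  by move=> /addIr /addrI.
have phi_sqr u : pb y (pb z (u * u)) = 2 * (pb y u * pb z u + u * pb y (pb z u)).
  have -> : pb z (u * u) = 2 * (u * pb z u) by rewrite pbM; ring.
  by rewrite pbM pb2r mul0r add0r pbM.
have E1 := jacobi ((x + c) * (x + c)) y z; rewrite phi_sqr phi_shift !pb_sqr_shift in E1.
have E2 := jacobi (x * x) y z; rewrite phi_sqr in E2.
have E3 := congr1 ( *%R (2 * c)) (jacobi x y z).
apply: (eq_of_comb (congr2 (fun u v => u - v) (congr2 (fun u v => u - v) E1 E2) E3)).
rewrite /K /a /b; ring.
Qed.

Let K_sqr z y : K z (y * y) = 2 * (y * K z y).
Proof.
apply: cancel2; rewrite [RHS](_ : _ = 2 * y * (2 * K z y)); last by ring.
rewrite !K_jacobi.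
have sqr u : pb u (y * y) = 2 * (y * pb u y) by rewrite pbM; ring.
have pbz2 w : pb z (2 * (y * w)) = 2 * (pb z y * w + y * pb z w).
  by rewrite pbM pb2r mul0r add0r pbM.
rewrite !sqr !pbz2.
have -> : 2 * (y * pb (x * x) y) + 2 * c * (2 * (y * pb x y)) =
    2 * (y * (pb (x * x) y + 2 * c * pb x y)) by ring.
by rewrite pbz2; ring.
Qed.

Let a_x : a x = 0.
Proof. by have := pbxx (x + c); rewrite shift. Qed.

Let K_mul z y : K z (x * y) = x * K z y.
Proof.
have KD u v : K z (u + v) = K z u + K z v by rewrite /K /a /b !pbD; ring.
have Kx : K z x = 0 by rewrite /K a_x /b pbxx; ring.
have := K_sqr z (x + y); rewrite [(x + y) * (x + y)](_ : _ = x * x + x * y + x * y + y * y); last by ring.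
rewrite !KD !K_sqr Kx => E; apply: cancel2; apply: (eq_of_comb E); ring.
Qed.

Let da y := a (x * y) - x * a y.
Let db y := b (x * y) - x * b y.

Let ab_defect z y : a z * da y = b z * db y.
Proof.
have := K_mul z y; rewrite /K => E; apply: (eq_of_comb E); rewrite /da /db; ring.
Qed.

Let product_defect y : x * (x + c) * (a y - b y) = (x + c) * db y - x * da y.
Proof.
have [->|] := eqVneq y 0; first by rewrite /da /db /a /b !mulr0 !pb0l; ring.
move=> y0; have E1 := pbxx (x * y); rewrite pbM in E1.
have E2 := pbxx ((x + c) * y); rewrite pbM [(x + c) * y]mulrDl !pbD !c_mul in E2.
rewrite !pbxx in E2.
suff : y * (x * (x + c) * (a y - b y) - ((x + c) * db y - x * da y)) = 0.
  by case/domS => [/eqP|/eqP]; rewrite ?(negbTE y0) // subr_eq0 => /eqP.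
apply: (eq_of_comb (congr2 (fun u v => u - v) (congr1 ( *%R x) E2) (congr1 ( *%R (x + c)) E1))).
rewrite /da /db /a /b; ring.
Qed.

(** The first alternative says that b is a derivation on x y.  Otherwise b is a multiple
    of a, the factor is 1 or -1, and only -1 survives [product_defect]. *)
Lemma shift_defect y : (forall u, c * u = 0 -> u = 0) ->
  pb (x * y) x = x * pb y x \/
  2 * x * (x + c) * pb y x + (2 * x + c) * (pb (x * y) x - x * pb y x) = 0.
Proof.
move=> c_reg; rewrite -/(b _) -/(b y) -/(db y).
have [D0|D0] := eqVneq (db y) 0; first by left; apply: (eq_of_comb D0); rewrite /db; ring.
right; have cancelD u v : u * db y = v * db y -> u = v.
  move=> /eqP; rewrite -subr_eq0 -mulrBl => /eqP /domS[/eqP|/eqP]; rewrite ?(negbTE D0) //.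
  by rewrite subr_eq0 => /eqP.
have DD : db y * db y = da y * da y.
  have E1 := ab_defect (x * y) y; have E2 := congr1 ( *%R x) (ab_defect y y).
  by apply: (eq_of_comb (congr2 (fun u v => v - u) E1 E2)); rewrite /db /da; ring.
have /domS[E|E] : (da y - db y) * (da y + db y) = 0.
- by apply: (eq_of_comb (esym DD)); ring.
- have ab z : a z = b z.
    apply: cancelD; rewrite -ab_defect; apply: (eq_of_comb (congr1 (fun u => - (a z * u)) E)).
    ring.
  have /c_reg /eqP : c * db y = 0; last by rewrite (negbTE D0).
  have P := product_defect y; rewrite ab in P.
  apply: (eq_of_comb (congr2 (fun u v => - u + x * v) P E)); ring.
have ab z : - a z = b z.
  apply: cancelD; rewrite -ab_defect; apply: (eq_of_comb (congr1 (fun u => - (a z * u)) E)).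
  ring.
have P := product_defect y; rewrite -(opprK (a y)) ab in P.
apply: (eq_of_comb (congr2 (fun u v => - u + x * v) P E)); ring.
Qed.

End Shift.

(** The second alternative of [shift_defect], at c = 1 and at c = 2, is a pair of
    linear equations for { y, x } and the defect, of determinant - 2 x^2. *)
Lemma pb_mul_self x y : pb (x * y) x = x * pb y x.
Proof.
have [->|x0] := eqVneq x 0; first by rewrite !mul0r pb0l.
have l1 u : pb (1 * u) =1 (fun v => 1 * pb u v) by move=> v; rewrite !mul1r.
have pb_2l v : pb 2 v = 0 by rewrite pbD pb_1l addr0.
have [//|E1] := @shift_defect 1 pb_1l l1 x y (fun u => @etrans _ _ _ _ (esym (mul1r u))).
have [//|E2] := @shift_defect 2 pb_2l pb2l x y two_regular.
have /two_regular/domS[/eqP|/domS[/eqP|b0]] : 2 * (x * (x * pb y x)) = 0; rewrite ?(negbTE x0) //.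
  apply: (eq_of_comb (congr2 (fun u v => - (2 * x + 2) * u + (2 * x + 1) * v) E1 E2)); ring.
rewrite b0 !mulr0 !add0r subr0 in E1 E2 *.
apply: (eq_of_comb (congr2 (fun u v => v - u) E1 E2)); ring.
Qed.

(** Expand { x y, x y } = 0 and cancel x y. *)
Lemma poisson_antisymmetric x y : pb x y = - pb y x.
Proof.
have [->|x0] := eqVneq x 0; first by rewrite pb0l pb0r oppr0.
have [->|y0] := eqVneq y 0; first by rewrite pb0l pb0r oppr0.
apply/eqP; rewrite -addr_eq0; apply/eqP.
have : x * (y * (pb x y + pb y x)) = 0.
  have E := pbxx (x * y); rewrite pbM pb_mul_self [x * y]mulrC pb_mul_self in E.
  by apply: (eq_of_comb E); ring.
by case/domS => [/eqP|/domS[/eqP|//]]; rewrite ?(negbTE x0) ?(negbTE y0).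
Qed.

End PoissonDomain.

(** * Growth of the quotients of U and S *)

Section Derivations.
Context (k : fieldType) (B : pzAlgType k).

Lemma commutator_linear a (c : k) (x y : B) :
  a * (c%:K * x + y) - (c%:K * x + y) * a = c%:K * (a * x - x * a) + (a * y - y * a).
Proof. by rewrite mulrDr mulrDl kcst_mulCA opprD addrACA mulrBr -mulrA. Qed.

Lemma commutator_leibniz (a x y : B) :
  a * (x * y) - x * y * a = (a * x - x * a) * y + x * (a * y - y * a).
Proof. by rewrite mulrBl mulrBr !mulrA addrA subrK. Qed.

Lemma ideal_commutator (J : ideal B) a x : J x -> J (a * x - x * a).
Proof. by case: (idealP J) => _ JB Jl Jr Jx; apply: JB; [exact: Jl|exact: Jr]. Qed.

Lemma poisson_linear_r (pb : B -> B -> B) : [pchar k] =i pred0 ->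
  (forall x y : B, x * y = y * x) -> (forall x y : B, x * y = 0 -> x = 0 \/ y = 0) ->
  poisson_bracket pb -> forall z c x y, pb z (c%:K * x + y) = c%:K * pb z x + pb z y.
Proof.
move=> char0 B_comm B_domain [lin pbxx jac leib] z c x y.
pose B' : comPzRingType := HB.pack (PzAlgebra.sort B) (GRing.PzRing_hasCommutativeMul.Build B B_comm).
have antisym u v : pb u v = - pb v u.
  apply: (@poisson_antisymmetric B' pb B_domain) => // [{}x x2|{}x {}y {}z].
    have two0 : (2%:R : k) != 0 by rewrite ((pcharf0P k).1 char0).
    have : (2%:R : k)%:K * x = 0 by rewrite rmorph_nat.
    case/B_domain => // /(congr1 ( *%R ((2%:R : k)^-1)%:K)).
    rewrite mulr0 -kcstM mulVf // kcst1 => one0.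
    by rewrite -[x]mul1r one0 mul0r.
  by have := lin 1 x y z; rewrite kcst1 !mul1r.
by rewrite antisym lin opprD -mulrN -!antisym.
Qed.

End Derivations.

Section Growth.
Context (k : closedFieldType) (char0 : [pchar k] =i pred0) (g : finDimLieType k).
Hypothesis g_simple : simple_lie g.
Context (sigma : lie_aut g) (r : nat) (eta : k).
Hypothesis sigma_r : iter r sigma =1 id.
Hypothesis eta_prim : r.-primitive_root eta.
Local Notation L := (twisted_current sigma eta).

Lemma env_quotient_growth (J : ideal (env_alg L)) : nonzero_ideal J ->
  exists E, forall V : set (quot_alg J), fin_dim V ->
    \forall n \near \oo%classic, (sdim (expS V n) <= n ^ E)%N.
Proof.
pose inU := quot_in (ideal_gen (@env_rel _ L)).
have inU_commutator u v : inU u * inU v - inU v * inU u = inU (lie u v).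
  suff /eqP : inU u * inU v - inU v * inU u - inU (lie u v) = 0 by rewrite subr_eq0 => /eqP.
  rewrite -pi_commutator; apply/pi_eq0; apply: ideal_gen_sub; by exists u, v.
apply: (@growth_of_quotient _ char0 _ _ _ _ sigma_r eta_prim g_simple (env_alg L) inU _ _ _ J
  (fun u x => inU u * x - x * inU u)).
- exact: quot_in_linear.
- exact: quot_in_span.
- by move=> u v; right; exact: inU_commutator.
- by move=> u c x y; exact: commutator_linear.
- by move=> u x y; exact: commutator_leibniz.
- by move=> u v; exact: inU_commutator.
- by move=> u x; exact: ideal_commutator.
Qed.

Lemma sym_quotient_growth pb (I : ideal (sym_alg L)) : kostant_kirillov pb ->
  poisson_ideal pb I -> nonzero_ideal I ->
  exists E, forall V : set (quot_alg I), fin_dim V ->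
    \forall n \near \oo%classic, (sdim (expS V n) <= n ^ E)%N.
Proof.
move=> [pb_poisson pb_in] I_poisson.
apply: (@growth_of_quotient _ char0 _ _ _ _ sigma_r eta_prim g_simple (sym_alg L)
  (quot_in (ideal_gen (@sym_rel _ L))) _ _ _ I (fun u => pb (sym_in u))).
- exact: quot_in_linear.
- exact: quot_in_span.
- by move=> u v; left; exact: inS_comm.
- move=> u; apply: (poisson_linear_r char0 _ _ pb_poisson); first exact: sym_comm.
  exact: (sym_domain char0 sigma_r eta_prim).
- by case: pb_poisson => _ _ _ pbM u x y; exact: pbM.
- exact: pb_in.
- by move=> u x; exact: I_poisson.
Qed.

End Growth.

Theorem theorem3p9 (R : realType) (k : closedFieldType)
    (char0 : [pchar k] =i pred0)
    (g : finDimLieType k) (g_simple : simple_lie g)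
    (sigma : lie_aut g) (sigma_diagram : from_diagram_aut sigma)
    (r : nat) (sigma_order : aut_order sigma r)
    (eta : k) (eta_primitive : r.-primitive_root eta) :
  (just_infinite_growth R (env_alg (twisted_current sigma eta)) /\
   forall J : ideal (env_alg (twisted_current sigma eta)),
     nonzero_ideal J -> polynomial_growth R (quot_alg J))
  /\
  (forall pb, kostant_kirillov (L := twisted_current sigma eta) pb ->
   forall I : ideal (sym_alg (twisted_current sigma eta)),
     poisson_ideal pb I -> nonzero_ideal I ->
     polynomial_growth R (quot_alg I)).
Proof.
have [_ sigma_r _] := sigma_order.
have env_growth J := @env_quotient_growth _ char0 _ g_simple _ _ _ sigma_r eta_primitive J.
split; first split; first split.
- exact: (GKdim_env_infty R char0 g_simple sigma_r eta_primitive).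
- by move=> J /env_growth[E]; exact: GKdim_fin.
- by move=> J /env_growth[E]; exact: polynomial_growth_fin.
move=> pb kk I I_poisson I0.
have [E] := sym_quotient_growth char0 g_simple sigma_r eta_primitive kk I_poisson I0.
exact: polynomial_growth_fin.
Qed.
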